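(* Let $m,m_0$ be nonnegative integers with $m+m_0>0$, let $G$ be a graph, let $k\ge 2$ be an integer, and let $f:V(G)\rightarrow \mathbb{Z}_k$ be a mapping compatible with $G$. If $G$ is $(2m+2m_0+6k-5)$-tree-connected, then $G$ has an $m$-tree-connected factor $H$ with $d_H(v)\equiv f(v)\pmod k$ for every vertex $v$, such that $G\setminus E(H)$ is $m_0$-tree-connected and for each vertex $v$, $$\left\lfloor \frac{d_G(v)}{2}\right\rfloor -(k-1) -m_0\le d_H(v) \le \left\lceil \frac{d_G(v)}{2}\right\rceil+(k-1)+m.$$
   Context: Graphs may have loops and multiple edges. A factor is a spanning subgraph. A graph is $m$-tree-connected if it contains $m$ edge-disjoint spanning trees. For $A\subseteq V(G)$, $e_G(A)$ is the number of edges with both ends in $A$. A mapping $f:V(G)\to\mathbb{Z}_k$ is compatible with $G$ with respect to a partition $X,Y$ of $V(G)$ if either $\sum_{v\in X} f(v)-2x\equiv \sum_{v\in Y}f(v) \pmod k$ for some integer $0\le x\le e_G(X)$, or $\sum_{v\in X} f(v)\equiv \sum_{v\in Y}f(v)-2y \pmod k$ for some integer $0\le y\le e_G(Y)$; $f$ is compatible with $G$ if it is compatible with respect to every partition $X,Y$ of $V(G)$. *)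

(* Defs.v *)
From HB Require Import structures.
From mathcomp Require Import all_boot all_order all_algebra.
Set Implicit Arguments.
Unset Strict Implicit.
Unset Printing Implicit Defensive.
Import GRing.Theory.
Local Open Scope ring_scope.

(* Finite undirected graphs, possibly with loops and multiple edges.  The order
   of the two components of [ends e] carries no meaning: every notion below is
   symmetric in them. *)
Record multigraph := Multigraph {
  vertex :> finType;
  edge : finType;
  ends : edge -> vertex * vertex
}.

Section Multigraph.
Variable G : multigraph.

(* A spanning subgraph (factor) of G is represented by its edge set
   F : {set edge G}; G itself is [set: edge G], and G \ E(F) is ~: F. *)
Implicit Types (F T : {set edge G}) (X Y : {set G}) (x y v : G) (e : edge G).

Definition joins e x y : bool := (ends e == (x, y)) || (ends e == (y, x)).

(* A loop at v contributes 2 to the degree of v. *)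
Definition degree F v : nat :=
  (#|[set e in F | (ends e).1 == v]| + #|[set e in F | (ends e).2 == v]|)%N.

Definition edges_within F X : nat :=
  #|[set e in F | ((ends e).1 \in X) && ((ends e).2 \in X)]|.

Definition adjacent F : rel G := fun x y => [exists e in F, joins e x y].

Definition connected F : Prop := forall x y, connect (adjacent F) x y.

(* The list (v_1, e_1), ..., (v_n, e_n) stands for the closed walk
   v_1 e_1 v_2 e_2 ... v_n e_n v_1; loops are the cycles with n = 1 and pairs of
   parallel edges give the cycles with n = 2. *)
Definition is_cycle F (c : seq (G * edge G)) : Prop :=
  [/\ c <> [::], uniq [seq p.1 | p <- c], uniq [seq p.2 | p <- c],
      all (fun p => p.2 \in F) c
    & cycle (fun p q => joins p.2 p.1 q.1) c].

Definition acyclic F : Prop := forall c, ~ is_cycle F c.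

Definition spanning_tree T : Prop := connected T /\ acyclic T.

(* On a one-vertex graph the edgeless tree may be repeated, so such a graph is
   m-tree-connected for every m. *)
Definition tree_connected (m : nat) F : Prop :=
  exists T : 'I_m -> {set edge G},
    [/\ forall i, T i \subset F,
        forall i, spanning_tree (T i)
      & forall i j, i != j -> [disjoint T i & T j]].

(* For k > 1, 'Z_k is the ring of integers modulo k. *)
Definition compatible_wrt (k : nat) (f : G -> 'Z_k) X Y : Prop :=
  (exists2 x : nat, (x <= edges_within [set: edge G] X)%N
     & \sum_(v in X) f v - 2 * x%:R = \sum_(v in Y) f v) \/
  (exists2 y : nat, (y <= edges_within [set: edge G] Y)%N
     & \sum_(v in X) f v = \sum_(v in Y) f v - 2 * y%:R).

(* Either part of the partition may be empty; this matters on a one-vertex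
   graph, which has no other bipartition. *)
Definition compatible (k : nat) (f : G -> 'Z_k) : Prop :=
  forall X Y, X :|: Y = [set: G] -> [disjoint X & Y] -> compatible_wrt f X Y.

End Multigraph.

(* Main.v *)
(* Let X be a maximum edge cut of G and Y its complement, and let S consist of k-1 edges not crossing
   X, or of all of them if there are fewer.  Each union of components flipped across X cannot enlarge
   the cut, so the given trees make the crossing edges dense enough for matroid union to yield 3k-2
   disjoint connected factors of crossing edges and 2(m+m0)-1 further ones avoiding S.  A T-join inside
   one of the former makes the edges outside S and the remaining crossing factors into an Eulerian
   graph P, and leaves a bipartite graph J all of whose cuts have at least 3k-3 edges.

   An Eulerian orientation of P has m+m0 arc-disjoint spanning branchings by Edmonds' theorem.  Since
   each vertex is entered at most m times by the first m of them, and at most m0 times by the others,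
   an exchange argument along alternating walks gives an F containing the first m and avoiding the
   others with -2 m0 <= 2 d_F - d_P <= 2 m.

   The remaining degrees come from S and J.  Orienting the chosen edges of J from X to Y and the others
   from Y to X turns degrees modulo k into net outdegrees modulo 2k, so J can be handled by the theorem
   of Lovasz, Thomassen, Wu and Zhang on modulo orientations, in a version that also bounds the net
   outdegrees by 2k-1.  Its only global condition is that the prescribed values sum to zero; the edges
   of S meet it, because k-1 of them realize every residue, while if S contains all the edges that do
   not cross X, compatibility of f supplies the numbers of edges to be chosen inside X and inside Y. *)

Require Import Defs.
From HB Require Import structures.
From mathcomp Require Import all_boot all_order all_algebra.
From mathcomp Require Import zify ring.
Set Implicit Arguments.
Unset Strict Implicit.
Unset Printing Implicit Defensive.
Import Order.TTheory GRing.Theory Num.Theory.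
Local Open Scope ring_scope.

(** The constant is 2(3k-2) + (2(m+m0)-1). The factor 2 pays for the maximum cut, which is only
    guaranteed to contain half of the edges of any other cut. Of the 3k-2 crossing factors one is
    spent on the T-join, which leaves 3k-3 for [J]. The orientation theorem asks a cut for 2k-2 plus
    the distance of a residue from the multiples of 2k; this is at most 3k-2, and parity supplies
    the missing unit. Parity also makes 2(m+m0)-1 enough for [P], because Eulerian cuts are even.

    The number k-1 of edges in [S] is forced from two sides. They are attached to an extra vertex of
    degree 2|S|, for which the induction tolerates 2k-2; and the choices from [S] give |S|+1
    consecutive values, which must cover all residues modulo k.

    That extra vertex, with its edges already oriented, is what makes the induction of the
    orientation theorem close: the outside of a set whose cut bound is attained contracts to such a
    vertex. The bound 2k-1 on net outdegrees bounds 2d_H-d_G, so halving and rounding give the k-1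
    of the statement. *)

(** * Distance to the nearest multiple of 2k *)

Section Residue.
Variables (k : int) (k2 : 2 <= k).
Implicit Types a b n : int.

(* Distance from [a] to the nearest multiple of 2k. *)
Definition nrm a : int :=
  let r := (a %% (2 * k))%Z in if r <= k then r else 2 * k - r.

Definition res a : int :=
  let r := (a %% (2 * k))%Z in if r <= k then r else r - 2 * k.

Lemma res_bounds a : - k < res a <= k.
Proof.
have r0 : 0 <= (a %% (2 * k))%Z by apply: modz_ge0; lia.
have r1 : (a %% (2 * k))%Z < 2 * k by apply: ltz_pmod; lia.
by rewrite /res; case: ifP; move: r0 r1 k2; clear; lia.
Qed.

Lemma dvd_res a : (2 * k %| a - res a)%Z.
Proof.
apply/dvdzP; rewrite /res; have := divz_eq a (2 * k).
set r := (a %% _)%Z; set c := (a %/ _)%Z => d.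
by case: ifP => _; [exists c | exists (c + 1)]; rewrite {1}d; clear; lia.
Qed.

Lemma nrm_res a : nrm a = `|res a|.
Proof. by have := res_bounds a; rewrite /nrm /res; case: ifP; clear; lia. Qed.

Lemma nrm_rep a : exists r, [/\ - k < r <= k, (2 * k %| a - r)%Z & nrm a = `|r|].
Proof. by exists (res a); rewrite res_bounds dvd_res nrm_res. Qed.

Lemma dvd_small a : (2 * k %| a)%Z -> `|a| < 2 * k -> a = 0.
Proof.
move=> /dvdzP[c ->] h; have [->|c0] := eqVneq c 0; first by rewrite mul0r.
have : 1 <= `|c| by lia.
rewrite normrM in h; nia.
Qed.

Lemma dvd_small2 a : (2 * k %| a)%Z -> `|a| < 4 * k ->
  [\/ a = 0, a = 2 * k | a = - (2 * k)].
Proof.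
move=> h1 h2; have [a0|a0] := lerP 0 a.
  have [|h] := ltrP a (2 * k); first by move=> h; constructor 1; apply: dvd_small => //; lia.
  constructor 2; apply/eqP; rewrite -subr_eq0; apply/eqP/dvd_small; last lia.
  by rewrite rpredB // dvdzz.
have [|h] := ltrP (- a) (2 * k); first by move=> h; constructor 1; apply: dvd_small => //; lia.
constructor 3; apply/eqP; rewrite -subr_eq0; apply/eqP/dvd_small; last lia.
by rewrite rpredB // rpredN /= dvdzz.
Qed.

Lemma dvdzB_eq d a b c : (d %| a)%Z -> (d %| b)%Z -> c = a - b -> (d %| c)%Z.
Proof. by move=> ha hb ->; rewrite rpredB. Qed.

Lemma dvdzD_eq d a b c : (d %| a)%Z -> (d %| b)%Z -> c = a + b -> (d %| c)%Z.
Proof. by move=> ha hb ->; rewrite rpredD. Qed.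

Lemma nrm_unique a r : (2 * k %| a - r)%Z -> `|r| <= k -> nrm a = `|r|.
Proof.
move=> h hr; have [r' [h1 h2 ->]] := nrm_rep a.
by case: (dvd_small2 (dvdzB_eq h2 h (erefl _))); lia.
Qed.

Lemma nrm_mod a b : (2 * k %| a - b)%Z -> nrm a = nrm b.
Proof.
move=> h; have [r [h1 h2 ->]] := nrm_rep b.
apply: nrm_unique; last lia.
by apply: dvdzD_eq h h2 _; lia.
Qed.

Lemma nrm_small a : `|a| <= k -> nrm a = `|a|.
Proof. by apply: nrm_unique; rewrite subrr dvdz0. Qed.

Lemma nrm_lek a : nrm a <= k.
Proof. by have [r [h _ ->]] := nrm_rep a; lia. Qed.

Lemma nrm_ge0 a : 0 <= nrm a.
Proof. by have [r [h _ ->]] := nrm_rep a; lia. Qed.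

Lemma nrmN a : nrm (- a) = nrm a.
Proof.
have [r [h1 h2 ->]] := nrm_rep a.
rewrite -normrN; apply: nrm_unique; last lia.
by apply: dvdzB_eq (dvdz0 _) h2 _; lia.
Qed.

Lemma nrm_le_abs a : nrm a <= `|a|.
Proof.
have [|h] := lerP `|a| k; first by move/nrm_small->.
by have := nrm_lek a; lia.
Qed.

Lemma nrm_lip a b : nrm (a + b) <= nrm a + `|b|.
Proof.
have [r [h1 h2 ->]] := nrm_rep a.
rewrite (@nrm_mod _ (r + b)); last by rewrite opprD addrACA subrr addr0.
by apply: le_trans (nrm_le_abs _) _; lia.
Qed.

(** The modulus 2k is even, so parity survives reduction. This is what repairs cut inequalities that
    would otherwise fail by one. *)
Lemma nrm_odd a : (2 %| nrm a - a)%Z.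
Proof.
have [r [h1 /dvdzP[c hc] ->]] := nrm_rep a.
apply: (@dvdzB_eq _ (`|r| - r) (a - r)); [lia| |lia].
by rewrite hc dvdz_mull // dvdz_mulr.
Qed.

(* A vertex of degree 2k-2+nrm n can only have one of the two net values nearest to zero. *)
Lemma abs_le_of_nrm n : `|n| <= 2 * k - 2 + nrm n -> `|n| <= 2 * k - 1.
Proof.
have [r [h1 h2 ->]] := nrm_rep n => h.
have : `|n - r| < 4 * k by lia.
by move=> h4; case: (dvd_small2 h2 h4) => h3; move: h1 h h3 {h2 h4}; lia.
Qed.

Definition dvd2k a : bool := (2 * k %| a)%Z.

Lemma nrm_dvd a b : dvd2k (a - b) -> nrm a = nrm b.
Proof. exact: nrm_mod. Qed.
Lemma dvd2k_eq a c : dvd2k a -> c = a -> dvd2k c.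
Proof. by move=> h ->. Qed.
Lemma dvd2kB a b c : dvd2k a -> dvd2k b -> c = a - b -> dvd2k c.
Proof. exact: dvdzB_eq. Qed.
Lemma dvd2kD a b c : dvd2k a -> dvd2k b -> c = a + b -> dvd2k c.
Proof. exact: dvdzD_eq. Qed.
Lemma dvd2kN a : dvd2k (- a) = dvd2k a.
Proof. exact: rpredN. Qed.
Lemma dvd2k0 : dvd2k 0.
Proof. exact: dvdz0. Qed.
Lemma dvd2kk : dvd2k (2 * k).
Proof. exact: dvdzz. Qed.

End Residue.

(** * Vertex sums, cuts and net outdegrees for matrices of multiplicities *)

Section Sums.
Variable V : finType.
Implicit Types (U A B exc : {set V}) (m x : V -> V -> int) (f t p q : V -> int) (u v y z : V).

Definition vsum f A : int := \sum_(v in A) f v.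
(** A multigraph on [U] is a symmetric matrix [m] of multiplicities, and an orientation is a matrix
    [x] where [x u v] counts the arcs from u to v. Splitting off and contraction then need no new
    edge type. Diagonal entries affect neither [cut] nor [net]. *)
Definition cut m U A : int := \sum_(u in A) \sum_(v in U :\: A) m u v.
Definition net x U v : int := \sum_(u in U) (x v u - x u v).
Definition arc y z u v : int := ((u == y) && (v == z))%:Z.
Definition pt y v : int := (v == y)%:Z.

Lemma vsum_pt y A : vsum (pt y) A = (y \in A)%:Z.
Proof.
rewrite /vsum /pt big_mkcond (bigD1 y) //= eqxx big1 ?addr0; first by case: ifP.
by move=> v /negPf ->; case: ifP.
Qed.

Lemma vsumD f g A : vsum (fun v => f v + g v) A = vsum f A + vsum g A.
Proof. exact: big_split. Qed.
Lemma vsumN f A : vsum (fun v => - f v) A = - vsum f A.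
Proof. exact: sumrN. Qed.
Lemma vsumZ c f A : vsum (fun v => c * f v) A = c * vsum f A.
Proof. by rewrite /vsum mulr_sumr. Qed.
Lemma vsum1 f v : vsum f [set v] = f v.
Proof. exact: big_set1. Qed.
Lemma vsum_ge0 f A : (forall v, 0 <= f v) -> 0 <= vsum f A.
Proof. by move=> h; apply: sumr_ge0. Qed.

Lemma vsum_setD f A B : A \subset B -> vsum f (B :\: A) = vsum f B - vsum f A.
Proof.
by move=> s; rewrite /vsum [in RHS](big_setID A) /= (setIidPr s) [in RHS]addrC addrK.
Qed.

Lemma cutD m m' U A : cut (fun u v => m u v + m' u v) U A = cut m U A + cut m' U A.
Proof. by rewrite /cut -big_split; apply: eq_bigr => u _; rewrite -big_split. Qed.
Lemma cutN m U A : cut (fun u v => - m u v) U A = - cut m U A.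
Proof. by rewrite /cut -sumrN; apply: eq_bigr => u _; rewrite -sumrN. Qed.

Lemma arcC y z u v : arc y z u v = arc z y v u.
Proof. by rewrite /arc andbC. Qed.

Lemma arc_ge0 y z u v : 0 <= arc y z u v.
Proof. by []. Qed.

Lemma sum_arc y z A B : \sum_(u in A) \sum_(v in B) arc y z u v = ((y \in A) && (z \in B))%:Z.
Proof.
have -> : \sum_(u in A) \sum_(v in B) arc y z u v = \sum_(u in A) pt y u * (z \in B)%:Z.
  apply: eq_bigr => u _; rewrite -vsum_pt mulr_sumr; apply: eq_bigr => v _.
  by rewrite /arc /pt; do 2!case: eqP.
by rewrite -mulr_suml -/(vsum _ _) vsum_pt; do 2!case: (_ \in _).
Qed.

Lemma cut_arc y z U A : z \in U -> cut (arc y z) U A = ((y \in A) && (z \notin A))%:Z.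
Proof. by move=> zU; rewrite /cut sum_arc inE zU andbT. Qed.

Lemma cutC m U A : (forall u v, m u v = m v u) -> A \subset U -> cut m U (U :\: A) = cut m U A.
Proof.
move=> h s; rewrite /cut exchange_big setDDr setDv set0U (setIidPr s).
by apply: eq_bigr => u _; apply: eq_bigr => v _.
Qed.

Lemma netD x x' U v : net (fun u v => x u v + x' u v) U v = net x U v + net x' U v.
Proof. by rewrite /net -big_split; apply: eq_bigr => u _ /=; lia. Qed.

Lemma netN x U v : net (fun u v => - x u v) U v = - net x U v.
Proof. by rewrite /net -sumrN; apply: eq_bigr => u _ /=; lia. Qed.

Lemma net_arc y z U v : y \in U -> z \in U -> net (arc y z) U v = pt y v - pt z v.
Proof.
move=> yU zU; rewrite /net big_split /= sumrN; congr (_ - _).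
- rewrite -(big_set1 +%R v (fun v => \sum_(u in U) arc y z v u)) /= sum_arc zU andbT.
  by rewrite inE eq_sym.
- rewrite -[RHS](_ : \sum_(u in U) \sum_(w in [set v]) arc y z u w = _).
    by apply: eq_bigr => u _; rewrite big_set1.
  by rewrite sum_arc yU inE eq_sym.
Qed.

Definition del m y z u v : int := m u v - (arc y z u v + arc z y u v).

Lemma cut_del m y z U A : y \in U -> z \in U ->
  cut (del m y z) U A = cut m U A - ((y \in A) != (z \in A))%:Z.
Proof.
move=> yU zU; rewrite /del cutD cutN cutD !cut_arc //.
by do 2!case: (_ \in A).
Qed.

Lemma del_ge0 m y z : (forall u v, 0 <= m u v) -> (forall u v, m u v = m v u) ->
  y != z -> 1 <= m y z -> forall u v, 0 <= del m y z u v.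
Proof.
move=> h hs yz h1 u v; rewrite /del /arc; have := h u v.
have [/andP[/eqP-> /eqP->]|_] := boolP ((u == y) && (v == z)).
  by rewrite (negPf yz) /=; lia.
by have [/andP[/eqP-> /eqP->]|_] := boolP ((u == z) && (v == y)); rewrite ?(hs z); lia.
Qed.

Lemma del_sym m y z : (forall u v, m u v = m v u) -> forall u v, del m y z u v = del m y z v u.
Proof. by move=> hs u v; rewrite /del hs /arc; do 4!case: (_ == _). Qed.

End Sums.

(** * Instances of the modulo orientation problem with one extra vertex *)

Section Core.
Variables (k : int) (k2 : 2 <= k) (V : finType).
Implicit Types (U A B exc : {set V}) (m x : V -> V -> int) (f t p q : V -> int) (u v y z : V).

(* [p v] and [q v] count the edges v -> z0 and z0 -> v to an extra vertex z0 whose edges are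
   already oriented; [exc] is either empty or the one set exempt from the cut condition. *)
Record inst U m t p q exc : Prop := Inst {
  inst_ge0 : forall u v, 0 <= m u v;
  inst_sym : forall u v, m u v = m v u;
  inst_p : forall v, 0 <= p v;
  inst_q : forall v, 0 <= q v;
  inst_par : forall A, A \subset U -> (2 %| vsum t A - cut m U A)%Z;
  inst_sum : dvd2k k (vsum t U);
  inst_root : vsum p U + vsum q U <= 2 * k - 2 + nrm k (vsum p U - vsum q U);
  inst_cut : forall A, A \subset U -> A != set0 -> A != U -> A != exc ->
    2 * k - 2 + nrm k (vsum t A + vsum p A - vsum q A) <= cut m U A + vsum p A + vsum q A;
  inst_exc : exc = set0 \/
    exists2 v, v \in U & exc = [set v] /\ dvd2k k (t v + p v - q v) }.

Definition solvable U m t p q : Prop :=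
  exists x, [/\ forall u v, 0 <= x u v,
    forall u v, u \in U -> v \in U -> u != v -> x u v + x v u = m u v,
    forall v, v \in U -> dvd2k k (net x U v - t v) &
    forall v, v \in U -> `|net x U v + p v - q v| <= 2 * k - 1].

(** No proper set with at least two vertices attains the bound of [inst_cut]; parity excludes the
    value in between. A reduction may therefore cost the cut and the distance of such a set two
    units together, and only singletons need care. *)
Definition slack U m t p q : Prop := forall A, A \subset U -> A != U -> (1 < #|A|)%N ->
  2 * k + nrm k (vsum t A + vsum p A - vsum q A) <= cut m U A + vsum p A + vsum q A.

(** Reversing all arcs exchanges [p] with [q] and negates the targets; this symmetry halves the
    later case analysis. *)
Lemma inst_neg U m t p q exc : inst U m t p q exc -> inst U m (fun v => - t v) q p exc.
Proof.
case=> h1 h2 h3 h4 h5 h6 h7 h8 h9; split=> //.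
- move=> A s; have := h5 A s; rewrite vsumN; lia.
- by rewrite vsumN dvd2kN.
- by rewrite addrC -nrmN // opprB.
- move=> A s1 s2 s3 s4; have := h8 A s1 s2 s3 s4; rewrite vsumN.
  rewrite -(@nrmN k k2 (- _ + _ - _)); set a := nrm _ _; set b := nrm _ _.
  by have -> : a = b by [congr (nrm k _); lia]; lia.
- case: h9 => [->|[v vU [-> h]]]; [by left|right; exists v => //; split=> //].
  by apply: dvd2kB (dvd2k0 k) h _; lia.
Qed.

Lemma slack_neg U m t p q : slack U m t p q -> slack U m (fun v => - t v) q p.
Proof.
move=> h A s1 s2 s3; have := h A s1 s2 s3; rewrite vsumN.
rewrite -(@nrmN k k2 (- _ + _ - _)); set a := nrm _ _; set b := nrm _ _.
by have -> : a = b by [congr (nrm k _); lia]; lia.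
Qed.

Lemma solvable_neg U m t p q : solvable U m (fun v => - t v) q p -> solvable U m t p q.
Proof.
case=> x [h1 h2 h3 h4]; exists (fun u v => x v u).
have hn v : net (fun u v => x v u) U v = - net x U v.
  by rewrite /net -sumrN; apply: eq_bigr => u _; lia.
split=> // [u v uU vU uv|v vU|v vU]; first by rewrite addrC h2.
- by rewrite hn; apply: dvd2kB (dvd2k0 k) (h3 v vU) _; lia.
- by rewrite hn; have := h4 v vU; lia.
Qed.

(** One copy of yz is fixed as an arc from y to z, and a arcs from y and b arcs from z to the extra
    vertex and c arcs from it to z are added. For larger sets [slack] pays for the lost edge and the
    residue shift, and added arcs raise a degree by at least as much as they move a distance. This
    leaves conditions at y, at z and at the extra vertex. *)
Lemma inst_dir U m t p q y z (a b c : int) : inst U m t p q set0 -> slack U m t p q ->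
  y \in U -> z \in U -> y != z -> 1 <= m y z -> 0 <= a -> 0 <= b -> 0 <= c ->
  nrm k (t y + p y - q y - 1 + a) <= nrm k (t y + p y - q y) - 1 + a ->
  nrm k (t z + p z - q z + 1 + b - c) <= nrm k (t z + p z - q z) - 1 + b + c ->
  vsum p U + vsum q U + a + b + c <= 2 * k - 2 + nrm k (vsum p U - vsum q U + a + b - c) ->
  inst U (del m y z) (fun v => t v + (- pt y v + pt z v))
    (fun v => p v + (a * pt y v + b * pt z v)) (fun v => q v + c * pt z v) set0.
Proof.
move=> I sl yU zU yz my a0 b0 c0 hy hz hr; case: I => h1 h2 h3 h4 h5 h6 h7 h8 _.
split.
- exact: del_ge0.
- exact: del_sym.
- by move=> v; rewrite /pt; have := h3 v; do 2!case: (_ == _); lia.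
- by move=> v; rewrite /pt; have := h4 v; case: (_ == _); lia.
- move=> A s; rewrite cut_del // !vsumD vsumN !vsum_pt; have := h5 A s.
  by do 2!case: (_ \in A); rewrite /=; lia.
- by rewrite !vsumD vsumN !vsum_pt yU zU addNr addr0.
- rewrite !vsumD !vsumZ !vsum_pt yU zU !mulr1.
  set n := nrm k _; suff -> : n = nrm k (vsum p U - vsum q U + a + b - c) by lia.
  by congr (nrm k _); lia.
- move=> A s A0 AU _; rewrite cut_del // !vsumD vsumN !vsumZ !vsum_pt.
  have [A1|A1] := ltnP 1 #|A|.
    have := sl A s AU A1.
    set T := vsum t A + _ - _ => h.
    have := nrm_lip k2 T (- (y \in A)%:Z + (z \in A)%:Z + a * (y \in A)%:Z + b * (z \in A)%:Z
      - c * (z \in A)%:Z).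
    set n := nrm k (T + _); set n' := nrm k (_ + (- _ + _) + _ - _).
    have -> : n = n' by congr (nrm k _); rewrite /T; ring.
    move: h a0 b0 c0; do 2!case: (_ \in A) => /=; rewrite ?mulr1 ?mulr0; clear; lia.
  have /cards1P[v Ev] : #|A| == 1 by rewrite eqn_leq A1 card_gt0 A0.
  have := h8 A s A0 AU A0; rewrite Ev !vsum1 !inE.
  have [vy|vy] := eqVneq y v.
    have zv : (z == v) = false by rewrite -vy eq_sym (negPf yz).
    rewrite zv /= -vy; set n := nrm k (_ + (- _ + _) + _ - _).
    by have -> : n = nrm k (t y + p y - q y - 1 + a); [congr (nrm k _); clear; lia | move: hy hz a0 b0 c0; clear; lia].
  have [vz|vz] := eqVneq z v; last by rewrite /= ?mulr0 ?addr0 ?oppr0 ?addr0 ?subr0.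
  rewrite /= -vz; set n := nrm k (_ + (- _ + _) + _ - _).
  by have -> : n = nrm k (t z + p z - q z + 1 + b - c); [congr (nrm k _); clear; lia | move: hy hz a0 b0 c0; clear; lia].
- by left.
Qed.

End Core.

(** * Orienting one edge, or dropping one arc at the extra vertex *)

Section Moves.
Variables (k : int) (k2 : 2 <= k) (V : finType).
Implicit Types (U A B exc : {set V}) (m x : V -> V -> int) (f t p q : V -> int) (u v y z : V) (r n s : int).

(** Restoring the arc and dropping the auxiliary ones respects all congruences, but changes the
    bounded net values at y and z. The two numerical hypotheses say that they stay in range. *)
Lemma solvable_dir U m t p q y z (a b c : int) : (forall u v, m u v = m v u) ->
  y \in U -> z \in U -> y != z ->
  (forall n, dvd2k k (n - (t y + p y - q y - 1 + a)) -> `|n| <= 2 * k - 1 ->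
     `|n + 1 - a| <= 2 * k - 1) ->
  (forall n, dvd2k k (n - (t z + p z - q z + 1 + b - c)) -> `|n| <= 2 * k - 1 ->
     `|n - 1 - b + c| <= 2 * k - 1) ->
  solvable k U (del m y z) (fun v => t v + (- pt y v + pt z v))
    (fun v => p v + (a * pt y v + b * pt z v)) (fun v => q v + c * pt z v) ->
  solvable k U m t p q.
Proof.
move=> ms yU zU yz hy hz [x [h1 h2 h3 h4]].
exists (fun u v => x u v + arc y z u v).
have zy : (z == y) = false by rewrite eq_sym (negPf yz).
split=> [u v|u v uU vU uv|v vU|v vU].
- by rewrite /arc; have := h1 u v; case: (_ && _); lia.
- by have := h2 u v uU vU uv; rewrite /del (arcC z y); lia.
- rewrite netD net_arc //; apply: etrans (h3 v vU); congr (dvd2k k _); lia.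
- rewrite netD net_arc //; have := h4 v vU; have := h3 v vU; rewrite /pt.
  have [->|vy] := eqVneq v y; last have [->|vz] := eqVneq v z; rewrite ?(negPf yz) ?zy ?eqxx.
  + move=> d n; set N := (X in `|X|); rewrite (_ : N = (net x U y + (p y + (a * 1%:Z + b * 0%:Z)) - (q y + c * 0%:Z)) + 1 - a).
      by apply: hy n; apply: etrans d; congr (dvd2k k _); rewrite ?mulr1 ?mulr0; lia.
    by rewrite /N /=; lia.
  + move=> d n; set N := (X in `|X|); rewrite (_ : N = (net x U z + (p z + (a * 0%:Z + b * 1%:Z)) - (q z + c * 1%:Z)) - 1 - b + c).
      by apply: hz n; apply: etrans d; congr (dvd2k k _); rewrite ?mulr1 ?mulr0; lia.
    by rewrite /N /=; lia.
  + by rewrite /= !mulr0; lia.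
Qed.

(** The target [t] inside [U] is kept, so the total target of y drops by one together with its
    degree. At the extra vertex the degree drops by one and the distance by at most one. *)
Lemma inst_rem U m t p q y : inst k U m t p q set0 -> slack k U m t p q -> y \in U ->
  1 <= p y -> nrm k (t y + p y - q y - 1) = nrm k (t y + p y - q y) - 1 ->
  inst k U m t (fun v => p v + - pt y v) q set0.
Proof.
case=> h1 h2 h3 h4 h5 h6 h7 h8 _ sl yU py hy; split=> //.
- move=> v; rewrite /pt; have := h3 v; case: eqP => [->|_] /=; lia.
- rewrite vsumD vsumN vsum_pt yU.
  have := nrm_lip k2 (vsum p U + - true%:Z - vsum q U) 1.
  set n := nrm k (_ + 1); have -> : n = nrm k (vsum p U - vsum q U) by congr (nrm k _); lia.
  by rewrite /=; lia.
- move=> A s A0 AU _; rewrite vsumD vsumN vsum_pt.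
  have [A1|A1] := ltnP 1 #|A|.
    have := sl A s AU A1; have := nrm_lip k2 (vsum t A + vsum p A - vsum q A) (- (y \in A)%:Z).
    set n := nrm k (_ + - _); set n' := nrm k (_ + (_ + - _) - _).
    have -> : n = n' by congr (nrm k _); lia.
    by case: (_ \in A) => /=; lia.
  have /cards1P[v Ev] : #|A| == 1%N by rewrite eqn_leq A1 card_gt0 A0.
  have := h8 A s A0 AU A0; rewrite Ev !vsum1 !inE.
  have [vy|vy] := eqVneq y v; last by rewrite /= oppr0 !addr0.
  rewrite -vy; set n := nrm k (_ + (_ + - _) - _).
  by have -> : n = nrm k (t y + p y - q y - 1); [congr (nrm k _); lia | lia].
- by left.
Qed.

Lemma solvable_rem U m t p q y : y \in U ->
  (forall n, dvd2k k (n - (t y + p y - q y - 1)) -> `|n| <= 2 * k - 1 ->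
     `|n + 1| <= 2 * k - 1) ->
  solvable k U m t (fun v => p v + - pt y v) q -> solvable k U m t p q.
Proof.
move=> yU hy [x [h1 h2 h3 h4]]; exists x; split=> // v vU.
have := h4 v vU; have := h3 v vU; rewrite /pt; case: eqP => [->|_] d n /=; last by lia.
suff -> : net x U y + p y - q y = net x U y + (p y + - true%:Z) - q y + 1 by
  apply: hy n; apply: etrans d; congr (dvd2k k _); lia.
by rewrite /=; lia.
Qed.

(* Shifting by one a net value that is congruent to [r] with [0 < |r|] keeps it among the two nearest. *)
Lemma near_add1 r n s : - k < r <= k -> dvd2k k (s - r) -> 0 < r ->
  dvd2k k (n - (s - 1)) -> `|n| <= 2 * k - 1 -> `|n + 1| <= 2 * k - 1.
Proof.
move=> hr d r0 e hn.
have : dvd2k k (n - (r - 1)) by apply: dvd2kD e d _; lia.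
move=> {}e; have : `|n - (r - 1)| < 4 * k by lia.
by move=> h; case: (dvd_small2 k2 e h) => h'; move: hr r0 hn h' {e d}; lia.
Qed.

Lemma near_sub1 r n s : - k < r <= k -> dvd2k k (s - r) -> r < 0 \/ r = k ->
  dvd2k k (n - (s + 1)) -> `|n| <= 2 * k - 1 -> `|n - 1| <= 2 * k - 1.
Proof.
move=> hr d r0 e hn.
have : dvd2k k (n - (r + 1)) by apply: dvd2kD e d _; lia.
move=> {}e; have : `|n - (r + 1)| < 4 * k by lia.
by move=> h; case: (dvd_small2 k2 e h) => h'; move: hr r0 hn h' {e d}; lia.
Qed.

Lemma nrm_sub1 r s : - k < r <= k -> dvd2k k (s - r) -> 0 < r -> nrm k (s - 1) = nrm k s - 1.
Proof.
move=> hr d r0; have -> : nrm k s = `|r| by apply: (nrm_unique k2 d); lia.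
rewrite (@nrm_unique k k2 _ (r - 1)); [lia| |lia].
by apply: etrans d; congr (dvd2k k _); lia.
Qed.

(** The residue k qualifies as well, being congruent to -k: a vertex of residue k can serve as
    either end of a newly fixed arc. *)
Lemma nrm_add1 r s : - k < r <= k -> dvd2k k (s - r) -> r < 0 \/ r = k ->
  nrm k (s + 1) = nrm k s - 1.
Proof.
move=> hr d r0; have -> : nrm k s = `|r| by apply: (nrm_unique k2 d); lia.
case: r0 => r0.
  rewrite (@nrm_unique k k2 _ (r + 1)); [lia| |lia].
  by apply: etrans d; congr (dvd2k k _); lia.
rewrite (@nrm_unique k k2 _ (r + 1 - 2 * k)); [lia| |lia].
by apply: (dvd2kD d (dvd2kk k)); lia.
Qed.

End Moves.

(** * Splitting off at the exempt vertex *)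

Section Lifts.
Variables (k : int) (k2 : 2 <= k) (V : finType).
Implicit Types (U A B exc : {set V}) (m x : V -> V -> int) (f t p q : V -> int) (u v y z e : V).

Definition lift m e y z := del (del (fun u v => m u v + (arc y z u v + arc z y u v)) e y) e z.

Lemma liftE m e y z u v : lift m e y z u v = m u v + (arc y z u v + arc z y u v)
  - (arc e y u v + arc y e u v) - (arc e z u v + arc z e u v).
Proof. by []. Qed.

Lemma cut_lift m e y z U A : e \in U -> y \in U -> z \in U ->
  cut (lift m e y z) U A = cut m U A + ((y \in A) != (z \in A))%:Z
    - ((e \in A) != (y \in A))%:Z - ((e \in A) != (z \in A))%:Z.
Proof.
move=> eU yU zU; rewrite !cut_del // cutD cutD !cut_arc //.
by do 3!case: (_ \in A).
Qed.

(** Splitting off changes no degree except that of e, whose singleton is exempt; larger sets lose at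
    most two edges, which [slack] allows. *)
Lemma inst_lift U m t p q e y z : inst k U m t p q [set e] -> slack k U m t p q ->
  e \in U -> y \in U -> z \in U -> e != y -> e != z -> y != z -> 1 <= m e y -> 1 <= m e z ->
  inst k U (lift m e y z) t p q [set e].
Proof.
case=> h1 h2 h3 h4 h5 h6 h7 h8 h9 sl eU yU zU ey ez yz my mz.
have ss u v : m u v + (arc y z u v + arc z y u v) = m v u + (arc y z v u + arc z y v u).
  by rewrite h2 /arc; do 4!case: (_ == _).
split=> //.
- have h u v : 0 <= m u v + (arc y z u v + arc z y u v).
    by rewrite addr_ge0 // addr_ge0 // arc_ge0.
  apply: del_ge0 => //; [apply: del_ge0 => // | exact: del_sym | ].
    by move: my; rewrite /arc (negPf ey) (negPf ez); lia.
  by rewrite /del /arc (eq_sym z y) (negPf yz) (negPf ey) (negPf ez) ?andbF /=; lia.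
- by apply: del_sym; apply: del_sym.
- move=> A s; rewrite cut_lift //; have := h5 A s.
  by do 3!case: (_ \in A) => /=; clear; lia.
- move=> A s A0 AU Ae; have := h8 A s A0 AU Ae; rewrite cut_lift //.
  have [A1|A1] := ltnP 1 #|A|.
    have := sl A s AU A1.
    by do 3!case: (_ \in A) => /=; clear; lia.
  have /cards1P[v Ev] : #|A| == 1%N by rewrite eqn_leq A1 card_gt0 A0.
  move: Ae; rewrite Ev !inE; have [->|ve _] := eqVneq e v; first by rewrite eqxx.
  have [yv|_] := eqVneq y v; last by case: (z == v) => /=; clear; lia.
  have -> : (z == v) = false by rewrite -yv eq_sym (negPf yz).
  by rewrite /=; clear; lia.
Qed.

Lemma solvable_lift U m t p q e y z : (forall u v, 0 <= m u v) -> (forall u v, m u v = m v u) ->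
  e \in U -> y \in U -> z \in U -> e != y -> e != z -> y != z ->
  solvable k U (lift m e y z) t p q -> solvable k U m t p q.
Proof.
move=> ms msym eU yU zU ey ez yz [x [h1 h2 h3 h4]].
have {h2}h2 u v : u \in U -> v \in U -> u != v -> x u v + x v u = lift m e y z u v by exact: h2.
(* At least one copy of yz exists after splitting off, so some arc joins y and z; by symmetry it
   goes from y to z and is rerouted through e, which changes no net value. *)
wlog xyz : y z yU zU ey ez yz h2 / 1 <= x y z.
  move=> H; have [|xyz] := lerP 1 (x y z); first exact: H.
  apply: (H z y) => //; rewrite 1?eq_sym //.
    move=> u v uU vU uv; rewrite h2 //= !liftE.
    by clear; lia.
  have := h2 y z yU zU yz; rewrite liftE /arc !eqxx (eq_sym z y) (eq_sym y e) (eq_sym z e).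
  by rewrite (negPf yz) (negPf ey) (negPf ez) /=; have := ms y z; have := h1 y z; have := h1 z y; lia.
exists (fun u v => x u v + (- arc y z u v + (arc y e u v + arc e z u v))).
have nE v : net (fun u v => x u v + (- arc y z u v + (arc y e u v + arc e z u v))) U v = net x U v.
  by rewrite !netD netN !net_arc //; lia.
split=> [u v|u v uU vU uv|v vU|v vU]; rewrite ?nE; [|  | exact: h3 | exact: h4].
- have := h1 u v; rewrite /arc.
  have [/andP[/eqP-> /eqP->]|_] := boolP ((u == y) && (v == z)); last by do 2!case: (_ && _); lia.
  by rewrite eqxx (eq_sym y e) (negPf ey) (eq_sym z e) (negPf ez) /=; lia.
- have := h2 u v uU vU uv; rewrite liftE !(arcC _ _ v u); clear; lia.
Qed.

(** Splitting off where one of the two edges goes to the extra vertex: an edge ye and an arc from e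
    become one arc from y. The total [t + p - q] is unchanged at every vertex. *)
Lemma inst_slide U m t p q e y : inst k U m t p q [set e] -> slack k U m t p q ->
  e \in U -> y \in U -> e != y -> 1 <= m e y -> 1 <= p e ->
  inst k U (del m e y) (fun v => t v + (- pt y v + pt e v)) (fun v => p v + (- pt e v + pt y v)) q
    [set e].
Proof.
case=> h1 h2 h3 h4 h5 h6 h7 h8 h9 sl eU yU ey my pe.
split=> //.
- exact: del_ge0.
- exact: del_sym.
- by move=> v; rewrite /pt; have := h3 v; case: (eqVneq v e) => [->|_]; case: (_ == _) => /=; lia.
- move=> A s; rewrite cut_del // !vsumD vsumN !vsum_pt; have := h5 A s.
  by do 2!case: (_ \in A); rewrite /=; lia.
- by rewrite !vsumD vsumN !vsum_pt yU eU addNr addr0.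
- by rewrite !vsumD vsumN !vsum_pt yU eU addNr addr0.
- move=> A s A0 AU Ae; have := h8 A s A0 AU Ae; rewrite cut_del // !vsumD !vsumN !vsum_pt.
  set n := nrm k _; set n' := nrm k (_ + (- _ + _) + _ - _).
  have -> : n' = n by congr (nrm k _); clear; lia.
  have [A1|A1] := ltnP 1 #|A|.
    by have := sl A s AU A1; rewrite -/n; do 2!case: (_ \in A) => /=; clear; lia.
  have /cards1P[v Ev] : #|A| == 1%N by rewrite eqn_leq A1 card_gt0 A0.
  move: Ae; rewrite Ev !inE; have [->|ve _] := eqVneq e v; first by rewrite eqxx.
  by case: (y == v) => /=; clear; lia.
- right; case: h9 => [/setP/(_ e)|[v vU [/set1_inj<- d]]]; first by rewrite !inE eqxx.
  exists e => //; split=> //; apply: etrans d; congr (dvd2k k _).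
  by rewrite /pt eqxx (negPf ey) /=; lia.
Qed.

Lemma solvable_slide U m t p q e y : (forall u v, m u v = m v u) ->
  e \in U -> y \in U -> e != y ->
  solvable k U (del m e y) (fun v => t v + (- pt y v + pt e v))
    (fun v => p v + (- pt e v + pt y v)) q ->
  solvable k U m t p q.
Proof.
move=> ms eU yU ey [x [h1 h2 h3 h4]].
exists (fun u v => x u v + arc y e u v).
split=> [u v|u v uU vU uv|v vU|v vU].
- by rewrite /arc; have := h1 u v; case: (_ && _); lia.
- by have := h2 u v uU vU uv; rewrite /del (arcC e y); clear; lia.
- by rewrite netD net_arc //; apply: etrans (h3 v vU); congr (dvd2k k _); lia.
- by rewrite netD net_arc //; apply: etrans (h4 v vU); congr (`|_| <= _); lia.
Qed.

End Lifts.

(** * Deleting an exempt vertex with a single neighbour *)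

Section Deletion.
Variables (k : int) (k2 : 2 <= k) (V : finType).
Implicit Types (U A B exc : {set V}) (m x : V -> V -> int) (f t p q : V -> int) (u v y z e : V).

Lemma vsumD1 f e U : e \in U -> vsum f (U :\ e) = vsum f U - f e.
Proof. by move=> eU; rewrite vsum_setD ?sub1set // vsum1. Qed.

Lemma cut_remove m U A e : e \in U -> e \notin A ->
  cut m (U :\ e) A = cut m U A - vsum (fun u => m u e) A.
Proof.
move=> eU eA; rewrite /cut /vsum -sumrB; apply: eq_bigr => u _.
rewrite [in RHS](big_setD1 e) /=; last by rewrite inE eA.
rewrite addrC addrK; apply: eq_bigl => v; rewrite !inE.
by case: (v == e); rewrite ?andbF ?andbT.
Qed.

Lemma cut_setU1 m U A e : e \notin A ->
  cut m U (e |: A) = cut m (U :\ e) A + vsum (m e) (U :\: (e |: A)).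
Proof.
move=> eA; rewrite /cut big_setU1 //= addrC; congr (_ + _).
by apply: eq_bigr => u _; apply: eq_bigl => v; rewrite !inE negb_or -andbA andbCA.
Qed.

Lemma net_remove x U e v : e \in U -> net x U v = net x (U :\ e) v + (x v e - x e v).
Proof. by move=> eU; rewrite /net (big_setD1 e) //= addrC. Qed.

(** A set containing y has the same cut without e as its union with e has in [U], and a set avoiding
    y loses no edge. The multiplicity of ey is even because the target of e vanishes modulo 2k and
    parity holds at the singleton of e. *)
Lemma inst_remove U m t p q e y : inst k U m t p q [set e] -> e \in U ->
  p e = 0 -> q e = 0 -> (forall v, v \in U -> v != e -> v != y -> m e v = 0) -> y != e ->
  y \in U ->
  inst k (U :\ e) m t p q set0 /\ (2 %| m e y)%Z.
Proof.
case=> h1 h2 h3 h4 h5 h6 h7 h8 h9 eU pe qe me ye yU.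
have te : dvd2k k (t e).
  case: h9 => [/setP/(_ e)|[v vU [/set1_inj<- d]]]; first by rewrite !inE eqxx.
  by apply: dvd2k_eq d _; rewrite pe qe; lia.
have cut0 A : A \subset U -> e \notin A -> y \notin A -> vsum (m e) A = 0.
  move=> /subsetP s eA yA; apply: big1 => v vA; apply: me; first exact: s.
    by apply: contraNneq eA => <-.
  by apply: contraNneq yA => <-.
have cut1 A : A \subset U -> e \notin A -> vsum (m e) A = (y \in A)%:Z * m e y.
  move=> s eA; have [yA|yA] := boolP (y \in A); last by rewrite cut0 // mul0r.
  rewrite /vsum (big_setD1 y) //= -/(vsum _ _) cut0 ?addr0 ?mul1r //.
  - by apply: subset_trans s; apply: subD1set.
  - by rewrite !inE (negPf eA) andbF.
  - by rewrite !inE eqxx.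
have mE : (2 %| m e y)%Z.
  have := h5 [set e]; rewrite sub1set => /(_ eU); rewrite vsum1 /cut big_set1 -/(vsum _ _).
  rewrite cut1 ?subsetDl ?inE ?eqxx // ye yU mul1r => /dvdzP[c hc].
  have /dvdzP[c' hc'] := te.
  by apply/dvdzP; exists (c' * k - c); lia.
split=> //.
have s1 A : A \subset U :\ e -> A \subset U by move/subset_trans; apply; apply: subD1set.
have s2 A : A \subset U :\ e -> e \notin A by rewrite subsetD1 => /andP[].
split=> //.
- move=> A s; rewrite cut_remove ?s2 //.
  have -> : vsum (fun u => m u e) A = (y \in A)%:Z * m e y.
    by rewrite -cut1 ?s1 ?s2 //; apply: eq_bigr => u _.
  by move: (h5 A (s1 A s)) mE; clear; case: (y \in A); rewrite ?mul1r ?mul0r; lia.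
- by rewrite vsumD1 //; apply: dvd2kB h6 te _.
- by rewrite !vsumD1 // pe qe !subr0.
- move=> A s A0 AU _; have sU := s1 A s; have eA := s2 A s.
  have [yA|yA] := boolP (y \in A); last first.
    rewrite cut_remove //; have -> : vsum (fun u => m u e) A = 0.
      by rewrite -(@cut0 A) //; apply: eq_bigr => u _.
    rewrite subr0; apply: h8 => //; first by apply: contraNneq eA => ->.
    by apply: contraNneq eA => ->; rewrite inE.
  have := h8 (e |: A); rewrite cut_setU1 // cut0 ?addr0; last first.
  + by rewrite !inE yA orbT.
  + by rewrite !inE eqxx.
  + exact: subsetDl.
  rewrite subUset sub1set eU sU => /(_ isT).
  have VE f : vsum f (e |: A) = f e + vsum f A by rewrite /vsum big_setU1.
  rewrite !VE pe qe !add0r => H; have {H} := H _ _ _.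
  set n := nrm k _; set n' := nrm k _ => H.
  have <- : n = n'.
    by apply: nrm_dvd => //; apply: dvd2k_eq te _; clear; lia.
  apply: H.
  + by apply/set0Pn; exists e; rewrite !inE eqxx.
  + by apply: contraNneq AU => <-; rewrite setU1K.
  + apply: contraTneq yA => /setP/(_ y); rewrite !inE (negPf ye) /= => ->; exact: isT.
- by left.
Qed.

(** All multiplicities at e are even, so half of the copies can go each way and e gets net value
    zero without disturbing its neighbours. *)
Lemma solvable_remove U m t p q e : inst k U m t p q [set e] -> e \in U ->
  p e = 0 -> q e = 0 -> (forall v, v \in U -> (2 %| m e v)%Z || (v == e)) ->
  solvable k (U :\ e) m t p q -> solvable k U m t p q.
Proof.
case=> h1 h2 _ _ _ _ _ _ h9 eU pe qe me [x [x1 x2 x3 x4]].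
have te : dvd2k k (t e).
  case: h9 => [/setP/(_ e)|[v vU [/set1_inj<- d]]]; first by rewrite !inE eqxx.
  by apply: dvd2k_eq d _; rewrite pe qe; lia.
pose x' u v := if (u == e) || (v == e) then (m u v %/ 2)%Z else x u v.
have xe v : x' v e = x' e v by rewrite /x' eqxx orbT h2.
have nE v : v \in U -> v != e -> net x' U v = net x (U :\ e) v.
  move=> vU ve; rewrite (net_remove _ _ eU) xe subrr addr0.
  by apply: eq_bigr => u; rewrite !inE => /andP[/negPf ue _]; rewrite /x' (negPf ve) ue.
have ne : net x' U e = 0 by apply: big1 => u _; rewrite xe subrr.
exists x'; split.
- by move=> u v; rewrite /x'; case: ifP => // _; have := h1 u v; lia.
- move=> u v uU vU uv; rewrite /x' (orbC (v == e)); case: ifP => [/orP[/eqP E|/eqP E]|/norP[ue ve]].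
  + have := me v vU; rewrite E (h2 v) eq_sym -E (negPf uv) orbF => d.
    by move: d; clear; lia.
  + have := me u uU; rewrite E (h2 u) -E (negPf uv) orbF => d.
    by move: d; clear; lia.
  + by apply: x2 => //; rewrite !inE ?ue ?ve.
- move=> v vU; have [->|ve] := eqVneq v e; first by rewrite ne sub0r dvd2kN.
  by rewrite nE // x3 // !inE ve.
- move=> v vU; have [->|ve] := eqVneq v e; first by rewrite ne pe qe; lia.
  by rewrite nE // x4 // !inE ve.
Qed.

End Deletion.

(** * Contracting a tight set and solving inside it *)

Section Contraction.
Variables (k : int) (k2 : 2 <= k) (V : finType).
Implicit Types (U A B exc : {set V}) (m x g : V -> V -> int) (f t p q : V -> int) (u v y z e : V).

Lemma vsum_split A U f : A \subset U -> vsum f U = vsum f (U :\: A) + vsum f A.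
Proof. by move=> s; rewrite vsum_setD // subrK. Qed.

(** Undoes a contraction: the arcs from an outside vertex to the contracted one are spread over the
    vertices of the set within the available multiplicities. *)
Lemma distribute A f (n : int) : (forall v, 0 <= f v) -> 0 <= n <= vsum f A ->
  exists h : V -> int, (forall v, 0 <= h v <= f v) /\ vsum h A = n.
Proof.
move=> f0; move cA: #|A| => c; elim: c A cA n => [|c IH] A cA n.
  have -> : A = set0 by apply/eqP; rewrite -cards_eq0 cA.
  rewrite /vsum big_set0 => hn; exists (fun=> 0); rewrite big_set0.
  by split=> [v|]; [rewrite lexx f0|lia].
have /set0Pn[v vA] : A != set0 by rewrite -card_gt0 cA.
have s (h : V -> int) : vsum h A = vsum h (A :\ v) + h v by rewrite vsumD1 // subrK.
rewrite s => /andP[n0 n1].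
have cA' : #|A :\ v| = c by move: cA; rewrite (cardsD1 v) vA; lia.
have S0 := vsum_ge0 (A :\ v) f0; have fv := f0 v.
have [|g [g1 g2]] := IH _ cA' (n - Num.min n (f v)).
  by move: n0 n1 S0 fv; clear; lia.
exists (fun u => if u == v then Num.min n (f v) else g u); split.
  by move=> u; case: eqP => [->|_]; [move: n0 fv; clear; lia|exact: g1].
rewrite s eqxx; set S := vsum _ _; suff -> : S = vsum g (A :\ v) by rewrite g2; lia.
by apply: eq_bigr => u; rewrite !inE => /andP[/negPf->].
Qed.

Section Quotient.
Variables (U A : {set V}) (a : V).
Hypotheses (sAU : A \subset U) (aA : a \in A).

(** [A] is contracted onto its own element [a], so all instances of the induction live on the same
    type. *)
Let phi u := if u \in A then a else u.
Definition quo := a |: (U :\: A).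
Definition qsum f u : int := \sum_(x in U | phi x == u) f x.
Definition qmul m u v : int := \sum_(x in U | phi x == u) \sum_(y in U | phi y == v) m x y.
Let pre B := [set x in U | phi x \in B].

Lemma phi_quo u : u \in U -> phi u \in quo.
Proof. by rewrite /phi !inE; case: ifP => [_|-> ->]; rewrite ?eqxx ?orbT. Qed.

Lemma phi_id u : u \in quo -> phi u = u.
Proof. by rewrite /phi !inE => /orP[/eqP->|/andP[/negPf-> _]//]; rewrite aA. Qed.

Lemma quo_sub : quo \subset U.
Proof. by rewrite subUset sub1set (subsetP sAU) //= subsetDl. Qed.

Lemma card_quo : #|quo| = (#|U| - #|A|).+1.
Proof. by rewrite cardsU1 !inE aA /= cardsD (setIidPr sAU). Qed.

Lemma vsum_quo f B : vsum (qsum f) B = vsum f (pre B).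
Proof.
rewrite /vsum [RHS](partition_big phi (mem B)) /=; last by move=> x; rewrite inE => /andP[].
apply: eq_bigr => u uB; apply: eq_bigl => x; rewrite !inE.
by case: eqP => [->|]; rewrite ?uB ?andbT ?andbF.
Qed.

Lemma cut_quo m B : B \subset quo -> cut (qmul m) quo B = cut m U (pre B).
Proof.
move=> s; rewrite /cut [RHS](partition_big phi (mem B)) /=; last by move=> x; rewrite inE => /andP[].
apply: eq_bigr => u uB; rewrite exchange_big /=.
apply: eq_big => [x|x _].
  by rewrite !inE; case: eqP => [->|]; rewrite ?uB ?andbT ?andbF.
rewrite [RHS](partition_big phi (mem (quo :\: B))) /=; last first.
  by move=> y; rewrite !inE negb_and andbC => /andP[yU]; rewrite yU /= => ->; have := phi_quo yU; rewrite !inE.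
apply: eq_bigr => v; rewrite inE => /andP[vB _]; apply: eq_bigl => y; rewrite !inE.
by case: (y \in U); case: eqP => [->|]; rewrite ?(negPf vB) ?andbT ?andbF.
Qed.

Lemma pre_set1 u : u \in U -> u \notin A -> pre [set u] = [set u].
Proof.
move=> uU uA; apply/setP => x; rewrite !inE /phi; case: ifP => xA; last first.
  by case: eqP => [->|]; rewrite ?uU ?andbF.
have [ux|_] := eqVneq x u; first by rewrite ux (negPf uA) in xA.
by case: eqP => [E|]; rewrite ?andbF //; rewrite -E aA in uA.
Qed.

Lemma pre_a : pre [set a] = A.
Proof.
apply/setP => x; rewrite !inE /phi; case: ifP => xA; first by rewrite eqxx (subsetP sAU).
by case: eqP => [E|]; rewrite ?andbF //; rewrite E aA in xA.
Qed.

Lemma qsum_a f : qsum f a = vsum f A.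
Proof. by rewrite -[LHS](vsum1 (qsum f)) vsum_quo pre_a. Qed.

Lemma qsum_id f u : u \in U -> u \notin A -> qsum f u = f u.
Proof. by move=> uU uA; rewrite -[LHS](vsum1 (qsum f)) vsum_quo pre_set1 // vsum1. Qed.

Lemma qmul_a m u : u \in U -> u \notin A -> qmul m u a = vsum (m u) A.
Proof.
move=> uU uA; rewrite -(qsum_a (m u)) -(qsum_id (fun w : V => qsum (m w) a) uU uA).
by [].
Qed.

Lemma qmul_id m u v : u \in U -> u \notin A -> v \in U -> v \notin A -> qmul m u v = m u v.
Proof.
move=> uU uA vU vA; rewrite -(qsum_id (m u) vU vA) -(qsum_id (fun w : V => qsum (m w) v) uU uA).
by [].
Qed.

(** Cuts of the quotient are cuts of [U], by taking preimages. An exempt vertex inside [A] leaves no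
    exemption behind: a preimage contains [A] or avoids it, and [A] has at least two elements. *)
Lemma inst_quo m t p q exc : inst k U m t p q exc -> (1 < #|A|)%N ->
  inst k quo (qmul m) (qsum t) (qsum p) (qsum q) (exc :\: A).
Proof.
case=> h1 h2 h3 h4 h5 h6 h7 h8 h9 A1.
have preU : pre quo = U.
  by apply/setP => x; rewrite !inE; case xU: (x \in U) => //=; rewrite -(phi_quo xU) !inE.
have preS B : pre B \subset U by apply/subsetP => x; rewrite inE => /andP[].
split.
- by move=> u v; apply: sumr_ge0 => x _; apply: sumr_ge0.
- move=> u v; rewrite /qmul exchange_big.
  by apply: eq_bigr => x _; apply: eq_bigr => y _.
- by move=> v; apply: sumr_ge0.
- by move=> v; apply: sumr_ge0.
- by move=> B s; rewrite vsum_quo cut_quo //; apply: h5.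
- by rewrite vsum_quo preU.
- by rewrite !vsum_quo preU.
- move=> B s B0 BU Be; rewrite !vsum_quo cut_quo //.
  have sB u : u \in B -> u \in pre B.
    by move=> uB; rewrite inE (phi_id (subsetP s _ uB)) uB (subsetP quo_sub) // (subsetP s).
  apply: h8 => //.
  + by have /set0Pn[u uB] := B0; apply/set0Pn; exists u; exact: sB.
  + apply: contraNneq BU => E; rewrite eqEsubset s; apply/subsetP => u uq.
    by have := subsetP quo_sub _ uq; rewrite -E inE (phi_id uq) => /andP[].
  + apply: contraNneq Be => E; have {}h9 : #|exc| = 0%N \/ #|exc| = 1%N.
      by case: h9 => [->|[v _ [-> _]]]; rewrite ?cards0 ?cards1; [left|right].
    have aB : a \notin B.
      apply/negP => aB; have : A \subset exc.
        by rewrite -E; apply/subsetP => x xA; rewrite inE /phi xA aB (subsetP sAU).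
      by move/subset_leq_card; case: h9 => ->; lia.
    have BA u : u \in B -> u \notin A.
      move=> uB; have := phi_id (subsetP s _ uB); rewrite /phi; case: ifP => // _ E'.
      by rewrite -E' (negPf aB) in uB.
    rewrite -E; apply/eqP/setP => x; rewrite !inE /phi.
    case: ifP => xA /=; first by apply/negbTE; apply: contraL xA; exact: BA.
    case xB: (x \in B); rewrite ?andbF // (subsetP (subset_trans s quo_sub)) //.
- case: h9 => [->|[v vU [-> d]]]; first by left; rewrite set0D.
  have [vA|vA] := boolP (v \in A).
    by left; apply/eqP; rewrite setD_eq0 sub1set.
  right; exists v; first by rewrite !inE vU vA orbT.
  split; last by rewrite !qsum_id.
  by apply/setP => x; rewrite !inE; case: eqP => [->|]; rewrite ?andbF ?vA.
Qed.

End Quotient.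

Section Inside.
Variables (U A : {set V}) (m g : V -> V -> int).
Hypotheses (sAU : A \subset U) (g0 : forall u v, 0 <= g u v <= m u v).
(** For v in [A], [N v] counts the edges to the outside and [G v] those already oriented towards v;
    the remaining [N v - G v] leave v. *)
Let N v := vsum (m v) (U :\: A).
Let G v : int := \sum_(u in U :\: A) g u v.

Lemma cut_inside B : B \subset A -> cut m U B = cut m A B + vsum N B.
Proof.
move=> s; rewrite /cut /vsum -big_split; apply: eq_bigr => u _ /=.
rewrite -!/(vsum _ _) (vsum_split (m u) (setSD B sAU)) addrC; congr (_ + _); rewrite /N; congr (vsum _ _).
apply/setP => x; rewrite !inE negb_and negbK.
case xB: (x \in B) => /=; last by [].
by rewrite (subsetP s) ?andbF.
Qed.

(** The outside of [A] is merged into the extra vertex, with the orientation inherited from the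
    quotient. Tightness of [A] is exactly the bound [inst_root] for this vertex, and the cuts of
    subsets of [A] are those in [U]. *)
Lemma inst_inside t p q exc : inst k U m t p q exc -> A != U ->
  cut m U A + vsum p A + vsum q A <= 2 * k - 2 + nrm k (vsum t A + vsum p A - vsum q A) ->
  dvd2k k (vsum N A - 2 * vsum G A - vsum t A) ->
  inst k A m (fun v => t v + (- N v + 2 * G v)) (fun v => p v + (N v - G v))
    (fun v => q v + G v) (exc :&: A).
Proof.
case=> h1 h2 h3 h4 h5 h6 h7 h8 h9 AU tight dA.
have msym u v : m u v = m v u by [].
have G0 v : 0 <= G v by apply: sumr_ge0 => u _; case/andP: (g0 u v).
have GN v : G v <= N v.
  by apply: ler_sum => u _; rewrite msym; case/andP: (g0 u v).
have tE B : vsum (fun v => t v + (- N v + 2 * G v)) B = vsum t B - vsum N B + 2 * vsum G B.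
  by rewrite !vsumD vsumN vsumZ addrA.
have pE B : vsum (fun v => p v + (N v - G v)) B = vsum p B + vsum N B - vsum G B.
  by rewrite !vsumD vsumN addrA.
have qE B : vsum (fun v => q v + G v) B = vsum q B + vsum G B by rewrite vsumD.
split=> //.
- by move=> v; rewrite addr_ge0 // subr_ge0.
- by move=> v; rewrite addr_ge0.
- move=> B s; rewrite tE; have := h5 B (subset_trans s sAU); rewrite cut_inside //.
  by clear; lia.
- by rewrite tE; apply: dvd2kB (dvd2k0 k) dA _; clear; lia.
- rewrite pE qE; have E : cut m U A = vsum N A by [].
  rewrite E in tight.
  set n := nrm k _; have -> : n = nrm k (vsum t A + vsum p A - vsum q A).
    by apply: nrm_dvd => //; apply: dvd2k_eq dA _; clear; lia.
  by move: tight; clear; lia.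
- move=> B s B0 BA Be; rewrite tE pE qE.
  have := h8 B (subset_trans s sAU) B0; rewrite cut_inside //.
  set n := nrm k _; set n' := nrm k (_ + _ + _ - _).
  have -> : n' = n by congr (nrm k _); clear; lia.
  move=> H; suff : 2 * k - 2 + n <= cut m A B + vsum N B + vsum p B + vsum q B by clear; lia.
  apply: H.
  + by apply: contraNneq AU => E; rewrite eqEsubset sAU -E.
  + by apply: contraNneq Be => E; rewrite -E; apply/eqP/esym/setIidPl.
- case: h9 => [->|[v vU [-> dv]]]; first by left; rewrite set0I.
  have [vA|vA] := boolP (v \in A).
    right; exists v => //; split; first by apply/setIidPl; rewrite sub1set.
    by apply: dvd2k_eq dv _; clear; lia.
  by left; apply/eqP; rewrite setI_eq0 disjoints1.
Qed.

End Inside.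

(** The bound on net values survives gluing: a vertex outside [A] keeps its net value from the
    quotient, and for a vertex of [A] the inner instance counts the outside arcs through [p] and
    [q]. *)
Lemma solvable_contract U A a m t p q exc : inst k U m t p q exc -> A \subset U -> A != U ->
  a \in A ->
  cut m U A + vsum p A + vsum q A <= 2 * k - 2 + nrm k (vsum t A + vsum p A - vsum q A) ->
  solvable k (quo U A a) (qmul U A a m) (qsum U A a t) (qsum U A a p) (qsum U A a q) ->
  (forall t' p' q', inst k A m t' p' q' (exc :&: A) -> solvable k A m t' p' q') ->
  solvable k U m t p q.
Proof.
move=> I sAU AU aA tight [x [x1 x2 x3 x4]] H.
have [m0 msym _ _ _ _ _ _ _] := I.
have quoP u : u \in U -> u \notin A -> u \in quo U A a by move=> uU uA; rewrite !inE uU uA orbT.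
have aq : a \in quo U A a by rewrite !inE eqxx.
have xa u : u \in U -> u \notin A -> x u a + x a u = vsum (m u) A.
  move=> uU uA; rewrite (x2 u a (quoP u uU uA) aq) ?qmul_a //.
  by apply: contraNneq uA => ->.
have /fin_all_exists2[g g1 g2] : forall u, exists2 h : V -> int, (forall v, 0 <= h v <= m u v) &
    (u \in U :\: A -> vsum h A = x u a).
  move=> u; rewrite inE; have [/andP[uA uU]|_] := boolP (_ && _); last first.
    by exists (fun=> 0) => // v; rewrite lexx m0.
  have [|h [h1 h2]] := @distribute A (m u) (x u a) (m0 u); last by exists h.
  by rewrite x1 -xa // lerDl x1.
have netS : net x (quo U A a) a = \sum_(u in U :\: A) (x a u - x u a).
  by rewrite /net /quo big_setU1 ?inE ?aA //= subrr add0r.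
pose N v : int := vsum (m v) (U :\: A); pose G v : int := \sum_(u in U :\: A) g u v.
have NG : vsum N A - 2 * vsum G A = net x (quo U A a) a.
  rewrite netS /N /G /vsum exchange_big /= [X in _ - 2 * X]exchange_big /= mulr_sumr -sumrB.
  apply: eq_bigr => u uA; rewrite (_ : \sum_(i in A) g u i = x u a); last exact: g2.
  have := uA; rewrite inE => /andP[uA' uU].
  rewrite (_ : \sum_(i in A) m i u = vsum (m u) A); last by apply: eq_bigr => v _.
  by rewrite -xa //; clear; lia.
have [|y [y1 y2 y3 y4]] := H _ _ _ (inst_inside sAU g1 I AU tight _).
  by rewrite NG -(qsum_a sAU aA t); exact: x3.
pose z u v := if u \in A then (if v \in A then y u v else m u v - g v u)
              else (if v \in A then g u v else x u v).
have zA v : v \in A -> net z U v = net y A v + (N v - 2 * G v).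
  move=> vA; rewrite /net -/(vsum _ _) (vsum_split _ sAU) addrC; congr (_ + _).
    by apply: eq_bigr => u uA; rewrite /z uA vA.
  rewrite /N /G mulr_sumr -sumrB; apply: eq_bigr => u; rewrite inE => /andP[/negPf uA _].
  by rewrite /z uA vA; clear; lia.
have zU v : v \in U -> v \notin A -> net z U v = net x (quo U A a) v.
  move=> vU vA; rewrite /net -/(vsum _ _) (vsum_split _ sAU) addrC.
  rewrite /quo big_setU1 /= ?inE ?aA //; congr (_ + _); last first.
    by apply: eq_bigr => u; rewrite inE => /andP[/negPf uA _]; rewrite /z uA (negPf vA).
  have -> : x v a - x a v = 2 * x v a - vsum (m v) A by rewrite -xa //; clear; lia.
  rewrite -(g2 v) ?inE ?vA // /vsum mulr_sumr -sumrB; apply: eq_bigr => u uA.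
  by rewrite /z uA (negPf vA) (msym u); clear; lia.
exists z; split.
- move=> u v; rewrite /z; case: ifP => uA; case: ifP => vA => //.
    by have := g1 v u; rewrite (msym v) subr_ge0 => /andP[].
  by case/andP: (g1 u v).
- move=> u v uU vU uv; rewrite /z; case: ifP => uA; case: ifP => vA.
  + exact: y2.
  + by rewrite subrK.
  + by rewrite (msym v); clear; lia.
  + by rewrite x2 ?quoP ?uA ?vA // qmul_id ?uA ?vA.
- move=> v vU; have [vA|vA] := boolP (v \in A).
    by rewrite zA //; apply: dvd2k_eq (y3 v vA) _; rewrite -/(N v) -/(G v); clear; lia.
  by rewrite zU //; have := x3 v (quoP v vU vA); rewrite qsum_id.
- move=> v vU; have [vA|vA] := boolP (v \in A).
    rewrite zA //; have := y4 v vA; rewrite /= -/(N v) -/(G v).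
    by move: (N v) (G v) (net _ _ _); clear; lia.
  by rewrite zU //; have := x4 v (quoP v vU vA); rewrite !qsum_id.
Qed.

End Contraction.

(** * Reductions when every larger cut has slack *)

Section Solve.
Variables (k : int) (k2 : 2 <= k) (V : finType).
Implicit Types (U A B exc : {set V}) (m x : V -> V -> int) (f t p q : V -> int) (u v y z e : V).

Definition size_mult m U : int := \sum_(u in U) \sum_(v in U) m u v.

Lemma size_del m y z U : y \in U -> z \in U -> size_mult (del m y z) U = size_mult m U - 2.
Proof.
move=> yU zU; transitivity (size_mult m U -
   (\sum_(u in U) \sum_(v in U) arc y z u v + \sum_(u in U) \sum_(v in U) arc z y u v)).
  rewrite /size_mult -big_split -sumrB; apply: eq_bigr => u _.
  by rewrite -big_split -sumrB.
by rewrite !sum_arc yU zU.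
Qed.

Lemma size_lift m e y z U : e \in U -> y \in U -> z \in U ->
  size_mult (lift m e y z) U = size_mult m U - 2.
Proof.
move=> eU yU zU; rewrite !size_del //.
transitivity (size_mult m U +
   (\sum_(u in U) \sum_(v in U) arc y z u v + \sum_(u in U) \sum_(v in U) arc z y u v) - 2 - 2).
  congr (_ - _ - _); rewrite /size_mult -!big_split; apply: eq_bigr => u _ /=.
  by rewrite -!big_split.
by rewrite !sum_arc yU zU; clear; lia.
Qed.

Lemma nrmD (n n' : int) : nrm k (n + n') <= nrm k n + nrm k n'.
Proof.
have [r [r1 r2 ->]] := nrm_rep k2 n'.
have -> : nrm k (n + n') = nrm k (n + r); last exact: nrm_lip.
by apply: nrm_dvd => //; apply: dvd2k_eq r2 _; clear; lia.
Qed.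

(** Add the bounds for [A] and its complement. Their residues sum to that of the extra vertex, so
    subadditivity of the distance and [inst_root] leave 2k-2 for twice the cut. *)
Lemma cut_gt0 U m t p q A : inst k U m t p q set0 -> A \subset U -> A != set0 -> A != U ->
  1 <= cut m U A.
Proof.
move=> I s A0 AU; have [h1 h2 h3 h4 h5 h6 h7 h8 _] := I.
have B0 : U :\: A != set0.
  by apply: contraNneq AU => /eqP; rewrite setD_eq0 => s'; rewrite eqEsubset s.
have BU : U :\: A != U.
  have /set0Pn[x xA] := A0; apply: contraTneq xA => E.
  by apply/negP => xA; have := subsetP s _ xA; rewrite -E inE xA.
have := h8 _ (subsetDl _ _) B0 BU B0; have := h8 _ s A0 AU A0.
rewrite cutC // !(vsum_setD _ s).
have := nrmD (vsum t A + vsum p A - vsum q A)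
  (vsum t U - vsum t A + (vsum p U - vsum p A) - (vsum q U - vsum q A)).
have -> : nrm k (vsum t A + vsum p A - vsum q A +
  (vsum t U - vsum t A + (vsum p U - vsum p A) - (vsum q U - vsum q A))) =
  nrm k (vsum p U - vsum q U).
  by apply: nrm_dvd => //; apply: (dvd2k_eq h6); clear; lia.
by move: h7 k2; clear; lia.
Qed.

Lemma nbr U m t p q A : inst k U m t p q set0 -> A \subset U -> A != set0 -> A != U ->
  exists y z, [/\ y \in A, z \in U :\: A & 1 <= m y z].
Proof.
move=> I s A0 AU; have := cut_gt0 I s A0 AU; have m0 := inst_ge0 I.
case: (pickP [pred w : V * V | [&& w.1 \in A, w.2 \in U :\: A & 1 <= m w.1 w.2]]).
  by move=> [y z] /and3P[]; exists y, z.
move=> H; rewrite /cut big1 // => y yA; apply: big1 => z zA.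
by have := H (y, z); rewrite /= yA zA /=; have := m0 y z; clear; lia.
Qed.

Lemma nbr1 U m t p q v : inst k U m t p q set0 -> v \in U -> (1 < #|U|)%N ->
  exists y, [/\ y \in U, v != y & 1 <= m v y].
Proof.
move=> I vU U1; have [||| y [z [/set1P-> + h]]] := @nbr U m t p q [set v] I.
- by rewrite sub1set.
- by apply/set0Pn; exists v; rewrite inE.
- by apply: contraTneq U1 => <-; rewrite cards1.
- by rewrite !inE eq_sym => /andP[zv zU]; exists z.
Qed.

(** The exempt vertex is split off pair by pair, using arcs at the extra vertex as well, until at
    most one neighbour remains and no such arc; then it is deleted. *)
Lemma solve_exc U m t p q e : inst k U m t p q [set e] -> slack k U m t p q ->
  (1 < #|U|)%N ->
  (forall m' t' p' q' exc, inst k U m' t' p' q' exc -> size_mult m' U < size_mult m U ->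
     solvable k U m' t' p' q') ->
  (forall U' m' t' p' q' exc, inst k U' m' t' p' q' exc -> (#|U'| < #|U|)%N ->
     solvable k U' m' t' p' q') ->
  solvable k U m t p q.
Proof.
move=> I sl U1 IHE IHU; have [m0 ms p0 q0 h5 h6 h7 h8 h9] := I.
have [eU te] : e \in U /\ dvd2k k (t e + p e - q e).
  case: h9 => [/setP/(_ e)|[v vU [/set1_inj E d]]]; first by rewrite !inE eqxx.
  by rewrite E.
have [w /and5P[]|none] := pickP [pred w : V * V | [&& w.1 \in U, w.2 \in U, 
   e != w.1, e != w.2 & [&& w.1 != w.2, 1 <= m e w.1 & 1 <= m e w.2]]].
  move: w => [y z] /= yU zU ey ez /and3P[yz my mz].
  apply: (@solvable_lift k k2 V U m t p q e y z) => //.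
  apply: (IHE _ _ _ _ [set e]); first exact: inst_lift.
  by rewrite size_lift //; clear; lia.
have remove y : y \in U -> y != e -> (forall v, v \in U -> v != e -> v != y -> m e v = 0) ->
    p e = 0 -> q e = 0 -> solvable k U m t p q.
  move=> yU ye me pe qe; have [I' d] := inst_remove k2 I eU pe qe me ye yU.
  apply: (solvable_remove k2 I eU pe qe).
    move=> v vU; have [|ve] := eqVneq v e; first by rewrite orbT.
    by have [->|vy] := eqVneq v y; rewrite ?d // me ?dvdz0.
  apply: (IHU _ _ _ _ _ _ I'); rewrite [X in (_ < X)%N](cardsD1 e) eU; clear; lia.
have [y /and3P[yU ey my]|none1] := pickP [pred y | [&& y \in U, e != y & 1 <= m e y]].
  have [pe|pe] := lerP 1 (p e).
    apply: (solvable_slide k2 ms eU yU ey); apply: (IHE _ _ _ _ [set e]).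
      exact: inst_slide.
    by rewrite size_del //; clear; lia.
  have [qe|qe] := lerP 1 (q e).
    apply: (solvable_neg k2); apply: (solvable_slide k2 ms eU yU ey); apply: (IHE _ _ _ _ [set e]).
      by apply: inst_slide => //; [exact: inst_neg|exact: slack_neg].
    by rewrite size_del //; clear; lia.
  apply: (remove y) => //; first by rewrite eq_sym.
  - move=> v vU ve vy; have := none (v, y); rewrite /= vU yU (eq_sym e v) ve ey vy my andbT /=.
    by have := m0 e v; clear; lia.
  - by have := p0 e; move: pe; clear; lia.
  - by have := q0 e; move: qe; clear; lia.
have [y yU ye] : exists2 y, y \in U & y != e.
  have /card_gt0P[y] : (0 < #|U :\ e|)%N by move: U1; rewrite (cardsD1 e) eU; clear; lia.
  by rewrite !inE => /andP[ye yU]; exists y.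
have me v : v \in U -> v != e -> m e v = 0.
  by move=> vU ve; have := none1 v; rewrite /= vU eq_sym ve /=; have := m0 e v; clear; lia.
(* Here e has no edge inside [U]. The cut bound for [U :\ e] and the root bound then differ only by
   [p e + q e], which must vanish. *)
have /andP[/eqP pe /eqP qe] : (p e == 0) && (q e == 0); last by apply: (remove y) => // v vU ve _; exact: me.
have eUs : [set e] \subset U by rewrite sub1set.
have B0 : U :\ e != set0 by apply/set0Pn; exists y; rewrite !inE ye.
have BU : U :\ e != U by apply: contraTneq eU => <-; rewrite !inE eqxx.
have Be : U :\ e != [set e].
  by apply/eqP => /setP/(_ e); rewrite !inE eqxx.
have := h8 _ (subsetDl _ _) B0 BU Be; rewrite cutC // !vsumD1 //.
have -> : cut m U [set e] = 0.
  rewrite /cut big_set1; apply: big1 => v; rewrite !inE => /andP[ve vU]; exact: me.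
have -> : nrm k (vsum t U - t e + (vsum p U - p e) - (vsum q U - q e)) =
    nrm k (vsum p U - vsum q U).
  by apply: nrm_dvd => //; apply: (dvd2kB h6 te); clear; lia.
by move: h7 (p0 e) (q0 e); clear; lia.
Qed.

Section NoZero.
Variables (U : {set V}) (m : V -> V -> int) (t p q : V -> int).
Hypotheses (I : inst k U m t p q set0) (sl : slack k U m t p q) (U1 : (1 < #|U|)%N).
Hypothesis IHE : forall m' t' p' q', inst k U m' t' p' q' set0 ->
  size_mult m' U < size_mult m U -> solvable k U m' t' p' q'.
Let tau v := t v + p v - q v.
Hypothesis tau0 : forall v, v \in U -> ~~ dvd2k k (tau v).
Let W := vsum p U + vsum q U.
Let c := vsum p U - vsum q U.
Let ms := inst_sym I.

(** A positive vertex gets closer to zero when an outgoing arc is fixed, a negative one when an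
    incoming arc is; residue k has both signs. *)
Definition positive v : bool := 0 < res k (tau v).
Definition negative v : bool := (res k (tau v) < 0) || (res k (tau v) == k).

Lemma positiveP v : positive v ->
  exists r, [/\ - k < r <= k, dvd2k k (tau v - r) & 0 < r].
Proof. by move=> vp; exists (res k (tau v)); rewrite res_bounds //; split=> //; exact: dvd_res. Qed.

Lemma negativeP v : negative v ->
  exists r, [/\ - k < r <= k, dvd2k k (tau v - r) & r < 0 \/ r = k].
Proof.
move=> vn; exists (res k (tau v)); rewrite res_bounds //; split=> //; first exact: dvd_res.
by case/orP: vn => [|/eqP]; [left|right].
Qed.

Lemma sign v : v \in U -> ~~ negative v -> positive v.
Proof.
move=> vU; rewrite /negative negb_or => /andP[r0 _]; rewrite /positive lt_def leNgt r0 andbT.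
apply: contraNneq (tau0 vU) => E; have := dvd_res k (tau v); rewrite E subr0; exact.
Qed.

Lemma moveD y z : y \in U -> z \in U -> y != z -> 1 <= m y z -> positive y -> negative z ->
  solvable k U m t p q.
Proof.
move=> yU zU yz my /positiveP[r [r1 r2 r3]] /negativeP[s [s1 s2 s3]].
apply: (@solvable_dir k k2 V U m t p q y z 0 0 0) => //.
- by move=> n hn hn'; rewrite subr0; apply: near_add1 r2 r3 _ hn' => //; apply: dvd2k_eq hn _; rewrite /tau; clear; lia.
- by move=> n hn hn'; rewrite subr0 addr0; apply: near_sub1 s2 s3 _ hn' => //; apply: dvd2k_eq hn _; rewrite /tau; clear; lia.
apply: IHE; last by rewrite size_del //; clear; lia.
apply: inst_dir => //.
- by rewrite !addr0 (nrm_sub1 k2 r1 r2 r3).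
- by rewrite subr0 !addr0 (nrm_add1 k2 s1 s2 s3).
- by rewrite subr0 !addr0; exact: inst_root I.
Qed.

(** Only z improves. At y the lost arc to z is replaced by an arc to the extra vertex, so its
    residue and degree stay; the price is one more arc at the extra vertex. *)
Lemma moveP y z : y \in U -> z \in U -> y != z -> 1 <= m y z -> negative z ->
  W + 1 <= 2 * k - 2 + nrm k (c + 1) -> solvable k U m t p q.
Proof.
move=> yU zU yz my /negativeP[s [s1 s2 s3]] hW.
apply: (@solvable_dir k k2 V U m t p q y z 1 0 0) => //.
- by move=> n hn hn'; rewrite addrK.
- by move=> n hn hn'; rewrite subr0 addr0; apply: near_sub1 s2 s3 _ hn' => //; apply: dvd2k_eq hn _; rewrite /tau; clear; lia.
apply: IHE; last by rewrite size_del //; clear; lia.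
apply: inst_dir => //.
- by rewrite !subrK.
- by rewrite subr0 !addr0 (nrm_add1 k2 s1 s2 s3).
- by rewrite subr0 !addr0.
Qed.

(** The mirror image of [moveP]: at z the arc from y is replaced by one from the extra vertex. *)
Lemma moveQ y z : y \in U -> z \in U -> y != z -> 1 <= m y z -> positive y ->
  W + 1 <= 2 * k - 2 + nrm k (c - 1) -> solvable k U m t p q.
Proof.
move=> yU zU yz my /positiveP[r [r1 r2 r3]] hW.
apply: (@solvable_dir k k2 V U m t p q y z 0 0 1) => //.
- by move=> n hn hn'; rewrite subr0; apply: near_add1 r2 r3 _ hn' => //; apply: dvd2k_eq hn _; rewrite /tau; clear; lia.
- by move=> n hn hn'; rewrite subr0 subrK.
apply: IHE; last by rewrite size_del //; clear; lia.
apply: inst_dir => //.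
- by rewrite !addr0 (nrm_sub1 k2 r1 r2 r3).
- by rewrite addr0 addrK addr0 subrK.
- by rewrite !addr0.
Qed.

(* Adding edges z -> z0 turns the residue of [z] into k, which is both positive and negative. *)
Lemma moveR y z : y \in U -> z \in U -> y != z -> 1 <= m y z -> positive y -> positive z ->
  W = 2 * k - 1 -> dvd2k k (c - 1) -> solvable k U m t p q.
Proof.
move=> yU zU yz my /positiveP[r [r1 r2 r3]] /positiveP[s [s1 s2 s3]] hW hc.
have E : nrm k (t z + p z - q z + 1 + (k - s)) = k - 1.
  have d : dvd2k k (t z + p z - q z + 1 + (k - s) - (1 - k)).
    by apply: dvd2kD s2 (dvd2kk k) _; rewrite /tau; clear; lia.
  by rewrite (nrm_unique k2 d); move: k2; clear; lia.
apply: (@solvable_dir k k2 V U m t p q y z 0 (k - s) 0) => //.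
- by move=> n hn hn'; rewrite subr0; apply: near_add1 r2 r3 _ hn' => //; apply: dvd2k_eq hn _; rewrite /tau; clear; lia.
- move=> n hn hn'; rewrite addr0.
  have : dvd2k k (n - (k + 1)) by apply: dvd2kD hn s2 _; rewrite /tau; clear; lia.
  have h : `|n - (k + 1)| < 4 * k by move: hn' k2; clear; lia.
  by move=> /(dvd_small2 k2)/(_ h)[] h'; move: hn' s1 s3 h' k2; clear; lia.
apply: IHE; last by rewrite size_del //; clear; lia.
apply: inst_dir => //; first by move: s1; clear; lia.
- by rewrite !addr0 (nrm_sub1 k2 r1 r2 r3).
- rewrite subr0 E addr0 (_ : nrm k _ = `|s|); last by apply: (nrm_unique k2 s2); move: s1 k2; clear; lia.
  by move: s3; clear; lia.
- rewrite -/W -/c hW addr0 addr0 addr0 subr0.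
  have -> : nrm k (c + (k - s)) = `|k - s + 1|.
    apply: (nrm_unique k2); last by move: s1 s3; clear; lia.
    by rewrite -/(dvd2k _ _); apply: dvd2k_eq hc _; clear; lia.
  by move: s1; clear; lia.
Qed.

Hypothesis IHW : forall t' p' q', inst k U m t' p' q' set0 ->
  vsum p' U + vsum q' U < W -> solvable k U m t' p' q'.

Lemma moveX y : y \in U -> 1 <= p y -> positive y -> solvable k U m t p q.
Proof.
move=> yU py /positiveP[r [r1 r2 r3]]; apply: (@solvable_rem k k2 V U m t p q y) => //.
  by move=> n hn hn'; apply: near_add1 r2 r3 hn hn'.
apply: IHW; first by apply: inst_rem => //; exact: nrm_sub1 r1 r2 r3.
by rewrite vsumD vsumN vsum_pt yU /W; clear; lia.
Qed.

Lemma moveY y : y \in U -> 1 <= q y -> negative y -> solvable k U m t p q.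
Proof.
move=> yU qy /negativeP[r [r1 r2 r3]]; apply: (solvable_neg k2).
apply: (@solvable_rem k k2 V U m _ q p y) => //.
  move=> n hn hn'; rewrite -normrN opprD addrC -[X in X - n]opprK addrC.
  rewrite opprK; apply: near_sub1 r2 r3 _ _ => //; last by rewrite normrN.
  by rewrite -dvd2kN; apply: dvd2k_eq hn _; rewrite /tau; clear; lia.
apply: IHW; last by rewrite vsumD vsumN vsum_pt yU /W; clear; lia.
apply: inst_rem => //; [exact: inst_neg|exact: slack_neg|].
have E n n' : n = - n' -> nrm k n = nrm k n' by move=> ->; rewrite nrmN.
rewrite (@E (_ - 1) (tau y + 1)) ?(@E (- t y + _ - _) (tau y)); first exact: nrm_add1 r1 r2 r3.
  by rewrite /tau; clear; lia.
by rewrite /tau; clear; lia.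
Qed.

(** When rc < k, one more arc into the extra vertex raises its distance too, so [moveP] is always
    affordable and any negative vertex can be used. When rc = k, every further arc lowers the
    distance and the capacity may be exhausted. *)
Lemma solve_nonneg rc : 0 <= rc <= k -> dvd2k k (c - rc) -> solvable k U m t p q.
Proof.
move=> hrc dc; have root : W <= 2 * k - 2 + nrm k c := inst_root I.
have Ec : nrm k c = rc by rewrite (nrm_unique k2 dc); move: hrc; clear; lia.
have /card_gt0P[v0 v0U] : (0 < #|U|)%N by move: U1; clear; lia.
have [y0 [y0U vy0 my0]] := nbr1 I v0U U1.
have allp : (forall v, v \in U -> positive v) -> solvable k U m t p q \/ c = - W.
  move=> H; have [v /andP[vU pv]|none] := pickP [pred v | (v \in U) && (1 <= p v)].
    by left; apply: (moveX vU pv); exact: H.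
  right; suff E : vsum p U = 0 by rewrite /W /c E; clear; lia.
  apply: big1 => v vU; have := none v; rewrite /= vU /=; have := inst_p I v; clear; lia.
have alln : (forall v, v \in U -> negative v) -> solvable k U m t p q \/ c = W.
  move=> H; have [v /andP[vU pv]|none] := pickP [pred v | (v \in U) && (1 <= q v)].
    by left; apply: (moveY vU pv); exact: H.
  right; suff E : vsum q U = 0 by rewrite /W /c E; clear; lia.
  apply: big1 => v vU; have := none v; rewrite /= vU /=; have := inst_q I v; clear; lia.
have nE (d : int) r : - k <= r <= k -> d + rc = r \/ d + rc = r + 2 * k -> nrm k (c + d) = `|r|.
  move=> hr E; apply: (nrm_unique k2); last by move: hr; clear; lia.
  rewrite -/(dvd2k _ _); case: E => E; first by apply: dvd2k_eq dc _; move: E; clear; lia.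
  by apply: dvd2kD dc (dvd2kk k) _; move: E; clear; lia.
have [rck|rck] := ltrP rc k.
  have free : W + 1 <= 2 * k - 2 + nrm k (c + 1).
    by rewrite (nE 1 (rc + 1)); move: root hrc rck Ec; clear; [lia|lia|left; lia].
  have [[z zU zn]|pos] : (exists2 z, z \in U & negative z) \/ (forall z, z \in U -> positive z).
    have [z /andP[zU]|none] := pickP [pred z | (z \in U) && negative z]; first by left; exists z.
    by right => z zU; apply: sign => //; have := none z; rewrite /= zU /= => ->.
  - have [y [yU zy my]] := nbr1 I zU U1.
    by apply: (moveP yU zU) => //; rewrite 1?eq_sym // ms.
  have [fq|fq] := lerP (W + 1) (2 * k - 2 + nrm k (c - 1)).
    by apply: (moveQ v0U y0U) => //; exact: pos.
  have [//|cW] := allp pos.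
  (* All vertices are positive and no arc enters the extra vertex, so c = -W and W + rc is a
     multiple of 2k. As [moveQ] is blocked, W is 2k-3+rc or 2k-2+rc when rc > 0, which leaves only
     this case. *)
  have [W1 rc1] : W = 2 * k - 1 /\ rc = 1.
    have [rc0|rc0] := eqVneq rc 0.
      have := nE (-1) (-1); rewrite rc0 => E1.
      by move: fq; rewrite E1; move: root Ec rc0 k2; clear; [lia|lia|left; lia].
    have hq : nrm k (c - 1) = rc - 1.
      by rewrite (nE (-1) (rc - 1)); move: hrc rck rc0; clear; [lia|lia|left; lia].
    have d : dvd2k k (W + rc).
      by rewrite -dvd2kN; apply: dvd2k_eq dc _; rewrite cW; clear; lia.
    have h : `|W + rc| < 4 * k by move: root Ec fq hq hrc rck k2; clear; lia.
    by have [] := dvd_small2 k2 d h; move: root Ec fq hq hrc rck k2; clear; lia.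
  apply: (moveR v0U y0U) => //; [exact: pos|exact: pos|].
  by apply: dvd2k_eq dc _; rewrite rc1.
have rcE : rc = k by move: hrc rck; clear; lia.
have n1 : nrm k (c + 1) = k - 1.
  by rewrite (nE 1 (1 - k)); move: rcE k2; clear; [lia|lia|right; lia].
have n2 : nrm k (c - 1) = k - 1.
  by rewrite (nE (-1) (k - 1)); move: rcE k2; clear; [lia|lia|left; lia].
have [fr|fr] := lerP (W + 1) (2 * k - 2 + (k - 1)).
  have [v0n|/(sign v0U) v0p] := boolP (negative v0).
    apply: (moveP y0U v0U) => //; first by rewrite eq_sym.
      by rewrite ms.
    by rewrite n1.
  by apply: (moveQ v0U y0U) => //; rewrite n2.
(* The extra vertex is saturated, so both ends of the next edge must improve. Were all vertices of
   one sign, c would be W or -W and W congruent to k modulo 2k, whereas W is 3k-3 or 3k-2. Hence [P]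
   is a proper nonempty set and an edge leaves it. *)
pose P := [set v in U | ~~ negative v].
have sP : P \subset U by apply/subsetP => v; rewrite inE => /andP[].
have Pp v : v \in P -> positive v.
  by rewrite inE => /andP[vU]; exact: sign.
have [P0|P0] := eqVneq P set0.
  have [|//|cW] := alln.
    move=> v vU; have /setP/(_ v) := P0; rewrite !inE vU /=.
    by case: (negative v).
  have d : dvd2k k (W - k) by apply: dvd2k_eq dc _; rewrite cW rcE.
  have := dvd_small k2 d; move: root Ec rcE fr k2; clear; lia.
have [PU|PU] := eqVneq P U.
  have [|//|cW] := allp; first by move=> v; rewrite -{1}PU; exact: Pp.
  have d : dvd2k k (W + k) by rewrite -dvd2kN; apply: dvd2k_eq dc _; rewrite cW rcE; clear; lia.
  have h : `|W + k| < 4 * k by move: root Ec rcE k2 fr; clear; lia.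
  by have [] := dvd_small2 k2 d h; move: root Ec rcE fr k2; clear; lia.
have [y [z [yP zP myz]]] := nbr I sP P0 PU.
have yU := subsetP sP _ yP; have yz : y != z.
  by apply: contraTneq zP => <-; rewrite inE yP.
move: zP; rewrite !inE => /andP[+ zU]; rewrite zU /= negbK => zn.
by apply: (moveD yU zU) => //; exact: Pp.
Qed.

End NoZero.

End Solve.

(** * The modulo orientation theorem by induction *)

Section CoreTheorem.
Variables (k : int) (k2 : 2 <= k) (V : finType).
Implicit Types (U A B exc : {set V}) (m x : V -> V -> int) (f t p q : V -> int) (u v y z e : V).

Lemma solve_small U m t p q exc : inst k U m t p q exc -> (#|U| <= 1)%N -> solvable k U m t p q.
Proof.
case=> h1 h2 h3 h4 h5 h6 h7 h8 h9 U1; exists (fun _ _ => 0).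
have n0 v : net (fun _ _ : V => 0) U v = 0 by apply: big1 => u _; rewrite subrr.
split=> // [u v uU vU uv|v vU|v vU].
- have : (#|[set u; v]| <= #|U|)%N by rewrite subset_leq_card // subUset !sub1set uU.
  by rewrite cards2 uv => /leq_trans/(_ U1).
- rewrite n0 sub0r dvd2kN; suff E : U = [set v] by rewrite E vsum1 in h6.
  by apply/esym/eqP; rewrite eqEcard sub1set vU cards1.
- have E : U = [set v] by apply/esym/eqP; rewrite eqEcard sub1set vU cards1.
  rewrite n0 add0r; apply: (abs_le_of_nrm k2).
  by move: h7 (h3 v) (h4 v); rewrite E !vsum1; clear; lia.
Qed.

Lemma inst_set1 U m t p q e : inst k U m t p q set0 -> e \in U -> dvd2k k (t e + p e - q e) ->
  inst k U m t p q [set e].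
Proof.
case=> h1 h2 h3 h4 h5 h6 h7 h8 _ eU d; split=> //; first by move=> A s A0 AU _; exact: h8.
by right; exists e.
Qed.

Lemma size_ge0 U m t p q exc : inst k U m t p q exc -> 0 <= size_mult m U.
Proof. by case=> h *; apply: sumr_ge0 => u _; apply: sumr_ge0. Qed.

(* The modulo-(2k) orientation theorem of Lovasz, Thomassen, Wu and Zhang, with the bound on the
   net values added. *)
Theorem inst_solvable U m t p q exc : inst k U m t p q exc -> solvable k U m t p q.
Proof.
(* The induction is lexicographic in the number of vertices, the total multiplicity, and the degree
   of the extra vertex; orienting an edge may raise the last. *)
have [n] := ubnP #|U|; elim: n U m t p q exc => // n IHU U m t p q exc; rewrite ltnS => Un.
have [N] := ubnP (absz (size_mult m U)); elim: N m t p q exc => // N IHN m t p q exc; rewrite ltnS => UN.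
have [w] := ubnP (absz (vsum p U + vsum q U)); elim: w t p q exc => // w IHw t p q exc.
rewrite ltnS => Uw I.
have [U1|U1] := leqP #|U| 1; first exact: solve_small I U1.
have IHU' U' m' t' p' q' exc' : inst k U' m' t' p' q' exc' -> (#|U'| < #|U|)%N ->
    solvable k U' m' t' p' q'.
  by move=> I' U'U; apply: IHU (I'); apply: leq_trans U'U Un.
have IHE m' t' p' q' exc' : inst k U m' t' p' q' exc' -> size_mult m' U < size_mult m U ->
    solvable k U m' t' p' q'.
  move=> I' lt; apply: (IHN _ _ _ _ _ _ I') => //.
  by move: lt (size_ge0 I') UN; clear; lia.
have [A /and4P[sAU AU A1 tight]|none] := pickP [pred A : {set V} | [&& A \subset U, A != U,
    (1 < #|A|)%N & ~~ (2 * k + nrm k (vsum t A + vsum p A - vsum q A)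
                         <= cut m U A + vsum p A + vsum q A)]].
  have /card_gt0P[a aA] : (0 < #|A|)%N by apply: leq_trans A1.
  apply: (solvable_contract k2 I sAU AU aA).
  (* By parity, a set without slack attains the bound, hence is tight. *)
  - have := nrm_odd k2 (vsum t A + vsum p A - vsum q A); have := inst_par I sAU.
    by move: tight; clear; lia.
  - apply: IHU' (inst_quo k2 sAU aA I A1) _; rewrite card_quo //.
    by have := subset_leq_card sAU; move: A1 U1; clear; lia.
  - move=> t' p' q' I'; apply: IHU' I' _; apply: proper_card.
    by rewrite properEneq AU.
have sl : slack k U m t p q.
  move=> A sAU AU A1; have := none A; rewrite /= sAU AU A1 /=.
  by move/negbT; rewrite negbK.
have wE e : inst k U m t p q [set e] -> solvable k U m t p q by move=> I'; apply: solve_exc I' _ _ _ _.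
case: (inst_exc I) => [E|[e eU [E _]]]; last by apply: (wE e); rewrite -E.
rewrite {}E in I.
(* Exempting a vertex of total target zero relaxes the instance and allows splitting off there. *)
have [e /andP[eU de]|nz] := pickP [pred v | (v \in U) && dvd2k k (t v + p v - q v)].
  by apply: (wE e); exact: inst_set1.
have nz' v : v \in U -> ~~ dvd2k k (t v + p v - q v).
  by move=> vU; have := nz v; rewrite /= vU /= => ->.
have IHW t' p' q' : inst k U m t' p' q' set0 -> vsum p' U + vsum q' U < vsum p U + vsum q U ->
    solvable k U m t' p' q'.
  move=> I' lt; apply: (IHw _ _ _ _ _ I').
  move: Uw lt (vsum_ge0 U (inst_p I')) (vsum_ge0 U (inst_q I')); clear; lia.
have [b1 b2] : - k < res k (vsum p U - vsum q U) /\ res k (vsum p U - vsum q U) <= k.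
  by apply/andP; exact: res_bounds.
have dr := dvd_res k (vsum p U - vsum q U).
have [r0|r0] := lerP 0 (res k (vsum p U - vsum q U)).
  apply: (solve_nonneg k2 I sl U1 _ nz' _ _ dr) => //; last by rewrite r0 b2.
  by move=> m' t' p' q' I'; exact: IHE I'.
apply: (solvable_neg k2).
apply: (@solve_nonneg k k2 V U m _ q p (inst_neg k2 I) (slack_neg k2 sl) U1 _ _ _
  (- res k (vsum p U - vsum q U))).
- by move=> m' t' p' q' I'; exact: IHE I'.
- move=> v vU; apply: contra (nz' v vU) => d.
  by rewrite -dvd2kN; apply: dvd2k_eq d _; clear; lia.
- by move=> t' p' q' I' lt; apply: IHW => //; move: lt; clear; lia.
- by move: r0 b1; clear; lia.
- by rewrite -dvd2kN; apply: dvd2k_eq dr _; clear; lia.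
Qed.

End CoreTheorem.

(** * Connectivity, spanning trees and parity joins *)

Section GraphBasics.
Local Open Scope nat_scope.
Variable G : multigraph.
Implicit Types (F T D : {set edge G}) (A X : {set G}) (x y v : G) (e : edge G).

Definition inc e v : nat := ((ends e).1 == v) + ((ends e).2 == v).
Definition crosses e A : bool := ((ends e).1 \in A) != ((ends e).2 \in A).
Definition cutset F A : {set edge G} := [set e in F | crosses e A].

Lemma degreeE F v : degree F v = \sum_(e in F) inc e v.
Proof.
rewrite /degree big_split /=; congr (_ + _); rewrite -sum1_card big_mkcond [RHS]big_mkcond;
by apply: eq_bigr => e _; rewrite !inE; case: (_ \in F); case: (_ == v).
Qed.

Lemma sum_inc (A : {set G}) e : \sum_(v in A) inc e v = ((ends e).1 \in A) + ((ends e).2 \in A).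
Proof.
have S u : \sum_(v in A) (u == v : nat) = (u \in A).
  rewrite big_mkcond (bigD1 u) //= eqxx big1 ?addn0; first by case: ifP.
  by move=> w wu; rewrite eq_sym (negPf wu); case: ifP.
by rewrite big_split /= !S.
Qed.

Lemma joins_crosses e x y A : joins e x y -> crosses e A = ((x \in A) != (y \in A)).
Proof. by rewrite /joins /crosses => /orP[] /eqP->//=; rewrite eq_sym. Qed.

Lemma joins_ends e : joins e (ends e).1 (ends e).2.
Proof. by rewrite /joins -surjective_pairing eqxx. Qed.

Lemma joinsC e x y : joins e x y = joins e y x.
Proof. by rewrite /joins orbC. Qed.

Lemma adjacentC F : symmetric (adjacent F).
Proof. by move=> x y; apply: eq_existsb => e; rewrite joinsC. Qed.

Lemma connect_adjC F : connect_sym (adjacent F).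
Proof. exact/sym_connect_sym/adjacentC. Qed.

Lemma connect_ends F e : e \in F -> connect (adjacent F) (ends e).1 (ends e).2.
Proof. by move=> eF; apply: connect1; apply/existsP; exists e; rewrite eF joins_ends. Qed.

Lemma connect_cut F A x y : connect (adjacent F) x y -> x \in A -> y \notin A ->
  exists2 e, e \in F & crosses e A.
Proof.
move=> cxy xA yA; apply/exists_inP; apply: contraTT cxy => /exists_inPn no.
have cl : closed (adjacent F) (mem A).
  move=> u v /existsP[e /andP[eF j]]; apply/eqP; have := no e eF.
  by rewrite (joins_crosses A j) negbK.
by apply/negP => /(closed_connect cl); rewrite xA (negPf yA).
Qed.

Lemma connectedP F :
  connected F <-> forall A, A != set0 -> A != setT -> exists2 e, e \in F & crosses e A.
Proof.
split=> [c A /set0Pn[x xA] AT|H x y].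
  have /subsetPn[y _ yA] : ~~ ([set: G] \subset A) by rewrite subTset.
  exact: connect_cut (c x y) xA yA.
apply: contraT => nxy; have [||e eF] := H [set z | connect (adjacent F) x z].
- by apply/set0Pn; exists x; rewrite inE connect0.
- by apply/eqP => /setP/(_ y); rewrite !inE (negPf nxy).
rewrite /crosses !inE; have c := connect_ends eF.
have c' : connect (adjacent F) (ends e).2 (ends e).1 by rewrite connect_adjC.
by move/eqP; case; apply/idP/idP => h; [apply: connect_trans h c|apply: connect_trans h c'].
Qed.

Lemma connectE F : connected F <-> [forall x, forall y, connect (adjacent F) x y].
Proof.
split=> [c|/forallP c x y]; first by apply/forallP => x; apply/forallP => y.
exact: (forallP (c x)).
Qed.

Lemma cycle_connect F (w : G * edge G) (s : seq (G * edge G)) (z : G * edge G) :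
  path (fun p q => joins p.2 p.1 q.1) w (rcons s z) ->
  all (fun p => p.2 \in F) (w :: s) -> connect (adjacent F) w.1 z.1.
Proof.
elim: s w => [|u s IH] w /= => [/andP[j _] /andP[wF _]|/andP[j p] /andP[wF al]].
  by apply: connect1; apply/existsP; exists w.2; rewrite wF.
apply: connect_trans (IH u p al).
by apply: connect1; apply/existsP; exists w.2; rewrite wF.
Qed.

Lemma spanning_tree_exists F : connected F -> exists2 T : {set edge G}, T \subset F & spanning_tree T.
Proof.
move=> cF; pose P D := [forall x, forall y, connect (adjacent D) x y].
have PF : P F by apply/connectE.
have [T /minsetP[PT min] TF] := minset_exists PF.
exists T => //; have cT := (connectE T).2 PT; split=> // -[|[v e] c] [] // _ _ /= /andP[ec _].
move=> /andP[eT al] cyc.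
suff /connectE PT' : connected (T :\ e).
  by have := min _ PT' (subD1set T e) => /setP/(_ e); rewrite eT !inE eqxx.
apply/connectedP => A A0 AT; have [e' e'T cr] := (connectedP T).1 cT A A0 AT.
have [E|ne] := eqVneq e' e; last by exists e' => //; rewrite !inE ne.
rewrite {e' e'T}E in cr.
case: c ec al cyc => [|[u e2] c] ec al /= /andP[j cyc].
  by move: cr; rewrite (joins_crosses A j) eqxx.
have al' : all (fun p : G * edge G => p.2 \in T :\ e) ((u, e2) :: c).
  apply/allP => p pc; rewrite !inE (allP al p pc) andbT.
  by apply: contraNneq ec => <-; apply: (map_f snd pc).
have := cycle_connect cyc al' => /= c1.
move: cr; rewrite (joins_crosses A j) => vu.
have [vA|vA] := boolP (v \in A); move: vu; rewrite ?vA ?(negPf vA).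
  by case: (boolP (u \in A)) => // uA _; rewrite connect_adjC in c1; apply: connect_cut c1 vA uA.
by case: (boolP (u \in A)) => // uA _; apply: connect_cut c1 uA vA.
Qed.

(** Allows working with disjoint connected factors throughout; trees are extracted only here. *)
Lemma tree_connected_of_connected m F (C : 'I_m -> {set edge G}) :
  (forall i, C i \subset F) -> (forall i, connected (C i)) ->
  (forall i j, i != j -> [disjoint C i & C j]) -> tree_connected m F.
Proof.
move=> CF cC dC; have /fin_all_exists2[T TC sT] : forall i, exists2 T : {set edge G}, T \subset C i & spanning_tree T.
  by move=> i; exact: spanning_tree_exists.
exists T; split=> // [i|i j ij]; first exact: subset_trans (TC i) (CF i).
exact: disjointWl (TC i) (disjointWr (TC j) (dC i j ij)).
Qed.

Lemma odd_degree_sym F D v : odd (degree ((F :\: D) :|: (D :\: F)) v)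
  = odd (degree F v) (+) odd (degree D v).
Proof.
have degU (B1 B2 : {set edge G}) : [disjoint B1 & B2] -> degree (B1 :|: B2) v = degree B1 v + degree B2 v.
  move=> d; rewrite !degreeE -bigU //; apply: eq_bigl => e; by rewrite !inE.
have dj (B1 B2 : {set edge G}) : [disjoint B1 :&: B2 & B1 :\: B2].
  by rewrite -setI_eq0; apply/eqP/setP => e; rewrite !inE; do 2!case: (e \in _).
have degD (B1 B2 : {set edge G}) : degree B1 v = degree (B1 :&: B2) v + degree (B1 :\: B2) v.
  by rewrite -degU ?setID.
rewrite (degD F D) (degD D F) (setIC D) degU.
  move: (degree (F :\: D) v) (degree (D :\: F) v) (degree (F :&: D) v) => a b c.
  by rewrite !oddD; case: (odd a); case: (odd b); case: (odd c).
by rewrite -setI_eq0; apply/eqP/setP => e; rewrite !inE; do 2!case: (e \in _).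
Qed.

Lemma degree1 e v : degree [set e] v = inc e v.
Proof. by rewrite degreeE big_set1. Qed.

Lemma odd_inc e x y v : joins e x y -> odd (inc e v) = (x == v) (+) (y == v).
Proof. by rewrite /joins /inc => /orP[] /eqP->/=; rewrite oddD !oddb // addbC. Qed.

Lemma connect_join F x y : connect (adjacent F) x y ->
  exists2 D : {set edge G}, D \subset F & forall v, odd (degree D v) = (x == v) (+) (y == v).
Proof.
case/connectP => p; elim: p x => [|z p IH] x /= => [_ ->|/andP[/existsP[e /andP[eF j]] pp] yl].
  exists set0; first exact: sub0set.
  by move=> v; rewrite degreeE big_set0 addbb.
have [D DF hD] := IH z pp yl.
exists ((D :\: [set e]) :|: ([set e] :\: D)).
  rewrite subUset (subset_trans (subsetDl _ _) DF) (subset_trans (subsetDl _ _)) //.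
  by rewrite sub1set.
move=> v; rewrite odd_degree_sym hD degree1 (odd_inc v j).
by case: (x == v); case: (y == v); case: (z == v).
Qed.

Lemma sum_degree F : \sum_v degree F v = 2 * #|F|.
Proof.
transitivity (\sum_(v in [set: G]) \sum_(e in F) inc e v).
  by apply: eq_big => [v|v _]; rewrite ?inE ?degreeE.
rewrite exchange_big /= -sum1_card big_distrr /=; apply: eq_bigr => e _.
by rewrite sum_inc !inE.
Qed.

Lemma odd_sum (f : G -> nat) : odd (\sum_v f v) = odd #|[set v | odd (f v)]|.
Proof.
have -> : \sum_v f v = \sum_v odd (f v) + 2 * \sum_v (f v)./2.
  by rewrite big_distrr -big_split; apply: eq_bigr => v _ /=; rewrite mul2n odd_double_half.
rewrite oddD mul2n odd_double addbF -sum1_card [in RHS]big_mkcond.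
by congr odd; apply: eq_bigr => v _; rewrite inE; case: (odd _).
Qed.

(** Take a subset of [T] with the fewest odd vertices. Their number is even, so there would be two
    of them, and adding a walk between them in [T] modulo two repairs both. *)
Lemma parity_join F T : connected T ->
  exists2 Q : {set edge G}, Q \subset T & forall v, ~~ odd (degree F v + degree Q v).
Proof.
move=> cT; pose B (Q : {set edge G}) := [set v | odd (degree F v + degree Q v)].
have [Q QT minQ] := @arg_minnP _ set0 (fun Q : {set edge G} => Q \subset T) (fun Q => #|B Q|) (sub0set T).
exists Q => // x; apply/negP => xo.
have xB : x \in B Q by rewrite inE.
have ev : ~~ odd #|B Q|.
  by rewrite -odd_sum big_split /= !sum_degree -mulnDr oddM.
have [y yB xy] : exists2 y, y \in B Q & y != x.
  have : 0 < #|B Q :\ x|.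
    by move: ev; rewrite (cardsD1 x) xB; case: #|_|.
  by case/card_gt0P => y; rewrite in_setD1 => /andP[yx yB]; exists y.
have [D DT hD] := connect_join (cT x y).
have := minQ ((Q :\: D) :|: (D :\: Q)).
rewrite subUset (subset_trans (subsetDl _ _) QT) (subset_trans (subsetDl _ _) DT).
move=> /(_ isT); rewrite leqNgt => /negP; apply.
apply: proper_card; apply/properP; split.
  apply/subsetP => v; rewrite !inE [X in is_true X -> _]oddD odd_degree_sym hD.
  have [<-|_] := eqVneq x v; first by move: xB; rewrite inE => ->.
  have [<-|_] := eqVneq y v; first by move: yB; rewrite inE => ->.
  by rewrite !addbF -oddD.
exists x => //; rewrite inE [X in ~~ X]oddD odd_degree_sym hD eqxx (negPf xy) addbF.
by rewrite addbA -oddD xo.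
Qed.

End GraphBasics.

(** * Eulerian orientations by splitting off *)

Section EulerOrientation.
Local Open Scope nat_scope.
Variables (V E : finType).
Implicit Types (F : {set E}) (en : E -> V * V) (s d : E -> V) (e : E) (u v : V).

Definition oriented en s d e := (en e == (s e, d e)) || (en e == (d e, s e)).

(* Two edges ab, bc are replaced by the single edge ac. *)
Lemma euler_orientation en F :
  (forall v, ~~ odd (\sum_(e in F) (((en e).1 == v) + ((en e).2 == v)))) ->
  exists s d, (forall e, e \in F -> oriented en s d e) /\
    forall v, \sum_(e in F) (s e == v) = \sum_(e in F) (d e == v).
Proof.
have [n] := ubnP #|F|; elim: n F en => // n IH F en; rewrite ltnS => Fn ev.
have [->|[e eF]] := set_0Vmem F.
  exists (fun e => (en e).1), (fun e => (en e).2); split=> [e|v]; first by rewrite inE.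
  by rewrite !big_set0.
have Fn' : #|F :\ e| < n by move: Fn; rewrite (cardsD1 e) eF.
have sD (g : E -> nat) : \sum_(x in F) g x = g e + \sum_(x in F :\ e) g x by rewrite (big_setD1 e).
case Ee: (en e) => [a b]; have [ab|ab] := eqVneq a b.
  have [|s [d [o bal]]] := IH (F :\ e) en Fn'.
    by move=> v; have := ev v; rewrite sD Ee /= ab addnn oddD odd_double.
  exists (fun x => if x == e then a else s x), (fun x => if x == e then a else d x); split.
    move=> x xF; rewrite /oriented; have [->|xe] := eqVneq x e; first by rewrite Ee ab eqxx.
    by apply: o; rewrite !inE xe.
  move=> v; rewrite !sD eqxx; congr (_ + _).
  transitivity (\sum_(x in F :\ e) (s x == v)); [|rewrite bal];
    by apply: eq_bigr => x; rewrite !inE => /andP[/negPf->].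
(* The edge e = ab is no loop and b has even degree, so another edge meets b. *)
have [e' e'F be'] : exists2 e', e' \in F :\ e & ((en e').1 == b) || ((en e').2 == b).
  apply/exists_inP; apply: contraT => /exists_inPn H; have := ev b.
  rewrite sD Ee /= (negPf ab) eqxx big1 //= => x /H; rewrite negb_or.
  by case/andP=> /negPf-> /negPf->.
have e'e : e' != e by move: e'F; rewrite !inE => /andP[].
pose c := if (en e').1 == b then (en e').2 else (en e').1.
have Ee' : (en e' == (b, c)) || (en e' == (c, b)).
  rewrite /c; case: (en e') be' => x y /=; case: eqP => [->|_] /=; first by rewrite eqxx.
  by move/eqP->; rewrite eqxx orbT.
have sD' (g : E -> nat) : \sum_(x in F :\ e) g x = g e' + \sum_(x in F :\ e :\ e') g x.
  by rewrite (big_setD1 e').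
pose en' x := if x == e' then (a, c) else en x.
have [|s [d [o bal]]] := IH (F :\ e) en' Fn'.
  move=> v; have := ev v; rewrite sD !sD' {1 2}/en' eqxx Ee /=.
  rewrite [in X in _ -> ~~ odd X](eq_bigr (fun x => ((en x).1 == v) + ((en x).2 == v))); last first.
    by move=> x; rewrite !inE /en' => /andP[/negPf->].
  have -> : ((en e').1 == v) + ((en e').2 == v) = (b == v) + (c == v).
    by case/orP: Ee' => /eqP-> //=; rewrite addnC.
  move: (\sum_(x in _) _) => S.
  by rewrite !oddD !oddb; case: (a == v); case: (b == v); case: (c == v); case: (odd S).
pose fwd := (s e' == a) && (d e' == c).
have oe' : ~~ fwd -> (s e' == c) && (d e' == a).
  have := o e' e'F; rewrite /oriented /en' eqxx /fwd !xpair_eqE ![_ == s e']eq_sym ![_ == d e']eq_sym.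
  by case/orP => /andP[-> ->].
(* Both edges follow the direction of the merged edge ac, passing through b. *)
exists (fun x => if x == e then if fwd then a else b else
                 if x == e' then if fwd then b else c else s x),
  (fun x => if x == e then if fwd then b else a else
            if x == e' then if fwd then c else b else d x); split.
  move=> x xF; rewrite /oriented; have [->|xe] := eqVneq x e.
    by rewrite Ee; case: ifP; rewrite eqxx ?orbT.
  have [->|xe'] := eqVneq x e'; first by case: ifP; rewrite // orbC.
  by have := o x; rewrite !inE xe xF /oriented /en' (negPf xe'); apply.
move=> v; have := bal v; rewrite !sD !sD' !eqxx (negPf e'e).
rewrite [X in _ -> _ + (_ + X) = _](eq_bigr (fun x => (s x == v) : nat)); last first.
  by move=> x; rewrite !inE => /andP[/negPf-> /andP[/negPf->]].
rewrite [X in _ -> _ = _ + (_ + X)](eq_bigr (fun x => (d x == v) : nat)); last first.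
  by move=> x; rewrite !inE => /andP[/negPf-> /andP[/negPf->]].
case: (boolP fwd) => [/andP[/eqP-> /eqP->]|/oe' /andP[/eqP-> /eqP->]]; clear; lia.
Qed.

End EulerOrientation.

(** * Edmonds' theorem on disjoint branchings *)

Section Branchings.
Local Open Scope nat_scope.
Variables (V E : finType) (s d : E -> V) (r : V).
Implicit Types (F T D : {set E}) (A B S : {set V}) (e : E) (v : V).

Definition enters e A : bool := (s e \notin A) && (d e \in A).
Definition indeg D A : nat := #|[set e in D | enters e A]|.

Lemma indegE D A : indeg D A = \sum_(e in D) enters e A.
Proof.
rewrite /indeg -sum1_card big_mkcond [RHS]big_mkcond; apply: eq_bigr => e _.
by rewrite !inE; case: (e \in D); case: (enters e A).
Qed.

Lemma indeg_submod D A B : indeg D (A :&: B) + indeg D (A :|: B) <= indeg D A + indeg D B.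
Proof.
rewrite !indegE -!big_split; apply: leq_sum => e _; rewrite /enters !inE.
by do 4!case: (_ \in _).
Qed.

Definition arborescence T : Prop :=
  (forall A, A != set0 -> r \notin A -> 0 < indeg T A) /\
  (forall v, \sum_(e in T) (d e == v) <= 1).

(** Lovász's argument: a branching on [S] is grown from the root while at least l arcs outside it
    keep entering every set. An arc leaving [S] may be added if it enters no tight set. *)
Lemma branching1 F l : (forall A, A != set0 -> r \notin A -> l < indeg F A) ->
  exists T, [/\ T \subset F, arborescence T &
    forall A, A != set0 -> r \notin A -> l <= indeg (F :\: T) A].
Proof.
move=> hF.
suff grow n S T : #|~: S| <= n -> r \in S -> T \subset F ->
    (forall e, e \in T -> (s e \in S) && (d e \in S)) ->
    (forall A, A :&: S != set0 -> r \notin A -> 0 < indeg T A) ->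
    (forall v, \sum_(e in T) (d e == v) <= 1) ->
    (forall A, A != set0 -> r \notin A -> l <= indeg (F :\: T) A) ->
  exists T, [/\ T \subset F, arborescence T &
    forall A, A != set0 -> r \notin A -> l <= indeg (F :\: T) A].
  apply: (grow #|V| [set r] set0).
  - exact: max_card.
  - by rewrite inE.
  - exact: sub0set.
  - by move=> e; rewrite in_set0.
  - move=> A /set0Pn[x]; rewrite !inE => /andP[xA /eqP xr]; by rewrite -xr xA.
  - by move=> v; rewrite big_set0.
  - by move=> A A0 rA; rewrite setD0 ltnW // hF.
elim: n S T => [|n IH] S T nS rS TF TS reach id1 cutT.
  exists T; split=> //; split=> // A A0 rA; apply: reach => //.
  suff -> : S = setT by rewrite setIT.
  by apply/eqP; rewrite -subTset -setCS setCT subset0 -cards_eq0 -leqn0.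
have [ST|ST] := eqVneq S setT.
  by exists T; split=> //; split=> // A A0 rA; apply: reach => //; rewrite ST setIT.
pose tight B := [&& B != set0, r \notin B & indeg (F :\: T) B <= l].
suff [e [eF sS dS nt]] : exists e, [/\ e \in F, s e \in S, d e \notin S &
    forall B, tight B -> ~~ enters e B].
  have eT : e \notin T by apply: contra dS => /TS/andP[].
  have dT : [disjoint [set e] & T] by rewrite disjoints1.
  have sumT (g : E -> nat) : \sum_(x in e |: T) g x = g e + \sum_(x in T) g x.
    by rewrite big_setU1.
  apply: (IH (d e |: S) (e |: T)).
  - have : #|~: (d e |: S)| < #|~: S|; last by move: nS; clear; lia.
    apply: proper_card; rewrite properC; apply/properP; split; first exact: subsetUr.
    by exists (d e); rewrite // !inE eqxx.
  - by rewrite !inE rS orbT.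
  - by rewrite subUset sub1set eF.
  - move=> x; rewrite !inE => /orP[/eqP->|/TS/andP[-> ->]]; last by rewrite !orbT.
    by rewrite eqxx sS orbT.
  - move=> A AS rA; rewrite indegE sumT -indegE.
    have [/eqP A0|A0] := boolP (A :&: S == set0); last by rewrite addn_gt0 reach ?orbT.
    rewrite addn_gt0 lt0b /enters; apply/orP; left.
    have sA : s e \notin A.
      by apply/negP => sA; have /setP/(_ (s e)) := A0; rewrite !inE sA sS.
    rewrite sA /=; have /set0Pn[x] := AS; rewrite !inE => /andP[xA /orP[/eqP<-//|xS]].
    by have /setP/(_ x) := A0; rewrite !inE xA xS.
  - move=> v; rewrite sumT; case: eqP => [<-|_]; last exact: id1.
    rewrite big1 // => x /TS/andP[_ dx]; apply/eqP; rewrite eqb0.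
    by apply: contraNneq dS => <-.
  - move=> A A0 rA; have := cutT A A0 rA.
    have EI : indeg (F :\: T) A = enters e A + indeg (F :\: (e |: T)) A.
      rewrite !indegE (big_setD1 e) /= ?inE ?eF ?eT //; congr (_ + _).
      by apply: eq_bigl => x; rewrite !inE negb_or andbA.
    rewrite {1}EI; have [en|_] := boolP (enters e A); last by [].
    have : ~~ tight A by apply/negP => /nt; rewrite en.
    by rewrite /tight A0 rA /= -ltnNge EI en.
have VS : ~: S != set0 by rewrite -setCT (inj_eq (@setC_inj _)).
have rVS : r \notin ~: S by rewrite inE rS.
have noT A : A \subset ~: S -> indeg (F :\: T) A = indeg F A.
  move=> /subsetP AS; apply: eq_card => x; rewrite !inE.
  case en: (enters x A); rewrite ?andbF // !andbT.
  case xT: (x \in T) => //=; have /andP[_ dx] := TS x xT.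
  by move: en; rewrite /enters => /andP[_ /AS]; rewrite inE dx.
(* Take a minimal tight [B] not contained in [S]. All arcs of [T] lie inside [S], so more than l of
   the remaining arcs enter [B :\: S] while at most l enter [B]; some arc runs from [B] within [S]
   to [B :\: S]. *)
have [B0 /andP[tB0 B0S]|none] := pickP [pred B | tight B && (B :\: S != set0)].
  have [B /andP[tB BS] minB] := @arg_minnP _ B0 (fun B => tight B && (B :\: S != set0))
    (fun B : {set V} => #|B|) (introT andP (conj tB0 B0S)).
  have /and3P[B1 rB tlB] := tB.
  have : indeg (F :\: T) B < indeg (F :\: T) (B :\: S).
    rewrite (noT (B :\: S)); last by rewrite setDE subsetIr.
    by apply: leq_ltn_trans tlB _; apply: hF => //; rewrite inE negb_and rB orbT.
  rewrite /indeg ltnNge => /negP H; have /subsetPn[e] :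
      ~~ ([set e in F :\: T | enters e (B :\: S)] \subset [set e in F :\: T | enters e B]).
    by apply/negP => /subset_leq_card.
  rewrite !inE => /andP[eFT en]; rewrite eFT /= => nen.
  have [eF dB dS] : [/\ e \in F, d e \in B & d e \notin S].
    by case/andP: eFT => _ ->; move: en; rewrite /enters !inE => /and3P[_ -> ->].
  have sB : s e \in B by move: nen; rewrite /enters dB andbT negbK.
  have sS : s e \in S by move: en; rewrite /enters !inE sB andbT negbK => /andP[].
  exists e; split=> // C tC; apply/negP => /andP[sC dC]; have /and3P[C0 rC tlC] := tC.
  have dI : d e \in B :&: C by rewrite inE dB.
  (* If the arc entered a tight [C], submodularity would make the intersection tight, and it is
     smaller since it misses the tail. *)
  have tI : tight (B :&: C) && ((B :&: C) :\: S != set0).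
    rewrite /tight -!andbA; apply/and4P; split.
    - by apply/set0Pn; exists (d e).
    - by rewrite inE negb_and rB.
    - have := indeg_submod (F :\: T) B C.
      have : l <= indeg (F :\: T) (B :|: C).
        apply: cutT; last by rewrite inE negb_or rB.
        by apply/set0Pn; exists (d e); rewrite inE dB.
      by move: tlB tlC; clear; lia.
    - by apply/set0Pn; exists (d e); rewrite !inE dS dB dC.
  have := minB _ tI; rewrite leqNgt => /negP[]; apply: proper_card.
  by apply/properP; split; [exact: subsetIl|exists (s e); rewrite // inE (negPf sC) andbF].
have /card_gt0P[e] : 0 < #|[set e in F | enters e (~: S)]|.
  by apply: leq_ltn_trans (leq0n l) (hF _ VS rVS).
rewrite inE /enters !inE negbK => /and3P[eF sS dS].
exists e; split=> // B tB; apply/negP => /andP[_ dB]; have := none B; rewrite /= tB /=.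
by move/negbT; rewrite negbK => /eqP/setP/(_ (d e)); rewrite !inE dS dB.
Qed.

Theorem branchings F l : (forall A, A != set0 -> r \notin A -> l <= indeg F A) ->
  exists T : 'I_l -> {set E}, [/\ forall i, T i \subset F, forall i, arborescence (T i) &
    forall i j, i != j -> [disjoint T i & T j]].
Proof.
elim: l F => [|l IH] F hF; first by exists (fun=> set0); split; case.
have [T [TF aT hT]] := branching1 hF; have [C [CF aC dC]] := IH _ hT.
exists (fun i => if unlift ord0 i is Some j then C j else T); split.
- by move=> i; case: unliftP => [j|] _ //; apply: subset_trans (CF j) (subsetDl _ _).
- by move=> i; case: unliftP.
- have dCT j : [disjoint C j & T].
    by have := CF j; rewrite subsetD => /andP[].
  move=> i j; case: unliftP => [i'|] ->; case: unliftP => [j'|] -> //.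
  + by move=> ij; apply: dC; apply: contraNneq ij => ->.
  + by rewrite disjoint_sym.
Qed.

End Branchings.

(** * Balancing a factor along alternating walks *)

Lemma path_nonlast (T : eqType) (e e' : rel T) x p : path e x p ->
  (forall y z, y \in belast x p -> z \in p -> e y z -> e' y z) -> path e' x p.
Proof.
elim: p x => //= y p IH x /andP[exy pp] H; rewrite H ?inE ?eqxx //=.
by apply: IH => // u v ub vp; apply: H; rewrite inE ?ub ?vp orbT.
Qed.

(** The contribution of one arc in [counting]: [f], [t1], [t2] record membership in F, [T1], [T2],
    and the other variables whether the tail or head lies in O or U. *)
Lemma edge_bound (f t1 t2 so su d_o du : bool) : t1 ==> f -> f ==> ~~ t2 ->
  so ==> ~~ su -> d_o ==> ~~ du ->
  (f && ~~ t1) && so ==> du -> (f && ~~ t1) && d_o ==> su ->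
  (~~ f && ~~ t2) && su ==> d_o -> (~~ f && ~~ t2) && du ==> so ->
  (if f then 1 else -1) * (so%:Z + d_o%:Z - (su%:Z + du%:Z)) <=
  2 * (t1 && d_o)%:Z + 2 * (t2 && du)%:Z + ((so || su)%:Z - (d_o || du)%:Z) :> int.
Proof.
by case: f; case: t1; case: t2 => //=; case: so; case: su; case: d_o; case: du.
Qed.

Section Balancing.
Variables (V E : finType) (s d : E -> V) (P : {set E}) (m m0 : nat).
Implicit Types (F T : {set E}) (e : E) (u v x y : V) (w : V * bool).
Hypothesis bal : forall v, (\sum_(e in P) (s e == v) = \sum_(e in P) (d e == v))%N.

Definition incsd e v : int := (s e == v)%:Z + (d e == v)%:Z.
Definition sg F e : int := if e \in F then 1 else -1.
(** For F inside [P] this is 2d_F - d_P at v, with loops counted twice. *)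
Definition imb F v : int := \sum_(e in P) sg F e * incsd e v.
Definition flip F e : {set E} := if e \in F then F :\ e else e |: F.

Lemma sg_flip F e e' : sg (flip F e) e' = if e' == e then - sg F e else sg F e'.
Proof.
rewrite /sg /flip; have [->|ne] := eqVneq e' e.
  by case eF: (e \in F); rewrite !inE eqxx ?opprK.
by case eF: (e \in F); rewrite !inE ?ne ?(negPf ne).
Qed.

Lemma imb_flip F e v : e \in P -> imb (flip F e) v = imb F v - 2 * sg F e * incsd e v.
Proof.
move=> eP; rewrite /imb (big_setD1 e) //= [in RHS](big_setD1 e) //= sg_flip eqxx.
rewrite (eq_bigr (fun e' => sg F e' * incsd e' v)); first by ring.
by move=> x; rewrite !inE sg_flip => /andP[/negPf->].
Qed.

Lemma imb_even F v : (2 %| imb F v)%Z.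
Proof.
have E0 : (2 %| \sum_(e in P) incsd e v)%Z.
  rewrite /incsd big_split /= -!(big_morph Posz PoszD (erefl _)) bal.
  by lia.
have -> : imb F v = \sum_(e in P) incsd e v + \sum_(e in P) (sg F e - 1) * incsd e v.
  by rewrite -big_split; apply: eq_bigr => e _ /=; ring.
apply: rpredD => //; apply: rpred_sum => e _; rewrite /sg; case: ifP => _; first by rewrite subrr mul0r.
by apply: dvdz_mulr.
Qed.

Section Augment.
Variables (T1 T2 : {set E}).
Hypotheses (T1P : T1 \subset P) (T2P : T2 \subset P).
Hypothesis dT : [disjoint T1 & T2].
Hypotheses (id1 : forall v, (\sum_(e in T1) (d e == v) <= m)%N)
  (id2 : forall v, (\sum_(e in T2) (d e == v) <= m0)%N).
Hypothesis m_gt0 : (0 < m + m0)%N.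

Definition adm F : bool := [&& T1 \subset F, F \subset P & [disjoint F & T2]].
Definition joinsd e x y : bool := ((s e == x) && (d e == y)) || ((s e == y) && (d e == x)).

(* [true] marks a vertex that must lose an edge of F, [false] one that must gain an edge. *)
Definition free F b e : bool := if b then (e \in F) && (e \notin T1) else (e \notin F) && (e \notin T2).
Definition step F w w' : bool :=
  (w'.2 == ~~ w.2) && [exists e in P, free F w.2 e && joinsd e w.1 w'.1].
Definition dir (b : bool) : int := if b then 2 else -2.

Lemma incsd_joins e x y v : joinsd e x y -> incsd e v = (x == v)%:Z + (y == v)%:Z.
Proof. by rewrite /joinsd /incsd => /orP[] /andP[/eqP-> /eqP->] //; rewrite addrC. Qed.

Lemma adm_flip F b e : adm F -> e \in P -> free F b e -> adm (flip F e).
Proof.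
case/and3P=> TF FP dF eP; rewrite /free /flip; case: b => /andP[eF eT].
  rewrite eF; apply/and3P; split; first by rewrite subsetD1 TF.
  - exact: subset_trans (subD1set _ _) FP.
  - exact: disjointWl (subD1set _ _) dF.
rewrite (negPf eF); apply/and3P; split; first exact: subset_trans (subsetUr _ _).
- by rewrite subUset sub1set eP.
- by rewrite -setI_eq0 setIUl setU_eq0 !setI_eq0 disjoints1 eT.
Qed.

(** Changes at inner vertices of the walk cancel. Since no vertex but the last repeats, no edge is
    used twice, so each edge is still free when its turn comes. *)
Lemma augment F x b p : adm F -> p != [::] -> path (step F) (x, b) p -> uniq ((x, b) :: p) ->
  uniq [seq w.1 | w <- belast (x, b) p] ->
  exists2 F', adm F' & forall v, imb F' v = imb F v - dir b * (x == v)%:Z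
    + dir (last (x, b) p).2 * ((last (x, b) p).1 == v)%:Z.
Proof.
elim: p F x b => // -[y c] p IH F x b aF _ /= /andP[/andP[/eqP/= Ec]].
rewrite {c}Ec => /exists_inP[e eP /andP[fe je]] pth /andP[nx un] /andP[nx1 un1].
have aF' := adm_flip aF eP fe.
have iF v : imb (flip F e) v = imb F v - dir b * (x == v)%:Z + dir (~~ b) * (y == v)%:Z.
  rewrite imb_flip // (incsd_joins v je) /dir; move: fe; rewrite /free /sg.
  by case: (b) => /andP[eF _]; rewrite ?eF ?(negPf eF) /=; ring.
case: p IH pth nx un nx1 un1 => [|w p] IH pth nx un nx1 un1.
  by exists (flip F e).
have [||||F' aF'' iF'] := IH (flip F e) y (~~ b) aF' => //.
  apply: path_nonlast pth _ => -[u a] [v a'] ub vp /andP[/eqP/= -> ] /exists_inP[e' e'P /andP[fe' je']].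
  apply/andP; split; first exact: eqxx.
  apply/exists_inP; exists e' => //=; rewrite je' andbT.
  have ne : e' != e.
    apply/eqP => E'; subst e'.
    have ab : a = b by move: fe fe'; rewrite /free; case: (a); case: (b); case: (e \in F).
    have ux : u != x.
      by apply: contraNneq nx1 => <-; apply: (map_f fst ub).
    have uy : u = y.
      move: je je' ux; rewrite /joinsd => /orP[] /andP[/eqP-> /eqP->] /orP[] /andP[/eqP? /eqP?]; subst; by rewrite ?eqxx.
    subst u a; move: ub un1 => /=; rewrite inE => /orP[/eqP[]|ub]; first by case: (b).
    by move=> /andP[+ _]; rewrite (map_f fst ub).
  move: fe'; rewrite /free /flip; case: (a); case: ifP => eF; rewrite !inE ?ne ?(negPf ne) //.
exists F' => // v; rewrite iF' iF; set L := dir _.2 * _.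
by case: (b); rewrite /dir /=; ring.
Qed.

Definition viol (a : int) : int := Num.max 0 (a - 2 * m%:Z) + Num.max 0 (- 2 * m0%:Z - a).
Definition potential F : int := \sum_v viol (imb F v).

(** Compare the sum of [imb] over O minus that over U. Edges of F outside [T1] that meet O run to U
    and cancel, and likewise for edges outside F and [T2] that meet U. The rest is charged to heads
    of [T1] in O and of [T2] in U, at most m and m0 per vertex, plus a tail-minus-head term that
    vanishes by balance. Since the vertices already attain their bounds, none in O exceeds 2m. *)
Lemma counting F v0 (O U : {set V}) : adm F -> [disjoint O & U] ->
  (forall x e u, x \in O -> e \in P -> free F true e -> joinsd e x u -> u \in U) ->
  (forall x e u, x \in U -> e \in P -> free F false e -> joinsd e x u -> u \in O) ->
  (forall x, x \in O -> 2 * m%:Z <= imb F x) -> (forall x, x \in U -> imb F x <= - 2 * m0%:Z) ->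
  v0 \in O -> imb F v0 <= 2 * m%:Z.
Proof.
move=> aF dOU clO clU hO hU vO.
have dis x : x \in O -> x \in U = false by move=> xO; apply: disjointFr dOU xO.
have S (A : {set V}) (g : E -> V) (D : {set E}) :
    \sum_(x in A) \sum_(e in D) (g e == x)%:Z = \sum_(e in D) (g e \in A)%:Z.
  rewrite exchange_big; apply: eq_bigr => e _ /=.
  rewrite big_mkcond (bigD1 (g e)) //= eqxx big1 ?addr0; first by case: ifP.
  by move=> x xg; rewrite eq_sym (negPf xg); case: ifP.
have SI (A : {set V}) : \sum_(x in A) imb F x =
    \sum_(e in P) sg F e * ((s e \in A)%:Z + (d e \in A)%:Z).
  rewrite /imb exchange_big; apply: eq_bigr => e _ /=; rewrite -mulr_sumr; congr (_ * _).
  rewrite /incsd big_split /=; congr (_ + _); have := S A; [move=> /(_ s [set e])|move=> /(_ d [set e])];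
  by rewrite big_set1 => <-; apply: eq_bigr => x _; rewrite big_set1.
have le1 : \sum_(x in O) imb F x - \sum_(x in U) imb F x <=
    \sum_(e in P) (2 * ((e \in T1) && (d e \in O))%:Z + 2 * ((e \in T2) && (d e \in U))%:Z
      + ((s e \in O :|: U)%:Z - (d e \in O :|: U)%:Z)).
  rewrite !SI -sumrB; apply: ler_sum => e eP; rewrite -mulrBr.
  have /and3P[TF FP dF] := aF.
  have js : joinsd e (s e) (d e) by rewrite /joinsd !eqxx.
  have jd : joinsd e (d e) (s e) by rewrite /joinsd !eqxx orbT.
  rewrite !in_setU; apply: edge_bound.
  - by apply/implyP; apply: (subsetP TF).
  - by apply/implyP => eF; rewrite (disjointFr dF).
  - by apply/implyP => xO; rewrite dis.
  - by apply/implyP => xO; rewrite dis.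
  - by apply/implyP => /andP[fe sO]; apply: clO sO eP fe js.
  - by apply/implyP => /andP[fe sO]; apply: clO sO eP fe jd.
  - by apply/implyP => /andP[fe sO]; apply: clU sO eP fe js.
  - by apply/implyP => /andP[fe sO]; apply: clU sO eP fe jd.
have bound1 (T : {set E}) (A : {set V}) l : T \subset P -> (forall v, (\sum_(e in T) (d e == v) <= l)%N) ->
    \sum_(e in P) ((e \in T) && (d e \in A))%:Z <= (l * #|A|)%:Z.
  move=> TP hT; have -> : \sum_(e in P) ((e \in T) && (d e \in A))%:Z = \sum_(e in T) (d e \in A)%:Z.
    rewrite [LHS]big_mkcond [RHS]big_mkcond; apply: eq_bigr => e _.
    by case eT: (e \in T) => /=; [rewrite (subsetP TP)|case: ifP].
  rewrite -S mulnC -sum_nat_const (big_morph Posz PoszD (erefl _)); apply: ler_sum => x _.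
  rewrite -(big_morph Posz PoszD (erefl _)); exact: hT.
have b1 := bound1 T1 O m T1P id1; have b2 := bound1 T2 U m0 T2P id2.
have b3 : \sum_(e in P) ((s e \in O :|: U)%:Z - (d e \in O :|: U)%:Z) = 0.
  rewrite sumrB -!S -sumrB big1 // => x _.
  by rewrite -!(big_morph Posz PoszD (erefl _)) bal subrr.
have b4 : \sum_(x in O) imb F x >= imb F v0 + 2 * m%:Z * (#|O|%:Z - 1).
  rewrite (big_setD1 v0) //= lerD2l (cardsD1 v0) vO.
  have : \sum_(x in O :\ v0) (2 * m%:Z) <= \sum_(x in O :\ v0) imb F x.
    by apply: ler_sum => x; rewrite !inE => /andP[_]; exact: hO.
  rewrite sumr_const -[X in X <= _ -> _]mulr_natr [#|_|%:R]natz.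
  by rewrite (_ : (true + #|O :\ v0|)%N%:Z - 1 = #|O :\ v0|%:Z) //; clear; lia.
have b5 : \sum_(x in U) imb F x <= - 2 * m0%:Z * #|U|%:Z.
  have : \sum_(x in U) imb F x <= \sum_(x in U) (- 2 * m0%:Z).
    by apply: ler_sum => x; exact: hU.
  by rewrite sumr_const -[X in _ <= X -> _]mulr_natr [#|_|%:R]natz.
move: le1; rewrite big_split big_split /= b3 -!mulr_sumr.
by move: b1 b2 b4 b5; rewrite !PoszM; move: (\sum_(_ in _) _) (\sum_(_ in _) _) (\sum_(_ in _) _) (\sum_(_ in _) _); clear; nia.
Qed.

Lemma viol_ge0 a : 0 <= viol a.
Proof. by rewrite /viol; clear; lia. Qed.

(** Either some state reachable from the violating vertex can absorb a change of two, and a walk to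
    the first such state is flipped, or the reachable states contradict [counting]. *)
Lemma improve F v0 : adm F -> 2 * m%:Z < imb F v0 ->
  exists2 F', adm F' & potential F' < potential F.
Proof.
move=> aF v0m; pose X w := connect (step F) (v0, true) w.
pose ok w : bool := if w.2 then imb F w.1 < 2 * m%:Z else - 2 * m0%:Z < imb F w.1.
have [w /andP[/connectP[p pp wE] okw]|none] := pickP [pred w | X w && ok w].
  move: wE; case/shortenP: pp => p' pp' up' sub wE.
  have nok0 : ~~ ok (v0, true) by rewrite /ok /= -leNgt ltW.
  have hp' : has ok p'.
    case: p' pp' up' sub wE => [|z p'] _ _ _ wE.
      by have wE' : w = (v0, true) := wE; case/negP: nok0; rewrite -wE'.
    by apply/hasP; exists w => //; rewrite (wE : w = last z p') mem_last.
  have [z [p1 [p2 [Ep okz nok1]]]] : exists z p1 p2, [/\ p' = rcons p1 z ++ p2, ok z & ~~ has ok p1].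
    by case/split_find: hp' => z p1 p2 okz nok; exists z, p1, p2.
  rewrite Ep cat_path in pp'; case/andP: pp' => pp1 _.
  have un : uniq ((v0, true) :: rcons p1 z).
    by move: up'; rewrite Ep -cat_cons cat_uniq => /andP[].
  (* Here m + m0 > 0 enters: a vertex failing [ok] in both states would satisfy 2m <= imb <=
     -2m0. *)
  have un1 : uniq [seq w.1 | w <- belast (v0, true) (rcons p1 z)].
    rewrite belast_rcons map_inj_in_uniq; first by move: un; rewrite -rcons_cons rcons_uniq => /andP[].
    have nok (x : V * bool) : x \in (v0, true) :: p1 -> ~~ ok x.
      rewrite inE => /orP[/eqP->//|xp]; apply: contra nok1 => okx; apply/hasP; by exists x.
    move=> [x b] [y c] /nok n1 /nok n2 /= E'; subst y; congr (_, _).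
    by move: n1 n2; rewrite /ok /=; case: (b); case: (c) => //; rewrite -!leNgt; move: m_gt0; clear; lia.
  have [|F' aF' iF'] := augment aF _ pp1 un un1; first by case: (p1).
  exists F' => //; rewrite last_rcons in iF'.
  rewrite /potential (bigD1 v0) //= [ltRHS](bigD1 v0) //=.
  (* Imbalances are even, so a strict inequality leaves room for a change of two and creates no new
     violation. *)
  have ev := imb_even F; apply: ltr_leD.
    rewrite iF' eqxx /dir; have := okz; rewrite /ok /viol; have := ev v0.
    by have [->|zv] := eqVneq z.1 v0; case: z.2 => /=; move: v0m m_gt0; clear; lia.
  apply: ler_sum => v vv; rewrite iF' eq_sym (negPf vv) mulr0 subr0.
  have := okz; rewrite /ok /viol /dir; have := ev v.
  by have [->|zv] := eqVneq z.1 v; case: z.2 => /=; move: m_gt0; clear; lia.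
pose O := [set v | X (v, true)]; pose U := [set v | X (v, false)].
have nok w : X w -> ~~ ok w by move=> Xw; apply/negP => okw; have := none w; rewrite /= Xw okw.
have hO x : x \in O -> 2 * m%:Z <= imb F x by rewrite inE => /nok; rewrite /ok /= -leNgt.
have hU x : x \in U -> imb F x <= - 2 * m0%:Z by rewrite inE => /nok; rewrite /ok /= -leNgt.
suff : imb F v0 <= 2 * m%:Z by rewrite leNgt v0m.
apply: (counting aF _ _ _ hO hU).
- rewrite -setI_eq0; apply/eqP/setP => x; rewrite in_set0 in_setI; apply/negbTE/negP.
  by case/andP => /hO h1 /hU h2; move: h1 h2 m_gt0; clear; lia.
- move=> x e u; rewrite !inE => Xx eP fe je; apply: connect_trans Xx (connect1 _).
  by apply/andP; split=> //; apply/exists_inP; exists e => //=; rewrite je andbT.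
- move=> x e u; rewrite !inE => Xx eP fe je; apply: connect_trans Xx (connect1 _).
  by apply/andP; split=> //; apply/exists_inP; exists e => //=; rewrite je andbT.
- by rewrite inE /X connect0.
Qed.

End Augment.
End Balancing.

Section BalancedFactor.
Variables (V E : finType) (s d : E -> V) (P : {set E}) (m m0 : nat) (T1 T2 : {set E}).
Hypothesis bal : forall v, (\sum_(e in P) (s e == v) = \sum_(e in P) (d e == v))%N.
Hypotheses (T1P : T1 \subset P) (T2P : T2 \subset P) (dT : [disjoint T1 & T2]).
Hypotheses (id1 : forall v, (\sum_(e in T1) (d e == v) <= m)%N)
  (id2 : forall v, (\sum_(e in T2) (d e == v) <= m0)%N).
Hypothesis m_gt0 : (0 < m + m0)%N.

Lemma imb_compl (F : {set E}) v : imb s d P (P :\: F) v = - imb s d P F v.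
Proof.
rewrite /imb -sumrN; apply: eq_bigr => e eP; rewrite /sg !inE eP andbT.
by case: (e \in F); rewrite ?mul1r ?mulN1r ?opprK.
Qed.

(** A minimizer of the potential works. The lower bound is the upper bound for [P :\: F], which
    exchanges [T1] with [T2] and m with m0. *)
Lemma balanced_factor : exists F : {set E}, [/\ T1 \subset F, F \subset P, [disjoint F & T2] &
  forall v, - 2 * m0%:Z <= imb s d P F v <= 2 * m%:Z].
Proof.
have a0 : adm P T1 T2 T1 by rewrite /adm subxx T1P dT.
have [F aF minF] := @arg_minnP _ T1 (adm P T1 T2) (fun F => absz (potential s d P m m0 F)) a0.
have pot0 (m1 m2 : nat) F' : 0 <= potential s d P m1 m2 F' by apply: sumr_ge0 => v _; exact: viol_ge0.
have no F' : adm P T1 T2 F' -> ~~ (potential s d P m m0 F' < potential s d P m m0 F).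
  move=> /minF; have := pot0 m m0 F; have := pot0 m m0 F'; clear; lia.
have /and3P[TF FP dF] := aF; exists F; split=> // v; apply/andP; split; rewrite leNgt; apply/negP => lt.
- have potC F' : potential s d P m0 m (P :\: F') = potential s d P m m0 F'.
    by apply: eq_bigr => x _; rewrite imb_compl /viol; clear; lia.
  have admC F1 (S1 S2 : {set E}) : S2 \subset P -> adm P S1 S2 F1 -> adm P S2 S1 (P :\: F1).
    move=> S2P /and3P[h1 h2 h3]; apply/and3P; split; last first.
    - by rewrite disjoint_sym; apply: disjointWl h1 _; rewrite disjoint_sym disjoints_subset setDE subsetIr.
    - exact: subsetDl.
    - by rewrite subsetD S2P disjoint_sym.
  have dT' : [disjoint T2 & T1] by rewrite disjoint_sym.
  have m_gt0' : (0 < m0 + m)%N by rewrite addnC.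
  have lt' : 2 * m0%:Z < imb s d P (P :\: F) v by rewrite imb_compl; move: lt; clear; lia.
  have [F' aF'] := improve bal T2P T1P id2 id1 m_gt0' (admC _ _ _ T2P aF) lt'.
  have EF : F' = P :\: (P :\: F').
    by have /and3P[_ /setIidPr + _] := aF'; rewrite setDDr setDv set0U.
  by rewrite EF !potC; apply/negP/no/admC.
- have [F' aF'] := improve bal T1P T2P id1 id2 m_gt0 aF lt.
  exact/negP/no.
Qed.

End BalancedFactor.

(** * Matroid union through Rado's condition *)

Section MatroidPartition.
Local Open Scope nat_scope.
Variables (E I : finType) (r : I -> {set E} -> nat) (rho : I -> nat).
Implicit Types (A B D U : {set E}) (e : E) (i : I) (X : I -> {set E}).
Hypothesis r_mono : forall i A B, A \subset B -> r i A <= r i B.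
Hypothesis r_sub : forall i A B, r i (A :&: B) + r i (A :|: B) <= r i A + r i B.
Hypothesis r_rho : forall i A, r i A <= rho i.

Let surplus D X U := #|D :\: U| + \sum_i r i (U :|: X i).

(* Rado's greedy argument: [e] cannot be given to the class [i] only if some set U avoiding [e] is
   tight and spans [e] in the i-th matroid; the union of these tight sets for all i would then
   violate the hypothesis after adding [e]. *)
Lemma matroid_partition_aux n D X : #|D| <= n ->
  (forall i j, i != j -> [disjoint X i & X j]) -> (forall i, [disjoint X i & D]) ->
  (forall U, U \subset D -> \sum_i rho i <= surplus D X U) ->
  exists Y : I -> {set E}, (forall i j, i != j -> [disjoint Y i & Y j]) /\ forall i, rho i <= r i (Y i).
Proof.
elim: n D X => [|n IH] D X Dn dX dXD hD.
  exists X; split=> // i; move: Dn; rewrite leqn0 cards_eq0 => /eqP D0.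
  have := hD set0 (sub0set _); rewrite /surplus D0 setDv cards0 add0n.
  rewrite [X in _ <= X](eq_bigr (fun i => r i (X i))) => [|j _]; last by rewrite set0U.
  rewrite (bigD1 i) //= [leqRHS](bigD1 i) //=.
  have : \sum_(j | j != i) r j (X j) <= \sum_(j | j != i) rho j by apply: leq_sum.
  lia.
have [D0|[e eD]] := set_0Vmem D; first by apply: (IH D X) => //; rewrite D0 cards0.
pose add i j := if j == i then e |: X i else X j.
have [i /forall_inP hi|bad] := pickP (fun i => [forall (U : {set E} | U \subset D :\ e),
    \sum_i rho i <= surplus (D :\ e) (add i) U]).
  apply: (IH (D :\ e) (add i)) => //.
  - by move: Dn; rewrite (cardsD1 e) eD.
  - have de j : [disjoint [set e] & X j].
      by rewrite disjoints1; apply/negP => /(disjointFr (dXD j)); rewrite eD.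
    move=> j1 j2 ij; rewrite /add; have [E1|n1] := eqVneq j1 i; have [E2|n2] := eqVneq j2 i.
    + by rewrite E1 E2 eqxx in ij.
    + by rewrite -setI_eq0 setIUl setU_eq0 !setI_eq0 de dX // eq_sym.
    + by rewrite disjoint_sym -setI_eq0 setIUl setU_eq0 !setI_eq0 de dX // eq_sym.
    + exact: dX.
  - move=> j; rewrite /add; case: eqP => _; last exact: disjointWr (subD1set _ _) (dXD j).
    rewrite -setI_eq0 setIUl setU_eq0 !setI_eq0 disjoints1 !inE eqxx /=.
    exact: disjointWr (subD1set _ _) (dXD i).
pose tight U := (U \subset D :\ e) && (surplus D X U <= \sum_i rho i).
have sub1 U : U \subset D :\ e -> U \subset D by move/subset_trans; apply; apply: subD1set.
have eU U : U \subset D :\ e -> e \notin U by rewrite subsetD1 => /andP[].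
have sm A B : surplus D X (A :&: B) + surplus D X (A :|: B) <= surplus D X A + surplus D X B.
  rewrite /surplus addnACA [leqRHS]addnACA leq_add //.
    by rewrite setDIr setDUr cardsUI.
  rewrite -!big_split; apply: leq_sum => i _ /=.
  apply: leq_trans (r_sub i _ _); rewrite leq_add // r_mono //.
    by rewrite setUIl.
  by rewrite setUUl.
have tightU A B : tight A -> tight B -> tight (A :|: B).
  move=> /andP[sA tA] /andP[sB tB]; rewrite /tight subUset sA sB /=.
  have := sm A B; have := hD (A :&: B) (sub1 _ (subset_trans (subsetIl _ _) sA)).
  by move: tA tB; lia.
have Ui i : exists2 U, tight U & r i (e |: (U :|: X i)) <= r i (U :|: X i).
  have := bad i; move/negbT; rewrite negb_forall_in => /exists_inP[U sU]; rewrite -ltnNge => lt.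
  have DU : #|D :\: U| = (#|(D :\ e) :\: U|).+1.
    rewrite (cardsD1 e) !inE eD eU //=; congr _.+1; apply: eq_card => x; rewrite !inE.
    by rewrite andbCA.
  have E1 : surplus (D :\ e) (add i) U + r i (U :|: X i) + 1 = surplus D X U + r i (e |: (U :|: X i)).
    rewrite /surplus DU (bigD1 i) //= [in RHS](bigD1 i) //= /add eqxx setUCA.
    rewrite (eq_bigr (fun j => r j (U :|: X j))); last by move=> j /negPf->.
    lia.
  have h := hD U (sub1 U sU); have mono : r i (U :|: X i) <= r i (e |: (U :|: X i)) by rewrite r_mono ?subsetUr.
  by exists U; rewrite ?/tight ?sU /=; lia.
have [t0 /andP[i0 _]|noI] := pickP (fun i : I => predT i && predT i); last first.
  by exists X; split=> // i; have := noI i.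
have [U0 tU0 _] := Ui t0.
have [U tU maxU] := @arg_maxnP _ U0 tight (fun U => #|U|) tU0.
have absorb B : tight B -> B \subset U.
  move=> tB; have := maxU _ (tightU _ _ tU tB) => le.
  have /eqP -> : U == U :|: B by rewrite eqEcard subsetUl.
  exact: subsetUr.
have /andP[sU tlU] := tU.
have spans i : r i (e |: (U :|: X i)) <= r i (U :|: X i).
  have [B tB hB] := Ui i; have BU := setSU (X i) (absorb B tB).
  have eB : e \notin B by case/andP: tB => + _; exact: eU.
  have := r_sub i (e |: (B :|: X i)) (U :|: X i).
  have -> : (e |: (B :|: X i)) :|: (U :|: X i) = e |: (U :|: X i).
    by rewrite -setUA (setUidPr BU).
  have : r i (B :|: X i) <= r i ((e |: (B :|: X i)) :&: (U :|: X i)).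
    by rewrite r_mono // subsetI BU subsetUr.
  by move: hB; lia.
have := hD (e |: U); rewrite subUset sub1set eD sub1 // => /(_ isT).
suff : surplus D X (e |: U) < surplus D X U by move: tlU; lia.
rewrite /surplus -addSn leq_add //.
  rewrite [X in _ < X](cardsD1 e) !inE eD eU //= ltnS subset_leq_card //.
  by apply/subsetP => x; rewrite !inE negb_or andbA.
by apply: leq_sum => i _; rewrite -setUA spans.
Qed.

Lemma matroid_partition : (forall U, \sum_i rho i <= #|~: U| + \sum_i r i U) ->
  exists Y : I -> {set E}, (forall i j, i != j -> [disjoint Y i & Y j]) /\ forall i, rho i <= r i (Y i).
Proof.
move=> h; apply: (@matroid_partition_aux #|E| setT (fun=> set0)).
- exact: max_card.
- by move=> i j _; rewrite -setI_eq0 setI0.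
- by move=> i; rewrite -setI_eq0 set0I.
- move=> U _; apply: leq_trans (h U) _; rewrite /surplus setTD leq_add2l.
  by apply: leq_sum => i _; rewrite setU0.
Qed.

End MatroidPartition.

(** * Rank in the graphic matroid *)

Section GraphicRank.
Local Open Scope nat_scope.
Variable G : multigraph.
Implicit Types (W D : {set edge G}) (A X : {set G}) (x y v : G) (e : edge G).

Let n := #|G|.
Definition dl x : 'rV[rat]_n := delta_mx 0%R (enum_rank x).
Definition evec e : 'rV[rat]_n := (dl (ends e).1 - dl (ends e).2)%R.
Definition espan W : 'M[rat]_n := (\sum_(e in W) <<evec e>>)%MS.
(** The rank is the dimension of the span of incidence vectors, so submodularity is the dimension
    formula for sums and intersections of subspaces. *)
Definition rk W : nat := \rank (espan W).

Lemma espanU W D : (espan (W :|: D) :=: espan W + espan D)%MS.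
Proof.
apply/eqmxP; apply/andP; split.
  apply/sumsmx_subP => e; rewrite inE => /orP[eW|eD].
    by apply: submx_trans (addsmxSl _ _); rewrite (sumsmx_sup e).
  by apply: submx_trans (addsmxSr _ _); rewrite (sumsmx_sup e).
by rewrite addsmx_sub; apply/andP; split; apply/sumsmx_subP => e eW; rewrite (sumsmx_sup e) // inE eW ?orbT.
Qed.

Lemma espanS W D : W \subset D -> (espan W <= espan D)%MS.
Proof. by move=> /subsetP s; apply/sumsmx_subP => e /s eD; rewrite (sumsmx_sup e). Qed.

Lemma rk_mono W D : W \subset D -> rk W <= rk D.
Proof. by move=> s; apply/mxrankS/espanS. Qed.

Lemma rk_submod W D : rk (W :&: D) + rk (W :|: D) <= rk W + rk D.
Proof.
rewrite /rk espanU -[leqRHS]mxrank_sum_cap [leqLHS]addnC leq_add2l mxrankS //.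
by rewrite sub_capmx !espanS ?subsetIl ?subsetIr.
Qed.

Lemma rk1 e : rk [set e] <= 1.
Proof. by rewrite /rk /espan big_set1 genmxE rank_leq_row. Qed.

Lemma rk_unit W e : rk (e |: W) <= (rk W).+1.
Proof.
have := rk_submod [set e] W; have := rk1 e; lia.
Qed.

Lemma rkU W D : rk (W :|: D) <= rk W + #|D :\: W|.
Proof.
have [k] := ubnP #|D :\: W|; elim: k D => // k IH D; rewrite ltnS => Dk.
have [D0|[e]] := set_0Vmem (D :\: W).
  by rewrite D0 cards0 addn0; move/eqP: D0; rewrite setD_eq0 => /setUidPl->.
rewrite inE => /andP[eW eD]; have E : D :\: W = e |: ((D :\ e) :\: W).
  by apply/setP => x; rewrite !inE; case: eqP => [->|]; rewrite ?eW ?eD.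
have E' : #|D :\: W| = (#|(D :\ e) :\: W|).+1.
  by rewrite {1}E cardsU1 !inE eqxx andbF.
have -> : W :|: D = e |: (W :|: (D :\ e)) by rewrite setUCA setD1K.
apply: leq_trans (rk_unit _ _) _; rewrite E' addnS ltnS; apply: IH.
by move: Dk; rewrite E'; lia.
Qed.

Lemma connect_span W x y : connect (adjacent W) x y -> ((dl x - dl y)%R <= espan W)%MS.
Proof.
case/connectP => p; elim: p x => [|z p IH] x /= => [_ ->|/andP[/existsP[e /andP[eW j]] pp] yl].
  by rewrite subrr sub0mx.
rewrite -(subrK (dl z) (dl x)) -addrA addmx_sub ?IH //.
apply: submx_trans (_ : evec e <= _)%MS; last by rewrite (sumsmx_sup e) ?genmxE.
by case/orP: j => /eqP; rewrite /evec => -> //=; rewrite -opprB (eqmx_opp _).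
Qed.

Definition closure W : {set edge G} := [set e | connect (adjacent W) (ends e).1 (ends e).2].

Lemma rk_closure W : rk (closure W) = rk W.
Proof.
apply/eqP; rewrite eqn_leq; apply/andP; split; last first.
  by apply: rk_mono; apply/subsetP => e eW; rewrite inE connect_ends.
apply: mxrankS; apply/sumsmx_subP => e; rewrite inE => c.
by rewrite genmxE connect_span.
Qed.

Lemma rk_connected W : connected W -> n.-1 <= rk W.
Proof.
move=> cW; have [x _|n0] := pickP (fun x : G => true); last first.
  by rewrite /n eq_card0.
suff : n <= rk W + 1 by lia.
have -> : n = \rank (1%:M : 'M[rat]_n) by rewrite mxrank1.
have le1 : \rank (dl x) <= 1 by apply: rank_leq_row.
apply: leq_trans (_ : rk W + \rank (dl x) <= _); last by rewrite leq_add2l.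
apply: leq_trans (mxrank_adds_leqif _ _).1; apply: mxrankS.
apply/row_subP => i; rewrite row1 -[i]enum_valK -/(dl _) -(subrK (dl x) (dl _)).
by rewrite addmx_sub_adds // connect_span.
Qed.

Definition ind_col A : 'cV[rat]_n := (\col_i ((enum_val i \in A)%:R))%R.

Lemma dl_ind x A : (dl x *m ind_col A)%R = ((x \in A)%:R%:M)%R.
Proof.
by apply/matrixP => i k; rewrite !ord1 -rowE !mxE enum_rankK eqxx mulr1n.
Qed.

Lemma espan_ind W A : (forall e, e \in W -> ~~ crosses e A) -> (espan W *m ind_col A)%R = 0%R.
Proof.
move=> no; apply/sub_kermxP/sumsmx_subP => e /no; rewrite genmxE /crosses negbK => /eqP E.
by apply/sub_kermxP; rewrite mulmxBl !dl_ind E subrr.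
Qed.

Lemma rk_leq W : rk W <= n.-1.
Proof.
have [x _|n0] := pickP (fun x : G => true); last first.
  by apply: leq_trans (rank_leq_row _) _; rewrite /n eq_card0.
have h0 : (espan W *m ind_col setT)%R = 0%R.
  by apply: espan_ind => e _; rewrite /crosses !inE.
have := mulmx0_rank_max h0.
have : 0 < \rank (ind_col [set: G]).
  apply: leq_trans (mxrankM_maxr (dl x) _).
  by rewrite dl_ind inE mxrank1.
by rewrite /rk; move: (\rank _) (\rank _) => a b; lia.
Qed.

(** If no edge of [W] crosses [A], the indicators of [A] and of its complement are independent and
    both annihilated, so the rank is at most n-2. *)
Lemma connected_rk W : n.-1 <= rk W -> connected W.
Proof.
move=> h; apply/connectedP => A A0 AT; apply/exists_inP; apply: contraT => /exists_inPn no.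
have /set0Pn[x xA] := A0; have /subsetPn[y _ yA] : ~~ ([set: G] \subset A) by rewrite subTset.
have h1 := espan_ind no.
have h2 : (espan W *m ind_col (~: A))%R = 0%R.
  apply: espan_ind => e /no; rewrite /crosses !inE; by do 2!case: (_ \in A).
have h3 : (espan W *m row_mx (ind_col A) (ind_col (~: A)))%R = 0%R.
  by rewrite mul_mx_row h1 h2 row_mx0.
have := mulmx0_rank_max h3.
have : 2 <= \rank (row_mx (ind_col A) (ind_col (~: A))).
  apply: leq_trans (mxrankM_maxr (col_mx (dl x) (dl y)) _).
  rewrite mul_col_row !dl_ind !inE xA (negPf yA) /= [X in block_mx _ X]raddf0 [X in block_mx _ _ X]raddf0.
  by rewrite -scalar_mx_block mxrank1.
by move: h; rewrite /rk; move: (\rank _) (\rank _) => a b; lia.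
Qed.

End GraphicRank.

(** * Disjoint connected factors inside and outside a maximum cut *)

Section Packing.
Local Open Scope nat_scope.
Variable G : multigraph.
Implicit Types (W D U F : {set edge G}) (A X : {set G}) (x y v : G) (e : edge G).

(** What maximality yields when [A] is flipped: the gained edges of the cut of [A], those not
    crossing [X], are no more than the lost ones. *)
Definition max_cut X : Prop :=
  forall A, #|cutset setT A| <= 2 * #|[set e in cutset setT A | crosses e X]|.

Lemma crosses_sym A X e : crosses e ((A :\: X) :|: (X :\: A)) = crosses e A (+) crosses e X.
Proof.
by rewrite /crosses !inE; do 4!case: (_ \in _).
Qed.

Lemma max_cut_exists : exists X, max_cut X.
Proof.
have [X _ maxX] := @arg_maxnP _ (set0 : {set G}) predT (fun X => #|cutset setT X|) isT.
exists X => A; have := maxX ((A :\: X) :|: (X :\: A)) isT => /=.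
set I := [set e in cutset setT A | crosses e X].
have -> : #|cutset setT ((A :\: X) :|: (X :\: A))| = #|cutset setT A :\: I| + #|cutset setT X :\: I|.
  rewrite -cardsUI [X in _ = _ + X](_ : _ = 0) ?addn0.
    apply: eq_card => e; rewrite !inE crosses_sym.
    by case: (crosses e A); case: (crosses e X).
  apply/eqP; rewrite cards_eq0; apply/eqP/setP => e; rewrite !inE.
  by case: (crosses e A); case: (crosses e X).
have IA : I \subset cutset setT A by apply/subsetP => e; rewrite inE => /andP[].
have IX : I \subset cutset setT X by apply/subsetP => e; rewrite !inE => /andP[].
have := subset_leq_card IA; have := subset_leq_card IX.
by rewrite !cardsD (setIidPr IA) (setIidPr IX); lia.
Qed.

(* Every edge between two components of [W] leaves exactly two of them. *)
Lemma max_cut_closure X W : max_cut X ->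
  #|~: closure W| <= 2 * #|[set e | crosses e X] :\: closure W|.
Proof.
move=> mX; pose comp x := [set y | connect (adjacent W) x y].
pose Pt := [set comp x | x : G].
have compE x C : C \in Pt -> (x \in C) = (C == comp x).
  case/imsetP => z _ ->; rewrite inE; apply/idP/eqP => [c|E]; last first.
    by have : x \in comp x; [rewrite inE connect0|rewrite -E inE].
  by apply/setP => u; rewrite !inE; apply: same_connect => //; exact: connect_adjC.
have count e : #|[set C in Pt | crosses e C]| = 2 * (e \notin closure W).
  have cP x : comp x \in Pt by apply: imset_f.
  have ce : (comp (ends e).1 == comp (ends e).2) = (e \in closure W).
    by rewrite -compE // !inE connect_adjC.
  have [ecl|ecl] := boolP (e \in closure W).
    apply/eqP; rewrite muln0 cards_eq0; apply/eqP/setP => C; rewrite !inE.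
    case CP: (C \in Pt) => //=; rewrite /crosses !compE //.
    by have /eqP -> := etrans ce ecl; rewrite eqxx.
  have -> : [set C in Pt | crosses e C] = [set comp (ends e).1; comp (ends e).2].
    apply/setP => C; rewrite !inE; case CP: (C \in Pt) => /=; last first.
      by apply/esym/negbTE/negP => /orP[]/eqP E; rewrite E cP in CP.
    rewrite /crosses !compE //; have [->|_] := eqVneq C (comp (ends e).1); first by rewrite ce (negPf ecl).
    by case: (C == _).
  by rewrite cards2 ce ecl.
have S F : \sum_(C in Pt) #|cutset F C| = 2 * #|F :\: closure W|.
  transitivity (\sum_(e in F) #|[set C in Pt | crosses e C]|).
    transitivity (\sum_(C in Pt) \sum_(e in F) crosses e C).
      apply: eq_bigr => C _; rewrite -sum1_card big_mkcond [RHS]big_mkcond.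
      by apply: eq_bigr => e _; rewrite !inE; case: (e \in F); case: (crosses e C).
    rewrite exchange_big; apply: eq_bigr => e _; rewrite -sum1_card big_mkcond [RHS]big_mkcond.
    by apply: eq_bigr => C _; rewrite !inE; case: (C \in Pt); case: (crosses e C).
  rewrite (eq_bigr (fun e => 2 * (e \notin closure W))) => [|e _]; last exact: count.
  rewrite -big_distrr /= -sum1_card big_mkcond [X in _ = 2 * X]big_mkcond; congr (2 * _).
  by apply: eq_bigr => e _; rewrite !inE; case: (e \in F); case: (connect _ _ _).
have h : \sum_(C in Pt) #|cutset setT C| <= 2 * \sum_(C in Pt) #|cutset [set e | crosses e X] C|.
  rewrite big_distrr; apply: leq_sum => C _; apply: leq_trans (mX C) _.
  rewrite leq_mul2l subset_leq_card ?orbT //; apply/subsetP => e; rewrite !inE.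
  by rewrite andbC.
by move: h; rewrite !S setTD leq_mul2l.
Qed.

Variables (a b N : nat) (C : 'I_N -> {set edge G}).
Hypotheses (EN : N = 2 * a + b) (cC : forall i, connected (C i)).
Hypothesis dC : forall i j, i != j -> [disjoint C i & C j].

Lemma sum_card_disjoint (I : finType) (F : I -> {set edge G}) D :
  (forall i j, i != j -> [disjoint F i & F j]) -> (forall i, F i \subset D) ->
  \sum_i #|F i| <= #|D|.
Proof.
move=> dF FD; rewrite -sum1_card.
apply: (@leq_trans (\sum_(e in D) \sum_i (e \in F i))).
  rewrite exchange_big /=; apply: eq_leq; apply: eq_bigr => i _; rewrite -sum1_card.
  rewrite big_mkcond [RHS]big_mkcond; apply: eq_bigr => e _.
  by case eF: (e \in F i); [rewrite (subsetP (FD i))|case: ifP].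
apply: leq_sum => e _; have [i ei|no] := pickP (fun i => e \in F i); last first.
  by rewrite big1 // => i _; rewrite no.
rewrite (bigD1 i) //= ei big1 // => k ki; rewrite (disjointFr (dF i k _)) //.
by rewrite eq_sym.
Qed.

(** Each of the [N] disjoint connected sets must make up the rank deficiency of [W] with its own
    edges outside [W]. *)
Lemma outside_card W : N * (#|G|.-1 - rk W) <= #|~: W|.
Proof.
apply: leq_trans (_ : \sum_i #|C i :\: W| <= _); last first.
  apply: sum_card_disjoint => [i j ij|i].
    exact: disjointWl (subsetDl _ _) (disjointWr (subsetDl _ _) (dC ij)).
  by rewrite -setTD setSD ?subsetT.
rewrite -[X in X * _]card_ord -sum_nat_const; apply: leq_sum => i _.
have := rk_connected (cC i); have := rkU W (C i); have := rk_mono (subsetUr W (C i)).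
by move: (rk _) (rk _) (rk _); lia.
Qed.

Lemma packing X (S : {set edge G}) : max_cut X -> (forall e, e \in S -> ~~ crosses e X) ->
  #|S| <= a ->
  exists Y : 'I_a + 'I_b -> {set edge G}, [/\ forall i j, i != j -> [disjoint Y i & Y j],
    forall i, connected (Y i), forall i e, e \in Y (inl i) -> crosses e X &
    forall j, [disjoint Y (inr j) & S]].
Proof.
move=> mX SX Sa; pose B := [set e | crosses e X].
pose allowed (i : 'I_a + 'I_b) := if i is inl _ then B else ~: S.
have [||||Y [dY hY]] := @matroid_partition (edge G) ('I_a + 'I_b)%type
    (fun i U => rk (U :&: allowed i)) (fun=> #|G|.-1).
- by move=> i U D UD; apply/rk_mono/setSI.
- move=> i U D; have := rk_submod (U :&: allowed i) (D :&: allowed i).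
  by rewrite setIACA setIid -setIUl.
- by move=> i U; exact: rk_leq.
- move=> U; rewrite !big_sumType /= !sum_nat_const !card_ord.
  have B1 := rk_leq (U :&: B); have B2 := rk_leq (U :&: ~: S).
  have h1 := outside_card (U :&: ~: S); have h2 := outside_card (closure (U :&: B)).
  have h3 := max_cut_closure (U :&: B) mX.
  have h4 : #|B :\: closure (U :&: B)| <= #|~: U|.
    apply: subset_leq_card; apply/subsetP => e; rewrite in_setD => /andP[ne eB].
    rewrite in_setC; apply: contra ne => eU.
    by rewrite inE connect_ends // inE eU.
  have h5 : #|~: (U :&: ~: S)| <= #|~: U| + #|S|.
    by rewrite setCI setCK cardsU leq_subr.
  rewrite rk_closure in h2.
  move: B1 B2 h1 h2 (leq_trans h3 (leq_mul (leqnn 2) h4)) h5 Sa; rewrite EN -/B.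
  move: (rk _) (rk _) (#|G|.-1) #|~: U| #|S| #|~: _| #|~: _| => r1 r2 n u s c1 c2.
  move=> B1 B2 h1 h2 h6 h5 sa.
  have [u1 E1] : exists u1, n = r1 + u1 by exists (n - r1); lia.
  have [u2 E2] : exists u2, n = r2 + u2 by exists (n - r2); lia.
  have e1 : n - r1 = u1 by lia.
  have e2 : n - r2 = u2 by lia.
  rewrite e1 e2 in h1 h2.
  have f1 : a * n = a * r2 + a * u2 by rewrite E2 mulnDr.
  have f2 : b * n = b * r1 + b * u1 by rewrite E1 mulnDr.
  suff : a * u2 + b * u1 <= u by move: f1 f2; clear; lia.
  move: h1 h2 h6 h5 sa; clear => h1 h2 h6 h5 sa.
  (* [u2] and [u1] are the rank deficiencies of [U :&: B] and [U :&: ~: S], with N u2 <= 2u and N u1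
     <= u + s. If 2u1 <= u2, then a u2 + b u1 <= N u2 / 2; otherwise it is at most N u1 - a, and s
     <= a finishes. *)
  have [le|lt] := leqP (2 * u1) u2.
    have : b * (2 * u1) <= b * u2 by rewrite leq_mul2l le orbT.
    by move: h2 h6; rewrite mulnDl -mulnA; clear; lia.
  have : a * (u2 + 1) <= a * (2 * u1) by rewrite leq_mul2l addn1 lt orbT.
  by move: h1 h5 sa; rewrite mulnDl mulnDr -mulnA muln1; clear; lia.
exists (fun i => Y i :&: allowed i); split.
- by move=> i k ik; apply: disjointWl (subsetIl _ _) (disjointWr (subsetIl _ _) (dY i k ik)).
- by move=> i; apply: connected_rk; exact: hY.
- by move=> i e; rewrite !inE => /andP[].
- by move=> k /=; rewrite disjoints_subset subsetIr.
Qed.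

End Packing.

(** * The factor of the Eulerian part *)

Section EulerianFactor.
Variable G : multigraph.
Implicit Types (F P T D : {set edge G}) (A X : {set G}) (v : G) (e : edge G).

Lemma tree_connectedS m F D : F \subset D -> tree_connected m F -> tree_connected m D.
Proof. by move=> FD [T [TF sT dT]]; exists T; split=> // i; exact: subset_trans (TF i) FD. Qed.

Lemma degreeU F D v : [disjoint F & D] -> degree (F :|: D) v = (degree F v + degree D v)%N.
Proof. by move=> d; rewrite !degreeE -bigU //; apply: eq_bigl => e; rewrite !inE. Qed.

Lemma eulerian_factor (m m0 : nat) P (root : G) : (0 < m + m0)%N ->
  (forall v, ~~ odd (degree P v)) ->
  (forall A, A != set0 -> A != setT -> ((m + m0).*2 <= #|cutset P A|.+1)%N) ->
  exists F, [/\ F \subset P, tree_connected m F, tree_connected m0 (P :\: F) &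
    forall v, - 2 * m0%:Z <= 2 * (degree F v)%:Z - (degree P v)%:Z <= 2 * m%:Z].
Proof.
move=> m_gt0 ev cutP.
have [|s [d [or bal]]] := @euler_orientation _ _ (@ends G) P.
  by move=> v; rewrite -[X in odd X]degreeE.
have crossE e A : e \in P -> crosses e A = ((s e \in A) != (d e \in A)).
  by move=> /or; rewrite /oriented /crosses => /orP[] /eqP->//=; rewrite eq_sym.
have S (g : edge G -> G) A : (\sum_(e in P) (g e \in A) = \sum_(v in A) \sum_(e in P) (g e == v))%N.
  rewrite exchange_big; apply: eq_bigr => e _ /=.
  rewrite [RHS]big_mkcond (bigD1 (g e)) //= eqxx big1 ?addn0; first by case: ifP.
  by move=> v vg; rewrite eq_sym (negPf vg); case: ifP.
have indegP A : A != set0 -> root \notin A -> (m + m0 <= indeg s d P A)%N.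
  move=> A0 rA; have AT : A != setT by apply: contraNneq rA => ->; rewrite inE.
  have b : (\sum_(e in P) (s e \in A) = \sum_(e in P) (d e \in A))%N.
    by rewrite !S; apply: eq_bigr => v _; exact: bal.
  have c : (#|cutset P A| + 2 * \sum_(e in P) (d e \in A) =
      2 * indeg s d P A + (\sum_(e in P) (s e \in A) + \sum_(e in P) (d e \in A)))%N.
    rewrite indegE !big_distrr /= -!big_split /=.
    have -> : #|cutset P A| = (\sum_(e in P) crosses e A)%N.
      rewrite -sum1_card big_mkcond [RHS]big_mkcond; apply: eq_bigr => e _.
      by rewrite !inE; case: (e \in P); case: (crosses e A).
    rewrite -big_split; apply: eq_bigr => e eP /=; rewrite /enters (crossE e A eP).
    by case: (s e \in A); case: (d e \in A).
  (* A balanced cut is twice its indegree, so the bound 2(m+m0)-1 already gives indegree m+m0. *)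
  by have := cutP A A0 AT; move: b c; rewrite -mul2n; clear; lia.
have [Tb [TbP aTb dTb]] := branchings indegP.
have connT i : connected (Tb i).
  have [h _] := aTb i.
  have hA A : A != set0 -> root \notin A -> exists2 e, e \in Tb i & crosses e A.
    move=> A0 rA; have /card_gt0P[e] := h A A0 rA; rewrite inE => /andP[eT].
    rewrite /enters => /andP[sA dA]; exists e => //.
    by rewrite (crossE e A (subsetP (TbP i) e eT)) (negPf sA) dA.
  apply/connectedP => A A0 AT; have [rA|rA] := boolP (root \in A); last exact: hA.
  have [||e eT ce] := hA (~: A); last first.
  - by exists e => //; move: ce; rewrite /crosses !inE; do 2!case: (_ \in A).
  - by rewrite inE rA.
  - by rewrite -setCT (inj_eq (@setC_inj _)).
pose T1 := \bigcup_(i < m) Tb (lshift m0 i); pose T2 := \bigcup_(i < m0) Tb (rshift m i).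
have id1 v : (\sum_(e in T1) (d e == v) <= m)%N.
  rewrite partition_disjoint_bigcup /=; last first.
    by move=> i k ik; apply: dTb; rewrite (inj_eq (@lshift_inj _ _)).
  rewrite -[X in (_ <= X)%N]card_ord -sum1_card; apply: leq_sum => i _.
  by have [_] := aTb (lshift m0 i); apply.
have id2 v : (\sum_(e in T2) (d e == v) <= m0)%N.
  rewrite partition_disjoint_bigcup /=; last first.
    by move=> i k ik; apply: dTb; rewrite (inj_eq (@rshift_inj _ _)).
  rewrite -[X in (_ <= X)%N]card_ord -sum1_card; apply: leq_sum => i _.
  by have [_] := aTb (rshift m i); apply.
have T1P : T1 \subset P by apply/bigcupsP.
have T2P : T2 \subset P by apply/bigcupsP.
have dT : [disjoint T1 & T2].
  rewrite -setI_eq0; apply/eqP/setP => e; rewrite !inE; apply/negbTE/negP.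
  case/andP => /bigcupP[i _ ei] /bigcupP[k _ ek].
  have := dTb (lshift m0 i) (rshift m k); rewrite eq_lrshift => /(_ isT) dd.
  by rewrite (disjointFr dd ei) in ek.
have [F [TF FP dF imbF]] := balanced_factor bal T1P T2P dT id1 id2 m_gt0.
exists F; split=> //.
- apply: (tree_connected_of_connected (C := fun i => Tb (lshift m0 i))) => //.
  + by move=> i; apply: subset_trans TF; apply: (bigcup_sup i).
  + by move=> i k ik; apply: dTb; rewrite (inj_eq (@lshift_inj _ _)).
- apply: (tree_connected_of_connected (C := fun i => Tb (rshift m i))) => //.
  + move=> i; have T2i : Tb (rshift m i) \subset T2 by apply: (bigcup_sup i).
    rewrite subsetD (subset_trans T2i T2P) disjoint_sym.
    exact: disjointWr T2i dF.
  + by move=> i k ik; apply: dTb; rewrite (inj_eq (@rshift_inj _ _)).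
- move=> v; have := imbF v; suff -> : imb s d P F v = 2 * (degree F v)%:Z - (degree P v)%:Z by [].
  have incE e : e \in P -> incsd s d e v = (inc e v)%:Z.
    by move=> /or; rewrite /oriented /incsd /inc PoszD => /orP[] /eqP->//=; rewrite addrC.
  rewrite !degreeE !(big_morph Posz PoszD (erefl _)) mulr_sumr /imb.
  rewrite [X in _ = X - _](_ : _ = \sum_(e in P) (if e \in F then 2 * (inc e v)%:Z else 0)).
    rewrite -sumrB; apply: eq_bigr => e eP; rewrite incE // /sg.
    by case: (e \in F); ring.
  rewrite [LHS]big_mkcond [RHS]big_mkcond; apply: eq_bigr => e _.
  by case eF: (e \in F); [rewrite (subsetP FP)|case: ifP].
Qed.

End EulerianFactor.

(** * From modulo orientations to factors of a bipartite graph *)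

Lemma subset_card (T : finType) (A : {set T}) n : (n <= #|A|)%N ->
  exists2 B : {set T}, B \subset A & #|B| = n.
Proof.
move=> nA; exists [set x in take n (enum A)].
  by apply/subsetP => x; rewrite inE => /mem_take; rewrite mem_enum.
rewrite cardsE (card_uniqP _) ?take_uniq ?enum_uniq // size_takel //.
by rewrite -cardE.
Qed.

Section BipartiteFactor.
Variables (G : multigraph) (X : {set G}).
Implicit Types (A : {set G}) (D J S : {set edge G}) (u v : G) (e : edge G).

Definition side v : int := if v \in X then 1 else -1.
Definition jmul D u v : int := #|[set e in D | joins e u v]|%:Z.

Lemma jmulE D u v : jmul D u v = \sum_(e in D) (joins e u v)%:Z.
Proof.
rewrite /jmul -sum1_card (big_morph Posz PoszD (erefl _)) big_mkcond [RHS]big_mkcond.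
by apply: eq_bigr => e _; rewrite !inE; case: (e \in D); case: (joins e u v).
Qed.

Lemma joins_arc e u v : (ends e).1 != (ends e).2 ->
  (joins e u v)%:Z = arc (ends e).1 (ends e).2 u v + arc (ends e).2 (ends e).1 u v.
Proof.
rewrite /joins /arc; case: (ends e) => x y /= xy; rewrite !xpair_eqE.
rewrite (eq_sym x u) (eq_sym y v) (eq_sym x v) (eq_sym y u) (andbC (v == x)).
have [/andP[/eqP-> /eqP->]|_] := boolP ((u == x) && (v == y)); last by rewrite add0r.
by rewrite (negPf xy).
Qed.

Lemma crosses_ends e A : crosses e A -> (ends e).1 != (ends e).2.
Proof. by rewrite /crosses; apply: contraNneq => ->. Qed.

Lemma cut_jmul D A : (forall e, e \in D -> crosses e X) -> cut (jmul D) setT A = #|cutset D A|%:Z.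
Proof.
move=> DX; rewrite /cut.
have -> : \sum_(u in A) \sum_(v in setT :\: A) jmul D u v =
    \sum_(e in D) \sum_(u in A) \sum_(v in setT :\: A) (joins e u v)%:Z.
  rewrite [RHS]exchange_big /=; apply: eq_bigr => u _; rewrite [RHS]exchange_big /=.
  by apply: eq_bigr => v _; rewrite jmulE.
rewrite -sum1_card (big_morph Posz PoszD (erefl _)) big_mkcond [RHS]big_mkcond.
apply: eq_bigr => e _; rewrite inE; case eD: (e \in D) => //=.
rewrite (eq_bigr (fun u => \sum_(v in setT :\: A) arc (ends e).1 (ends e).2 u v +
   \sum_(v in setT :\: A) arc (ends e).2 (ends e).1 u v)); last first.
  move=> u _; rewrite -big_split; apply: eq_bigr => v _.
  by rewrite joins_arc // (crosses_ends (DX e eD)).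
rewrite big_split /= !sum_arc !inE !andbT /crosses.
by do 2!case: (_ \in A).
Qed.

Lemma degree_jmul D v : (forall e, e \in D -> crosses e X) ->
  (degree D v)%:Z = \sum_(u | (u \in X) != (v \in X)) jmul D v u.
Proof.
move=> DX; rewrite degreeE (big_morph Posz PoszD (erefl _)).
rewrite (eq_bigr (fun u => \sum_(e in D) (joins e v u)%:Z)); last by move=> u _; rewrite jmulE.
rewrite exchange_big; apply: eq_bigr => e eD /=.
have ce := DX e eD; have ne := crosses_ends ce.
have pE y : \sum_(u | (u \in X) != (v \in X)) (u == y)%:Z = ((y \in X) != (v \in X))%:Z :> int.
  rewrite big_mkcond (bigD1 y) //= eqxx big1 ?addr0; first by case: ifP.
  by move=> u /negPf->; case: ifP.
rewrite (eq_bigr (fun u => (v == (ends e).1)%:Z * (u == (ends e).2)%:Z +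
    (v == (ends e).2)%:Z * (u == (ends e).1)%:Z)); last first.
  by move=> u _; rewrite joins_arc // /arc; do 4!case: (_ == _).
rewrite big_split /= -!mulr_sumr !pE /inc PoszD.
move: ce; rewrite /crosses ![_ == v]eq_sym.
have [->|_] := eqVneq v (ends e).1; have [E|_] := eqVneq _ (ends e).2; rewrite ?mul0r ?mul1r //=.
- by rewrite E eqxx.
- by rewrite eq_sym => ->.
- by rewrite E => ->.
Qed.

Lemma cards_sumZ (D : {set edge G}) (P : pred (edge G)) :
  #|[set e in D | P e]|%:Z = \sum_(e in D) (P e)%:Z.
Proof.
rewrite -sum1_card (big_morph Posz PoszD (erefl _)) big_mkcond [RHS]big_mkcond.
by apply: eq_bigr => e _; rewrite !inE; case: (e \in D); case: (P e).
Qed.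

(* Each edge of [S] is split into two edges to the root, oriented according to whether it is taken. *)
Lemma bipartite_factor (k : nat) J S (FS : {set edge G}) (g : G -> int) : (2 <= k)%N ->
  (forall e, e \in J -> crosses e X) -> (forall e, e \in S -> ~~ crosses e X) ->
  (forall A, A != set0 -> A != setT -> (3 * k - 3 <= #|cutset J A|)%N) ->
  FS \subset S -> (#|S| <= k.-1)%N ->
  dvd2k k%:Z (\sum_v side v * (2 * g v - (degree J v)%:Z)) ->
  exists2 H : {set edge G}, H \subset J & forall v, (k%:Z %| (degree H v)%:Z - g v)%Z /\
    `|2 * (degree H v)%:Z - (degree J v)%:Z + (2 * (degree FS v)%:Z - (degree S v)%:Z)|
      <= 2 * k%:Z - 1.
Proof.
move=> k2 JX SX cutJ FSS Sk sumg; have k2' : 2 <= k%:Z :> int by [].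
(* The sign follows [side]: a chosen edge inside [X] gives two arcs to the extra vertex, a chosen
   edge outside [X] two arcs from it, and unchosen edges the reverse. *)
pose pos e := (e \in FS) == ((ends e).1 \in X).
pose t v := side v * (2 * g v - (degree J v)%:Z).
pose p v : int := \sum_(e in S) (if pos e then (inc e v)%:Z else 0).
pose q v : int := \sum_(e in S) (if pos e then 0 else (inc e v)%:Z).
have cE v : p v - q v = side v * (2 * (degree FS v)%:Z - (degree S v)%:Z).
  have -> : (degree FS v)%:Z = \sum_(e in S) (e \in FS)%:Z * (inc e v)%:Z.
    rewrite degreeE (big_morph Posz PoszD (erefl _)) big_mkcond [RHS]big_mkcond.
    apply: eq_bigr => e _; case eF: (e \in FS); last by case: ifP; rewrite ?mul0r.
    by rewrite (subsetP FSS) // mul1r.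
  rewrite degreeE (big_morph Posz PoszD (erefl _)) [in RHS]mulr_sumr -[in RHS]sumrB [in RHS]mulr_sumr /p /q -sumrB.
  apply: eq_bigr => e /SX; rewrite /crosses negbK => /eqP E.
  rewrite /side /pos /inc.
  have [vX|vX] := boolP (v \in X); have [aX|aX] := boolP ((ends e).1 \in X).
  - by case: (e \in FS) => /=; ring.
  - have n1 : (ends e).1 == v = false by apply: contraNF aX => /eqP->.
    have n2 : (ends e).2 == v = false by apply: contraNF aX => /eqP E'; rewrite E E'.
    by rewrite n1 n2; case: (_ == _) => /=; ring.
  - have n1 : (ends e).1 == v = false by apply: contraNF vX => /eqP<-.
    have n2 : (ends e).2 == v = false by apply: contraNF vX => /eqP<-; rewrite -E.
    by rewrite n1 n2; case: (_ == _) => /=; ring.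
  - by case: (e \in FS) => /=; ring.
have wE v : p v + q v = (degree S v)%:Z.
  rewrite degreeE (big_morph Posz PoszD (erefl _)) /p /q -big_split; apply: eq_bigr => e _ /=.
  by case: ifP; rewrite ?addr0 ?add0r.
have p0 v : 0 <= p v by apply: sumr_ge0 => e _; case: ifP.
have q0 v : 0 <= q v by apply: sumr_ge0 => e _; case: ifP.
have parJ A : (2 %| vsum t A - #|cutset J A|%:Z)%Z.
  have -> : vsum t A - #|cutset J A|%:Z = 2 * vsum (fun v => side v * g v) A
     + (\sum_(v in A) (1 - side v) * (degree J v)%:Z)
     - \sum_(e in J) (((ends e).1 \in A)%:Z + ((ends e).2 \in A)%:Z + (crosses e A)%:Z).
    rewrite big_split /= -[X in _ - (_ + X)]cards_sumZ -/(cutset J A).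
    have -> : \sum_(e in J) (((ends e).1 \in A)%:Z + ((ends e).2 \in A)%:Z) = \sum_(v in A) (degree J v)%:Z.
      rewrite (eq_bigr (fun v => \sum_(e in J) (inc e v)%:Z)); last first.
        by move=> v _; rewrite degreeE (big_morph Posz PoszD (erefl _)).
      rewrite exchange_big; apply: eq_bigr => e _ /=.
      by rewrite -(big_morph Posz PoszD (erefl _)) sum_inc PoszD.
    rewrite opprD addrA -vsumZ; congr (_ - _); rewrite /vsum -big_split -sumrB.
    by apply: eq_bigr => v _ /=; rewrite /t; ring.
  apply: rpredB; [apply: rpredD|].
  - by rewrite dvdz_mulr.
  - apply: rpred_sum => v _; rewrite /side; case: ifP => _; first by rewrite subrr mul0r.
    by rewrite dvdz_mulr.
  - by apply: rpred_sum => e _; rewrite /crosses; do 2!case: (_ \in A).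
have wA A : vsum p A + vsum q A = vsum (fun v => (degree S v)%:Z) A.
  by rewrite -vsumD; apply: eq_bigr => v _; rewrite wE.
have I : inst k%:Z setT (jmul J) t p q set0.
  split=> //.
  - by move=> u v; rewrite /jmul; congr Posz; apply: eq_card => e; rewrite !inE joinsC.
  - by move=> A _; rewrite cut_jmul.
  - by apply: dvd2k_eq sumg _; apply: eq_bigl => v; rewrite inE.
  (* The extra vertex has degree 2|S| <= 2k-2, within the root bound whatever its residue. *)
  - have -> : vsum p setT + vsum q setT = 2 * #|S|%:Z.
      rewrite wA /vsum -(big_morph Posz PoszD (erefl _)).
      rewrite (eq_bigl predT) => [|v]; last by rewrite inE.
      by rewrite sum_degree PoszM.
    have := nrm_ge0 k2' (vsum p setT - vsum q setT).
    by move: Sk k2; clear; lia.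
  - move=> A _ A0 AT _; rewrite cut_jmul //.
    (* The required bound reaches 3k-2 only at distance k. Degree and distance have equal parity, so
       3k-3 suffices even then. *)
    have c1 := cutJ A A0 AT; have c2 := parJ A.
    have n1 := nrm_lek k2' (vsum t A + vsum p A - vsum q A).
    have n2 := nrm_odd k2' (vsum t A + vsum p A - vsum q A).
    have w0 : 0 <= vsum p A + vsum q A by rewrite addr_ge0 // vsum_ge0.
    by move: c1 c2 n1 n2 w0 k2; clear; lia.
  - by left.
have [x [x0 xJ xnet xb]] := inst_solvable k2' I.
have {}xJ u v : u != v -> x u v + x v u = jmul J u v by apply: xJ; rewrite inE.
have /fin_all_exists2[D DJ cD] : forall w : G * G, exists2 D : {set edge G},
    D \subset [set e in J | joins e w.1 w.2] &
    (w.1 \in X -> w.2 \notin X -> #|D|%:Z = x w.1 w.2).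
  move=> [u v] /=; have [uX|uX] := boolP (u \in X); last by exists set0; rewrite ?sub0set.
  have [vX|vX] := boolP (v \in X); first by exists set0; rewrite ?sub0set.
  have uv : u != v by apply: contraNneq vX => <-.
  have [|B BJ cB] := @subset_card _ [set e in J | joins e u v] (absz (x u v)).
    by have := xJ u v uv; have := x0 u v; have := x0 v u; rewrite /jmul; clear; lia.
  by exists B => // _ _; rewrite cB; have := x0 u v; clear; lia.
pose H := [set e | [exists w : G * G, [&& w.1 \in X, w.2 \notin X & e \in D w]]].
have HJ : H \subset J.
  apply/subsetP => e; rewrite inE => /existsP[w /and3P[_ _ eD]].
  by have := subsetP (DJ w) e eD; rewrite inE => /andP[].
have HX e : e \in H -> crosses e X by move/(subsetP HJ); exact: JX.
have jH u v : u \in X -> v \notin X -> jmul H u v = x u v.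
  move=> uX vX; rewrite -(cD (u, v)) // /jmul; congr Posz; apply: eq_card => e.
  rewrite !inE; apply/andP/idP => [[/existsP[[u' v'] /and3P[/= u'X v'X eD]] je]|eD].
    have := subsetP (DJ _) e eD; rewrite inE /= => /andP[_ je'].
    suff [-> ->] : u = u' /\ v = v' by [].
    move: je je'; rewrite /joins => /orP[]/eqP-> /orP[]/eqP[E1 E2]; subst=> //;
    by [rewrite uX in v'X|rewrite u'X in vX].
  split; last by have := subsetP (DJ _) e eD; rewrite inE => /andP[].
  by apply/existsP; exists (u, v); rewrite /= uX vX.
have jC F u v : jmul F u v = jmul F v u.
  by rewrite /jmul; congr Posz; apply: eq_card => e; rewrite !inE joinsC.
have j0 u v : (u \in X) = (v \in X) -> jmul J u v = 0.
  move=> uv; rewrite jmulE big1 // => e /JX; case je: (joins e u v) => //.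
  by rewrite (joins_crosses X je) uv eqxx.
have netE v : net x setT v = side v * (2 * (degree H v)%:Z - (degree J v)%:Z).
  rewrite (degree_jmul _ HX) (degree_jmul _ JX) mulr_sumr -sumrB mulr_sumr /net.
  rewrite big_mkcond [RHS]big_mkcond; apply: eq_bigr => u _; rewrite inE /=.
  case: ifP => [ne|/negbFE/eqP E]; last first.
    have [->|uv] := eqVneq u v; first by rewrite subrr.
    by have := xJ u v uv; rewrite j0 //; have := x0 u v; have := x0 v u; clear; lia.
  have uv : u != v by apply: contraTneq ne => ->; rewrite eqxx.
  have := xJ u v uv; rewrite /side; have [vX|vX] := boolP (v \in X).
    rewrite vX in ne; rewrite (jC J v u) jH //; last by move: ne; case: (u \in X).
    by clear; lia.
  rewrite (negPf vX) in ne; rewrite (jC H) (jC J v u) jH //; last by move: ne; case: (u \in X).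
  by clear; lia.
have sideM v (n : int) : `|side v * n| = `|n| by rewrite /side; case: ifP; rewrite ?mul1r ?mulN1r ?normrN.
exists H => // v; split.
  have := xnet v (in_setT v); rewrite netE /t /dvd2k -mulrBr /side.
  have -> : 2 * (degree H v)%:Z - (degree J v)%:Z - (2 * g v - (degree J v)%:Z) = 2 * ((degree H v)%:Z - g v) by ring.
  by case: ifP => _; rewrite ?mul1r ?mulN1r ?dvdzN ?rpredN dvdz_mul2l.
by have := xb v (in_setT v); rewrite -addrA cE netE -mulrDr sideM.
Qed.

End BipartiteFactor.

(** * Signed degree sums and compatibility *)

Section Assembly.
Variable G : multigraph.
Implicit Types (A X : {set G}) (F D J P S : {set edge G}) (v : G) (e : edge G).

(** Crossing edges cancel; each other edge counts twice with the sign of its side. *)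
Lemma sum_side_degree X F : \sum_v side X v * (degree F v)%:Z =
  2 * ((edges_within F X)%:Z - (edges_within F (~: X))%:Z).
Proof.
pose se e := side X (ends e).1 + side X (ends e).2.
have -> : \sum_v side X v * (degree F v)%:Z = \sum_(e in F) se e.
  rewrite (eq_bigr (fun v => \sum_(e in F) side X v * (inc e v)%:Z)) => [|v _]; last first.
    by rewrite degreeE (big_morph Posz PoszD (erefl _)) mulr_sumr.
  rewrite exchange_big; apply: eq_bigr => e _ /=; rewrite /se.
  rewrite (eq_bigr (fun v => (if v == (ends e).1 then side X v else 0) +
      (if v == (ends e).2 then side X v else 0))) => [|v _]; last first.
    rewrite /inc PoszD mulrDr (eq_sym v (ends e).1) (eq_sym v (ends e).2).
    by do 2!case: (_ == v); rewrite ?mulr0 ?mulr1.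
  by rewrite big_split -!big_mkcond !big_pred1_eq.
have card A : (edges_within F A)%:Z =
    \sum_(e in F) ((((ends e).1 \in A) && ((ends e).2 \in A)) : nat)%:Z.
  rewrite /edges_within -sum1_card (big_morph Posz PoszD (erefl _)).
  rewrite big_mkcond [RHS]big_mkcond.
  by apply: eq_bigr => e _; rewrite inE; case: (e \in F) => //=; case: ifP.
rewrite !card -sumrB mulr_sumr; apply: eq_bigr => e _; rewrite /se /side !inE.
by do 2!case: (_ \in X).
Qed.

Lemma edges_within_inner X S : (forall e, e \in S -> ~~ crosses e X) ->
  (edges_within S X + edges_within S (~: X))%N = #|S|.
Proof.
move=> SX; rewrite /edges_within -[RHS](cardsID [set e in S | (ends e).1 \in X]).
congr (_ + _)%N; apply: eq_card => e; rewrite !inE; have := SX e; rewrite /crosses;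
by case: (e \in S) => //= /(_ isT); do 2!case: (_ \in X).
Qed.

Lemma inner_choice X S (w : int) : - (edges_within S (~: X))%:Z <= w <= (edges_within S X)%:Z ->
  exists2 D : {set edge G}, D \subset S & (edges_within D X)%:Z - (edges_within D (~: X))%:Z = w.
Proof.
have sub A n : (n <= edges_within S A)%N -> exists2 D : {set edge G}, D \subset S & 
    edges_within D A = n /\ edges_within D (~: A) = 0%N.
  move=> /subset_card[D /subsetP DS Dn]; exists D.
    by apply/subsetP => e /DS; rewrite inE => /andP[].
  split.
    rewrite -Dn; apply: eq_card => e; rewrite !inE.
    by case eD: (e \in D) => //=; have := DS e eD; rewrite inE => /andP[].
  apply/eqP; rewrite cards_eq0; apply/eqP/setP => e; rewrite !inE.
  by case eD: (e \in D) => //=; have := DS e eD; rewrite inE => /and3P[_ -> _].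
move=> /andP[wY wX]; have [w0|w0] := lerP 0 w.
  have [|D DS [DX DY]] := sub X `|w|%N; first by move: w0 wX; clear; lia.
  by exists D => //; rewrite DX DY; move: w0; clear; lia.
have [|D DS [DX DY]] := sub (~: X) `|w|%N; first by move: w0 wY; clear; lia.
by exists D => //; rewrite setCK in DY; rewrite DX DY; move: w0; clear; lia.
Qed.

Lemma Zp_intr_eq0 k (n : int) : (2 <= k)%N -> (n%:~R == 0 :> 'Z_k) = (k%:Z %| n)%Z.
Proof.
move=> k2; have kk : k.-2.+2 = k by case: k k2 => [|[|]].
suff nat_case (a : nat) : (a%:R == 0 :> 'Z_k) = (k%:Z %| a%:Z)%Z.
  by case: n => a; rewrite ?NegzE ?mulrNz ?oppr_eq0 ?dvdzN -pmulrn nat_case.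
rewrite -val_eqE /= val_Zp_nat //.
Qed.

(** Take z = x in the first alternative of compatibility and z = -y in the second: both become one
    interval around zero. *)
Lemma compatible_shift k (f : G -> 'Z_k) X : (2 <= k)%N -> compatible f ->
  exists2 z : int, - (edges_within setT (~: X))%:Z <= z <= (edges_within setT X)%:Z &
    (k%:Z %| \sum_v side X v * (val (f v))%:Z - 2 * z)%Z.
Proof.
move=> k2 /(_ X (~: X)); rewrite setUCr -setI_eq0 setICr eqxx => /(_ erefl isT) cf.
have E z : \sum_(v in X) f v - \sum_(v in ~: X) f v = (2 * z)%:~R ->
    (k%:Z %| \sum_v side X v * (val (f v))%:Z - 2 * z)%Z.
  move=> Ez; rewrite -Zp_intr_eq0 // rmorphB /= -Ez subr_eq0; apply/eqP.
  rewrite rmorph_sum (bigID (mem X)) /= -sumrN; congr (_ + _); last first.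
    rewrite [RHS](eq_bigl (fun v => v \notin X)) => [|v]; last by rewrite inE.
    by apply: eq_bigr => v vX; rewrite /side (negPf vX) mulN1r rmorphN /= -pmulrn natr_Zp.
  by apply: eq_bigr => v vX; rewrite /side vX mul1r -pmulrn natr_Zp.
case: cf => [[x xX Ex]|[y yY Ey]].
  exists x%:Z; first by move: xX; clear; lia.
  apply: E; rewrite -Ex opprB addrC subrK -PoszM -pmulrn natrM //.
exists (- y%:Z); first by move: yY; clear; lia.
apply: E; rewrite Ey addrC addKr mulrN -PoszM rmorphN /= -pmulrn natrM //.
Qed.

End Assembly.

(** * Splitting the edges into an inner, an Eulerian and a crossing part *)

Section Partition.
Variable G : multigraph.
Implicit Types (A X : {set G}) (F D J P S : {set edge G}) (v : G) (e : edge G).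

Lemma connected_cut F A : connected F -> A != set0 -> A != setT -> (0 < #|cutset F A|)%N.
Proof.
move=> /connectedP cF A0 AT; have [e eF eA] := cF A A0 AT.
by rewrite card_gt0; apply/set0Pn; exists e; rewrite inE eF.
Qed.

Lemma edge_partition k h (C : 'I_(2 * h + 6 * k - 5) -> {set edge G}) : (2 <= k)%N -> (0 < h)%N ->
  (forall i, connected (C i)) -> (forall i j, i != j -> [disjoint C i & C j]) ->
  exists X S P J, [/\ [/\ S :|: (P :|: J) = setT, [disjoint S & P :|: J] & [disjoint P & J]],
    forall e, e \in S -> ~~ crosses e X, forall e, e \in J -> crosses e X,
    (#|S| <= k.-1)%N /\ (#|S| = k.-1 \/ forall e, e \notin S -> crosses e X) &
    [/\ forall v, ~~ odd (degree P v),
        forall A, A != set0 -> A != setT -> (h.*2 <= #|cutset P A|.+1)%N &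
        forall A, A != set0 -> A != setT -> (3 * k - 3 <= #|cutset J A|)%N]].
Proof.
move=> k2 h0 cC dC; have [X mX] := max_cut_exists G.
pose I : {set edge G} := [set e | ~~ crosses e X].
have [|S SI cS] := @subset_card _ I (minn k.-1 #|I|); first by rewrite geq_minr.
have SX e : e \in S -> ~~ crosses e X by move=> /(subsetP SI); rewrite inE.
have Sk : (#|S| <= k.-1)%N by rewrite cS geq_minl.
have Sk' : #|S| = k.-1 \/ forall e, e \notin S -> crosses e X.
  have [kI|Ik] := leqP k.-1 #|I|; first by left; rewrite cS; apply/minn_idPl.
  right=> e; rewrite -[crosses e X]negbK; apply: contraNN => eI.
  suff -> : S = I by rewrite inE.
  by apply/eqP; rewrite eqEcard SI cS leq_min leqnn andbT ltnW.
have EN : (2 * h + 6 * k - 5 = 2 * (3 * k - 2) + (2 * h - 1))%N by move: k2 h0; clear; lia.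
have Sa : (#|S| <= 3 * k - 2)%N by move: Sk k2; clear; lia.
have [Z [dZ cZ ZX ZS]] := packing EN cC dC mX SX Sa.
have a0 : (0 < 3 * k - 2)%N by move: k2; clear; lia.
pose i0 := Ordinal a0; pose W := \bigcup_i Z (inl i).
have WX e : e \in W -> crosses e X by move=> /bigcupP[i _]; exact: ZX.
pose P0 := ~: (S :|: W).
(* The join stays inside the factor [i0], so the other 3k-3 crossing factors remain whole in [J]. *)
have [Q QZ evQ] := parity_join P0 (cZ (inl i0)).
have QW : Q \subset W by apply: subset_trans QZ _; exact: bigcup_sup.
have SW e : e \in S -> e \in W = false by move=> eS; apply: contraTF (SX e eS) => /WX ->.
have dPQ : [disjoint P0 & Q].
  rewrite disjoint_sym disjoints_subset; apply/subsetP => e /(subsetP QW) eW.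
  by rewrite !inE eW orbT.
exists X, S, (P0 :|: Q), (W :\: Q); split=> //.
- split.
  + apply/setP => e; rewrite !inE; by case: (e \in S); case: (e \in W); case: (e \in Q).
  + rewrite disjoints_subset; apply/subsetP => e eS; rewrite !inE eS /= SW // andbF orbF.
    by apply: contraFN (SW e eS); exact: (subsetP QW).
  + rewrite disjoints_subset; apply/subsetP => e; rewrite !inE negb_or negb_and.
    by case: (e \in Q); case: (e \in W); rewrite ?andbF ?orbT ?orbF.
- by move=> e; rewrite !inE => /andP[_ /WX].
split.
- by move=> v; rewrite degreeU //; exact: evQ.
- move=> A A0 AT; pose D (j : 'I_(2 * h - 1)) := cutset (Z (inr j)) A.
  have : (\sum_j #|D j| <= #|cutset (P0 :|: Q) A|)%N.
    apply: sum_card_disjoint => [i j ij|j].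
      apply: disjointW (dZ (inr i) (inr j) _); last by rewrite (inj_eq (@inr_inj _ _)).
        by apply/subsetP => e; rewrite inE => /andP[].
      by apply/subsetP => e; rewrite inE => /andP[].
    apply/subsetP => e; rewrite !inE => /andP[eZ ->]; rewrite andbT.
    apply/orP; left; apply/negP => /orP[eS|/bigcupP[i _ eW]].
      by have := ZS j; rewrite disjoints_subset => /subsetP/(_ e eZ); rewrite inE eS.
    have := dZ (inl i) (inr j) isT; rewrite disjoints_subset => /subsetP/(_ e eW).
    by rewrite inE eZ.
  have : (\sum_(j < 2 * h - 1) 1 <= \sum_j #|D j|)%N.
    by apply: leq_sum => j _; exact: connected_cut.
  by rewrite sum1_card card_ord -mul2n; move: h0; clear; lia.
move=> A A0 AT; pose D (i : 'I_(3 * k - 2)) := if i == i0 then set0 else cutset (Z (inl i)) A.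
have : (\sum_i #|D i| <= #|cutset (W :\: Q) A|)%N.
  apply: sum_card_disjoint => [i j ij|i]; rewrite /D.
    case: ifP => _; first by rewrite -setI_eq0 set0I.
    case: ifP => _; first by rewrite -setI_eq0 setI0.
    apply: disjointW (dZ (inl i) (inl j) _); last by rewrite (inj_eq (@inl_inj _ _)).
      by apply/subsetP => e; rewrite inE => /andP[].
    by apply/subsetP => e; rewrite inE => /andP[].
  case: ifP => [_|/negbT ii]; first exact: sub0set.
  apply/subsetP => e; rewrite !inE => /andP[eZ ->]; rewrite andbT.
  apply/andP; split; last by apply/bigcupP; exists i.
  apply/negP => /(subsetP QZ) e0; have := dZ (inl i) (inl i0).
  rewrite (inj_eq (@inl_inj _ _)) => /(_ ii); rewrite disjoints_subset.
  by move=> /subsetP/(_ e eZ); rewrite inE e0.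
rewrite (bigD1 i0) //= {1}/D eqxx cards0 add0n.
have : (\sum_(i < 3 * k - 2 | i != i0) 1 <= \sum_(i | i != i0) #|D i|)%N.
  by apply: leq_sum => i ii; rewrite /D (negPf ii) connected_cut.
rewrite (eq_bigl (mem (predC1 i0))) // sum1_card cardC1 card_ord; move=> s1 s2; apply: leq_trans s2; apply: leq_trans s1; move: k2; clear; lia.
Qed.

End Partition.

(** * Combining the three parts of the factor *)

Lemma Zp_natr_eq k (a : nat) (x : 'Z_k) : (2 <= k)%N ->
  (k%:Z %| a%:Z - (val x)%:Z)%Z -> a%:R = x.
Proof.
move=> k2 dv; apply/eqP; rewrite -subr_eq0 -[x in _ - x]natr_Zp.
by have := Zp_intr_eq0 (a%:Z - (val x)%:Z) k2; rewrite dv rmorphB /= -!pmulrn => /eqP->.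
Qed.

Theorem theorem7p7 (m m0 : nat) (hm : (0 < m + m0)%N) (G : multigraph)
  (k : nat) (hk : (2 <= k)%N) (f : G -> 'Z_k) (hf : compatible f)
  (hG : tree_connected (2 * m + 2 * m0 + 6 * k - 5)%N [set: edge G]) :
  exists H : {set edge G},
    [/\ tree_connected m H,
        forall v : G, (degree H v)%:R = f v,
        tree_connected m0 (~: H)
      & forall v : G,
          ((degree [set: edge G] v)./2%:Z - (k%:Z - 1) - m0%:Z
             <= (degree H v)%:Z
             <= (uphalf (degree [set: edge G] v))%:Z + (k%:Z - 1) + m%:Z)].
Proof.
(* Without vertices there is no root for the branchings, but then every claim about vertices is
   vacuous. *)
have [root _|G0] := pickP (@predT G); last first.
  have tc n (F : {set edge G}) : tree_connected n F.
    apply: (tree_connected_of_connected (C := fun=> set0)) => [i|i x|i j _].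
    - exact: sub0set.
    - by have := G0 x.
    - by rewrite -setI_eq0 set0I.
  by exists set0; split=> // v; have := G0 v.
move: hG; rewrite -mulnDr => -[C [_ sC dC]].
have [|X [S [P [J [[UT dSPJ dPJ] SX JX [Sk Sfull] [Pev Pcut Jcut]]]]]] :=
  edge_partition hk hm _ dC.
  by move=> i; have [] := sC i.
have [F [FP tF tPF dF]] := eulerian_factor root hm Pev Pcut.
pose bal (D : {set edge G}) : int := (edges_within D X)%:Z - (edges_within D (~: X))%:Z.
have within0 (D : {set edge G}) A : (forall e, e \in D -> crosses e X) -> A = X \/ A = ~: X ->
    edges_within D A = 0%N.
  move=> DX AX; apply/eqP; rewrite cards_eq0; apply/eqP/setP => e; rewrite !inE.
  case eD: (e \in D) => //=; have := DX e eD; rewrite /crosses.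
  by case: AX => ->; rewrite ?inE; do 2!case: (_ \in X).
have bal0 (D : {set edge G}) : (forall e, e \in D -> crosses e X) -> bal D = 0.
  by move=> DX; rewrite /bal !within0 //; [right|left].
have [z zXY dz] := compatible_shift X hk hf.
have [w wXY dw] : exists2 w : int,
    - (edges_within S (~: X))%:Z <= w <= (edges_within S X)%:Z & (k%:Z %| z - bal F - w)%Z.
  case: Sfull => [cS|Sin].
    have kn0 : k%:Z != 0 by move: hk; clear; lia.
    (* The interval allowed for w contains |S|+1 = k integers, so it meets every residue; w is found
       by reduction from its left end. *)
    set t := z - bal F + (edges_within S (~: X))%:Z.
    exists ((t %% k%:Z)%Z - (edges_within S (~: X))%:Z).
      have := edges_within_inner SX; have := modz_ge0 t kn0.
      have : (t %% k%:Z)%Z < k%:Z by rewrite ltz_pmod //; move: hk; clear; lia.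
      by move: cS; clear; move: (_ %% _)%Z => r; lia.
    apply/dvdzP; exists (t %/ k%:Z)%Z; have := divz_eq t k%:Z; rewrite {1}/t.
    by move: (_ %% _)%Z (_ %/ _)%Z => r d; clear; lia.
  (* Now all edges outside [S] cross [X]: [F] contributes nothing, and the interval for [S] is the
     one that compatibility provides for all of [G]. *)
  exists z; last first.
    rewrite bal0 ?subr0 ?subrr ?dvdz0 // => e /(subsetP FP) eP; apply: Sin.
    by apply: contraL eP => eS; have := disjointFr dSPJ eS; rewrite inE => /norP[].
  have ES A : A = X \/ A = ~: X -> edges_within S A = edges_within setT A.
    move=> AX; apply: eq_card => e; rewrite !inE /=; case: (boolP (e \in S)) => //= /Sin.
    by rewrite /crosses; case: AX => ->; rewrite ?inE; do 2!case: (_ \in X).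
  by rewrite !ES //; [left|right].
have [D DS balD] := inner_choice wXY.
pose g v : int := (val (f v))%:Z - (degree F v)%:Z - (degree D v)%:Z.
have [|K KJ HK] := @bipartite_factor _ X k J S D g hk JX SX Jcut DS Sk.
  rewrite /dvd2k; have -> : \sum_v side X v * (2 * g v - (degree J v)%:Z) =
      2 * ((\sum_v side X v * (val (f v))%:Z - 2 * z) + 2 * (z - bal F - w)).
    rewrite (eq_bigr (fun v => 2 * (side X v * (val (f v))%:Z) - 2 * (side X v * (degree F v)%:Z) -
        2 * (side X v * (degree D v)%:Z) - side X v * (degree J v)%:Z)).
      rewrite !sumrB -!mulr_sumr !sum_side_degree -/(bal F) -/(bal D) -/(bal J) (bal0 J JX).
      by rewrite /bal balD; ring.
    by move=> v _; rewrite /g; ring.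
  by rewrite dvdz_mul2l // rpredD // dvdz_mull.
have FPJ : [disjoint F & K] by apply: disjointW dPJ.
have dDFK : [disjoint D & F :|: K] by apply: disjointW dSPJ => //; exact: setUSS.
have degH v : degree (D :|: (F :|: K)) v = (degree D v + (degree F v + degree K v))%N.
  by rewrite !degreeU.
exists (D :|: (F :|: K)); split.
- by apply: tree_connectedS tF; rewrite setUCA subsetUl.
- move=> v; apply: Zp_natr_eq => //; have [+ _] := HK v; rewrite degH.
  by congr (_ %| _)%Z; rewrite /g !PoszD; ring.
- apply: tree_connectedS tPF; apply/subsetP => e; rewrite !inE => /andP[eF eP].
  rewrite (negPf eF) /=; apply/norP; split.
    apply: contraL eP => /(subsetP DS) eS; have := disjointFr dSPJ eS.
    by rewrite inE => /norP[].
  by apply: contraL eP => /(subsetP KJ) eJ; rewrite (disjointFl dPJ eJ).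
(* Adding both estimates, 2d_H - d_G lies between -(2m0+2k-1) and 2m+2k-1; halving and rounding give
   the bounds. *)
move=> v; have [_] := HK v; have := dF v; rewrite degH -UT !degreeU //.
rewrite ler_norml; move: (degree F v) (degree D v) (degree K v) (degree S v) (degree P v) (degree J v).
by clear; move=> dF dD dK dS dP dJ; rewrite !PoszD; lia.
Qed.
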